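(* Let $M$ be a finitely generated multigraded $S$-module with minimal multigraded free resolution $\mathbb{F}:\ 0\to F_p \xrightarrow{\varphi_p} F_{p-1}\to \cdots \to F_1 \xrightarrow{\varphi_1} F_0\to 0$, where $F_i=\bigoplus_j S(-\mathbf{a}_{ij})$, and let $\mathbb{C}$ be the double complex attached to $\mathbb{F}$ as described in the context, with $C_{ij}=G_{ij}$, row differentials $d$ and column differentials $\partial$. Then the total complex $T(\mathbb{C})$ of $\mathbb{C}$ is a minimal multigraded free resolution of $M^*$ over $S^*$.
   Context: Let $K$ be a field and $S=K[x_1,\ldots,x_n]$. Fix positive integers $i_1,\ldots,i_n$, let $S^*$ be the polynomial ring over $K$ in the variables $x_{jk}$, $1\le j\le n$, $1\le k\le i_j$, and set $P_j=(x_{j1},\ldots,x_{ji_j})\subseteq S^*$. For $\mathbf{a}=(a(1),\ldots,a(n))\in\mathbb{N}^n$ put $(\mathbf{x}^{\mathbf{a}})^*=P_1^{a(1)}\cdots P_n^{a(n)}\subseteq S^*$. Polynomial rings carry the standard multigrading (by exponent vectors). Multigraded $S$-modules are understood to be $\mathbb{N}^n$-graded, so all shifts lie in $\mathbb{N}^n$; free modules are finitely generated. Expansion functor. For $F=\bigoplus_i S(-\mathbf{a}_i)$ put $F^*=\bigoplus_i(\mathbf{x}^{\mathbf{a}_i})^*$. A multigraded homomorphism $\alpha:\bigoplus_{i} S(-\mathbf{a}_i)\to\bigoplus_{j} S(-\mathbf{b}_j)$ has components $f\mapsto \lambda_{ji}\mathbf{x}^{\mathbf{a}_i-\mathbf{b}_j}f$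 with $\lambda_{ji}\in K$ and $\lambda_{ji}=0$ if $\mathbf{x}^{\mathbf{b}_j}\nmid\mathbf{x}^{\mathbf{a}_i}$; the matrix $[\lambda_{ji}]$ is the monomial matrix expression of $\alpha$. The map $\alpha^*:\bigoplus_i(\mathbf{x}^{\mathbf{a}_i})^*\to\bigoplus_j(\mathbf{x}^{\mathbf{b}_j})^*$ has components $f\mapsto\lambda_{ji}f$ if $\mathbf{x}^{\mathbf{b}_j}\mid\mathbf{x}^{\mathbf{a}_i}$, and zero otherwise. For a finitely generated multigraded $S$-module $M$ choose a multigraded free presentation $F_1\xrightarrow{\varphi}F_0\to M\to0$ and set $M^*=\operatorname{Coker}\varphi^*$ (well defined up to isomorphism). Resolution of powers of $P_j$. Order the variables of $S^*$ by $x_{11}>\cdots>x_{1i_1}>\cdots>x_{n1}>\cdots>x_{ni_n}$, and index them accordingly by $1<2<\cdots<\eta$, $\eta=\sum_j i_j$, writing $y_1>\cdots>y_\eta$. Let $P=P_j$ and $a\ge0$. Order the minimal monomial generators $u_1,u_2,\ldots$ of $P^a$ decreasingly in the lexicographic order. For a generator $u=u_l$ let $\operatorname{set}(u)=\{k: y_k\in(u_1,\ldots,u_{l-1}):u_l\}$. For a monomial $u\in P^a$ let $g_a(u)=u_l$ where $l$ is smallest with $u\in(u_1,\ldots,u_l)$, and let $c_a(u)$ be the monomial with $u=c_a(u)g_a(u)$. The complex $\mathbb{G}(P^a)$ has in homological degree $s$ the free $S^*$-module $G_s(P^a)$ with basis the symbols $f(\sigma;u)$, $u$ a minimal monomial generator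 of $P^a$, $\sigma\subseteq\operatorname{set}(u)$, $|\sigma|=s$, of multidegree $\sigma+\deg u$ ($\sigma$ identified with its $(0,1)$-vector), and differential $$\partial(f(\sigma;u))=-\sum_{t\in\sigma}(-1)^{\alpha(\sigma,t)}y_tf(\sigma\setminus t;u)+\sum_{t\in\sigma}(-1)^{\alpha(\sigma,t)}\frac{y_tu}{g_a(y_tu)}f(\sigma\setminus t;g_a(y_tu)),$$ where $\alpha(\sigma,t)=|\{s\in\sigma: s<t\}|$ and $f(\sigma;u)=0$ if $\sigma\not\subseteq\operatorname{set}(u)$; the augmentation $G_0(P^a)\to P^a$ is $f(\emptyset;u)\mapsto u$. It is known that $\mathbb{G}(P^a)$ is a minimal multigraded free resolution of $P^a$. For $a\ge b$ let $\varphi^{a,b}:\mathbb{G}(P^a)\to\mathbb{G}(P^b)$ be given by $\varphi^{a,b}(f(\sigma;u))=c_b(u)f(\sigma;g_b(u))$ (zero if $\sigma\not\subseteq\operatorname{set}(g_b(u))$). Put $\mathbb{G}^{\mathbf{a}}=\bigotimes_{j=1}^n\mathbb{G}(P_j^{a(j)})$ (over $S^*$), and for $\mathbf{x}^{\mathbf{b}}\mid\mathbf{x}^{\mathbf{a}}$ put $\varphi^{\mathbf{a},\mathbf{b}}=\bigotimes_{j=1}^n\varphi^{a(j),b(j)}:\mathbb{G}^{\mathbf{a}}\to\mathbb{G}^{\mathbf{b}}$; it is a complex homomorphism lifting the inclusion $(\mathbf{x}^{\mathbf{a}})^*\subseteq(\mathbf{x}^{\mathbf{b}})^*$. The double complex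 $\mathbb{C}$. For $\mathbb{F}$ as in the claim, put $\mathbb{G}_i=\bigoplus_j\mathbb{G}^{\mathbf{a}_{ij}}$, and let $G_{ij}$ be the module of $\mathbb{G}_i$ in homological degree $j$. If $[\lambda_{\ell k}]$ is the monomial matrix expression of $\varphi_i$, let $d:\mathbb{G}_i\to\mathbb{G}_{i-1}$ be the complex homomorphism whose component $\mathbb{G}^{\mathbf{a}_{ik}}\to\mathbb{G}^{\mathbf{a}_{i-1,\ell}}$ is $\lambda_{\ell k}\varphi^{\mathbf{a}_{ik},\mathbf{a}_{i-1,\ell}}$ (zero when $\mathbf{x}^{\mathbf{a}_{i-1,\ell}}\nmid\mathbf{x}^{\mathbf{a}_{ik}}$). Then $\mathbb{C}$ is the double complex with $C_{ij}=G_{ij}$, row differentials $d:G_{ij}\to G_{i-1,j}$ and column differentials $\partial:G_{ij}\to G_{i,j-1}$ the differentials of $\mathbb{G}_i$. Its total complex has $T(\mathbb{C})_k=\bigoplus_{i+j=k}G_{ij}$ with the usual differential $d+(-1)^i\partial$ on $G_{ij}$. *)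

(* Defs.v *)
From HB Require Import structures.
From mathcomp Require Import all_boot all_order all_algebra.
From mathcomp.multinomials Require Import mpoly.
From mathcomp.classical Require Import boolp.

Set Implicit Arguments.
Unset Strict Implicit.
Unset Printing Implicit Defensive.

Import GRing.Theory.
Local Open Scope ring_scope.

Section Ideals.
Variable R : comNzRingType.
Implicit Types (X I J : R -> Prop) (p q r u : R).

Definition ideal_gen X : R -> Prop := fun p =>
  exists (k : nat) (c x : 'I_k -> R),
    (forall i, X (x i)) /\ p = \sum_i c i * x i.

Definition ideal1 : R -> Prop := fun _ => True.

Definition ideal_mul I J : R -> Prop :=
  ideal_gen (fun p => exists u v, [/\ I u, J v & p = u * v]).

Definition ideal_exp I k : R -> Prop := iter k (ideal_mul I) ideal1.

Definition ideal_colon I u : R -> Prop := fun r => I (r * u).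

Lemma ideal_gen0 X : ideal_gen X 0.
Proof.
by exists 0%N, (fun=> 0), (fun=> 0); split=> [[]//|]; rewrite big_ord0.
Qed.

Lemma ideal_genD X p q : ideal_gen X p -> ideal_gen X q -> ideal_gen X (p + q).
Proof.
move=> [k [c [x [Xx ->]]]] [l [d [y [Yy ->]]]].
pose h T (f : 'I_k -> T) (g : 'I_l -> T) (i : 'I_(k + l)) :=
  match split i with inl a => f a | inr b => g b end.
exists (k + l)%N, (h _ c d), (h _ x y); split.
  by move=> i; rewrite /h; case: (split i).
rewrite big_split_ord /=; congr (_ + _); apply: eq_bigr => i _.
  rewrite /h; case: splitP => [j /= e|j /= e]; last first.
    by have := ltn_ord i; rewrite e ltnNge leq_addr.
  by have -> : i = j by exact: val_inj.
rewrite /h; case: splitP => [j /= e|j /= /addnI e].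
  by have := ltn_ord j; rewrite -e ltnNge leq_addr.
by have -> : i = j by exact: val_inj.
Qed.

Lemma ideal_genM X r p : ideal_gen X p -> ideal_gen X (r * p).
Proof.
move=> [k [c [x [Xx ->]]]]; exists k, (fun i => r * c i), x; split=> //.
by rewrite big_distrr /=; apply: eq_bigr => i _; rewrite mulrA.
Qed.

Lemma ideal_gen_sub X p : X p -> ideal_gen X p.
Proof.
move=> Xp; exists 1%N, (fun=> 1), (fun=> p); split=> //.
by rewrite big_ord1 mul1r.
Qed.

Lemma ideal_gen_sum X (T : Type) (s : seq T) (P : pred T) (f : T -> R) :
  (forall i, P i -> ideal_gen X (f i)) -> ideal_gen X (\sum_(i <- s | P i) f i).
Proof.
by move=> h; apply: big_ind => //; [exact: ideal_gen0 | exact: ideal_genD].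
Qed.

Lemma ideal_gen_incl X I p :
    I 0 -> (forall x y, I x -> I y -> I (x + y)) ->
    (forall r x, I x -> I (r * x)) -> (forall x, X x -> I x) ->
  ideal_gen X p -> I p.
Proof.
move=> I0 ID IM XI [k [c [x [Xx ->]]]].
by apply: big_ind => // i _; apply/IM/XI.
Qed.

Lemma ideal_mulSS I I' J J' : (forall p, I p -> I' p) ->
  (forall p, J p -> J' p) -> forall p, ideal_mul I J p -> ideal_mul I' J' p.
Proof.
move=> sI sJ p [k [c [x [Xx ->]]]]; exists k, c, x; split=> // i.
by have [u [v [Iu Jv ->]]] := Xx i; exists u, v; split; auto.
Qed.

Definition is_ideal I :=
  [/\ I 0, forall x y, I x -> I y -> I (x + y) & forall r x, I x -> I (r * x)].

Lemma ideal_gen_ideal X : is_ideal (ideal_gen X).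
Proof.
split; [exact: ideal_gen0 | exact: ideal_genD | exact: ideal_genM].
Qed.

Lemma ideal_mul_ideal I J : is_ideal (ideal_mul I J).
Proof. exact: ideal_gen_ideal. Qed.

Lemma ideal1_ideal : is_ideal ideal1. Proof. by []. Qed.

Lemma ideal_exp_ideal I k : is_ideal (ideal_exp I k).
Proof. by case: k => [|k] /=; [exact: ideal1_ideal|exact: ideal_mul_ideal]. Qed.

Lemma ideal_mulr I J p : is_ideal J -> ideal_mul I J p -> J p.
Proof.
case=> J0 JD JM; apply: ideal_gen_incl => // x [u [v [_ Jv ->]]].
exact: JM.
Qed.

Lemma ideal_exp_le I k l p : (l <= k)%N -> ideal_exp I k p -> ideal_exp I l p.
Proof.
move=> /subnK <-; elim: (k - l)%N p => // d IHd p /ideal_mulr h.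
by apply/IHd/h/ideal_exp_ideal.
Qed.

End Ideals.

Record is_multigrading (K : fieldType) (n : nat) (M : lmodType {mpoly K[n]})
    (gr : 'X_{1..n} -> M -> Prop) : Prop := IsMultigrading {
  multigr0 : forall a, gr a 0;
  multigrB : forall a x y, gr a x -> gr a y -> gr a (x - y);
  multigrZ : forall a b (c : K) x, gr a x -> gr (b + a)%MM ((c *: 'X_[b]) *: x);
  multigr_gen : forall x, exists (s : seq 'X_{1..n}) (y : 'X_{1..n} -> M),
    (forall a, gr a (y a)) /\ x = \sum_(a <- s) y a;
  multigr_direct : forall (s : seq 'X_{1..n}) (y : 'X_{1..n} -> M),
    uniq s -> (forall a, gr a (y a)) -> \sum_(a <- s) y a = 0 ->
    forall a, a \in s -> y a = 0
}.

Record mgmod (K : fieldType) (n : nat) := MGMod {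
  mg_sort :> lmodType {mpoly K[n]};
  mg_comp : 'X_{1..n} -> mg_sort -> Prop;
  mg_axiom : is_multigrading mg_comp
}.

Definition mghom (K : fieldType) (n : nat) (M N : mgmod K n)
    (f : {linear M -> N}) : Prop :=
  forall a x, mg_comp a x -> mg_comp a (f x).

Definition fin_gen (R : nzRingType) (M : lmodType R) : Prop :=
  exists s : seq M, forall x, exists c : nat -> R,
    x = \sum_(i < size s) c i *: s`_i.

Section FfunGrading.
Variables (K : fieldType) (n : nat) (I : finType) (deg : I -> 'X_{1..n}).
Local Notation S := {mpoly K[n]}.
Local Notation V := {ffun I -> S^o}.

(* The homogeneous component of degree a of the direct sum of the S(- deg i). *)
Definition ffun_comp (a : 'X_{1..n}) (v : V) : Prop :=
  forall i m, m \in msupp (v i : S) -> (m + deg i)%MM = a.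

Lemma ffun_compP a (v : V) : ffun_comp a v <->
  (forall i m, (m + deg i)%MM <> a -> (v i : S)@_m = 0).
Proof.
split=> h i m; last first.
  by rewrite mcoeff_msupp => /eqP nz; apply: contrapT => /h.
by move=> ne; apply/eqP; rewrite mcoeff_eq0; apply/negP => /h.
Qed.

Lemma mcoeff_monoM (c : K) (b m : 'X_{1..n}) (p : S) :
  ((c *: 'X_[b]) * p)@_m = if (b <= m)%MM then c * p@_(m - b) else 0.
Proof.
rewrite -scalerAl mcoeffZ mcoeffM.
case: ifPn => [le|nle]; last first.
  rewrite big1 ?mulr0 // => k /eqP e; rewrite mcoeffX.
  case: eqP => [eb|]; rewrite ?mul0r //; case/negP: nle.
  by rewrite e -eb lem_addr.
congr (_ * _).
have lb : (mdeg b < (mdeg m).+1)%N by rewrite ltnS -(submK le) mdegD leq_addl.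
have lm : (mdeg (m - b)%MM < (mdeg m).+1)%N by rewrite ltnS mdegB.
rewrite (bigD1 (BMultinom lb, BMultinom lm)) /=; last first.
  by rewrite addmC submK.
rewrite mcoeffX eqxx mul1r big1 ?addr0 // => -[k1 k2] /= /andP[/eqP e ne].
rewrite mcoeffX; case: eqP => [eb|]; rewrite ?mul0r //.
case/negP: ne; apply/eqP; congr (_, _); apply/val_inj => /=; first by rewrite eb.
transitivity (k1 + k2 - b)%MM; first by rewrite -eb addmC addmK.
by congr (_ - _)%MM; apply/esym.
Qed.

Definition ffun_part (a : 'X_{1..n}) (v : V) : V :=
  [ffun i => if (deg i <= a)%MM
             then (v i : S)@_(a - deg i) *: 'X_[a - deg i] else 0 : S].

Lemma ffun_partE a v i m : (ffun_part a v i : S)@_m =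
  if (m + deg i)%MM == a then (v i : S)@_m else 0.
Proof.
rewrite ffunE; case: ifPn => [le|nle].
  rewrite mcoeffZ mcoeffX.
  have -> : ((m + deg i)%MM == a) = (a - deg i == m)%MM.
    apply/eqP/eqP => [<-|<-]; first by rewrite addmK.
    by rewrite submK.
  by case: eqP => [->|]; rewrite ?mulr1 ?mulr0.
rewrite mcoeff0; case: eqP => // e; case/negP: nle; rewrite -e.
exact: lem_addl.
Qed.

Lemma ffun_part_comp a v : ffun_comp a (ffun_part a v).
Proof. by apply/ffun_compP => i m /eqP/negbTE ne; rewrite ffun_partE ne. Qed.

Lemma ffun_part_sum v : exists2 s : seq 'X_{1..n}, uniq s &
  v = \sum_(a <- s) ffun_part a v.
Proof.
exists (undup (flatten [seq [seq (m + deg i)%MM | m <- msupp (v i : S)]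
                       | i <- enum I])); first exact: undup_uniq.
set s := undup _; have us : uniq s by exact: undup_uniq.
apply/ffunP => i; rewrite sum_ffunE; apply/mpolyP => m.
rewrite [RHS](raddf_sum (mcoeff m)) /=.
under eq_bigr do rewrite ffun_partE.
rewrite -big_mkcond /=; under eq_bigl do rewrite eq_sym.
have [ms|/memN_msupp_eq0 z] := boolP (m \in msupp (v i : S)); last first.
  by rewrite big1.
rewrite -big_filter filter_pred1_uniq // ?big_seq1 //.
rewrite mem_undup; apply/flattenP.
exists [seq (m + deg i)%MM | m <- msupp (v i : S)].
  by apply/mapP; exists i; rewrite ?mem_enum.
by apply/mapP; exists m.
Qed.

Lemma ffun_direct (s : seq 'X_{1..n}) (y : 'X_{1..n} -> V) : uniq s ->
    (forall a, ffun_comp a (y a)) -> \sum_(a <- s) y a = 0 ->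
  forall a, a \in s -> y a = 0.
Proof.
move=> us gy sum0 a sa; apply/ffunP => i; rewrite ffunE.
apply/mpolyP => m; rewrite mcoeff0.
have [e|/eqP ne] := eqVneq (m + deg i)%MM a; last first.
  by have /ffun_compP -> := gy a.
have := congr1 (fun w : V => (w i : S)@_m) sum0.
rewrite /= sum_ffunE ffunE mcoeff0 [LHS](raddf_sum (mcoeff m)) /=.
rewrite (bigD1_seq a) //= big1 ?addr0 // => b /eqP ne.
by have /ffun_compP -> := gy b => //; rewrite e => /esym.
Qed.

Lemma ffun_comp0 a : ffun_comp a 0.
Proof. by apply/ffun_compP => i m _; rewrite ffunE mcoeff0. Qed.

Lemma ffun_compB a x y : ffun_comp a x -> ffun_comp a y -> ffun_comp a (x - y).
Proof.
move=> /ffun_compP gx /ffun_compP gy; apply/ffun_compP => i m ne.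
by rewrite !ffunE mcoeffB gx // gy // subrr.
Qed.

Lemma ffun_compZ a b (c : K) x :
  ffun_comp a x -> ffun_comp (b + a)%MM ((c *: 'X_[b] : S) *: x).
Proof.
move=> /ffun_compP gx; apply/ffun_compP => i m ne.
rewrite ffunE /= [_ *: _](_ : _ = (c *: 'X_[b]) * (x i : S)) //.
rewrite mcoeff_monoM; case: ifP => // le; rewrite gx ?mulr0 // => e.
by apply: ne; rewrite -e addmA [(b + _)%MM]addmC submK.
Qed.

Lemma ffun_multigrading : is_multigrading ffun_comp.
Proof.
split; [exact: ffun_comp0|exact: ffun_compB|exact: ffun_compZ| |].
- move=> v; have [s us ->] := ffun_part_sum v.
  by exists s, (ffun_part^~ v); split=> // a; exact: ffun_part_comp.
- exact: ffun_direct.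
Qed.

End FfunGrading.

(* The multigraded free module with finite basis fbasis, the basis element b
   having multidegree fdeg b, i.e. the direct sum of the S(- fdeg b). *)
Record mgfree (K : fieldType) (n : nat) := MGFree {
  fbasis : finType;
  fdeg : fbasis -> 'X_{1..n}
}.
Arguments MGFree K {n} fbasis fdeg.

Section Free.
Variables (K : fieldType) (n : nat).
Local Notation S := {mpoly K[n]}.

Definition free_mod (F : mgfree K n) : mgmod K n :=
  MGMod (@ffun_multigrading K n (fbasis F) (@fdeg K n F)).

End Free.

Coercion free_mod : mgfree >-> mgmod.

Section FreeTheory.
Variables (K : fieldType) (n : nat).
Local Notation S := {mpoly K[n]}.
Implicit Types F G : mgfree K n.

Definition mgcoord F (v : F) (b : fbasis F) : S := (v : {ffun fbasis F -> S^o}) b.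

Definition bvec F (b : fbasis F) : F :=
  ([ffun c => (c == b)%:R] : {ffun fbasis F -> S^o}).

Definition lin_ext_fun F G (A : fbasis F -> fbasis G -> S) (v : F) : G :=
  ([ffun c => \sum_b mgcoord v b * A b c] : {ffun fbasis G -> S^o}).

Lemma lin_ext_is_linear F G A : linear (@lin_ext_fun F G A).
Proof.
move=> r u v; apply/ffunP => c; rewrite !ffunE /=.
rewrite [RHS](_ : _ = r * (\sum_b mgcoord u b * A b c) +
                     \sum_b mgcoord v b * A b c) //.
rewrite big_distrr -big_split /=; apply: eq_bigr => b _.
by rewrite /mgcoord !ffunE mulrDl mulrA.
Qed.

HB.instance Definition _ F G A :=
  GRing.isLinear.Build S F G _ (@lin_ext_fun F G A) (@lin_ext_is_linear F G A).

(* The linear map sending the basis element b to \sum_c A b c * c. *)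
Definition lin_ext F G A : {linear F -> G} := @lin_ext_fun F G A.

End FreeTheory.

Record mgcomplex (K : fieldType) (n : nat) := MGComplex {
  cterm :> nat -> mgfree K n;
  cdiff : forall i, {linear cterm i.+1 -> cterm i}
}.

Section Resolutions.
Variables (K : fieldType) (n : nat).

Definition is_coker (R : nzRingType) (U V W : lmodType R)
    (f : {linear U -> V}) (e : {linear V -> W}) : Prop :=
  (forall w, exists v, e v = w) /\ (forall v, e v = 0 <-> exists u, f u = v).

Definition mg_presentation (E1 E0 : mgfree K n) (psi : {linear E1 -> E0})
    (M : mgmod K n) : Prop :=
  mghom psi /\ exists e : {linear E0 -> M}, mghom e /\ is_coker psi e.

Definition mg_free_resolution (F : mgcomplex K n) (M : mgmod K n) : Prop :=
  [/\ forall i, mghom (cdiff F i),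
      forall i v, cdiff F i v = 0 <-> exists w, cdiff F i.+1 w = v
    & exists e : {linear F 0%N -> M}, mghom e /\ is_coker (cdiff F 0) e].

(* The image of each differential lies in (x_1, ..., x_n) F_i: all the
   coordinates have zero constant term. *)
Definition minimal_complex (F : mgcomplex K n) : Prop :=
  forall i (v : F i.+1) (b : fbasis (F i)), (mgcoord (cdiff F i v) b)@_0%MM = 0.

Definition mg_min_free_resolution (F : mgcomplex K n) (M : mgmod K n) : Prop :=
  mg_free_resolution F M /\ minimal_complex F.

Definition length_le (F : mgcomplex K n) (p : nat) : Prop :=
  forall i, (p < i)%N -> #|fbasis (F i)| = 0%N.

End Resolutions.

Section Coker.
Variables (R : nzRingType) (U V : lmodType R) (f : {linear U -> V}).

Definition lin_img : {pred V} := fun v => `[< exists u, f u = v >].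

Lemma lin_imgP v : reflect (exists u, f u = v) (v \in lin_img).
Proof. exact: asboolP. Qed.

Lemma lin_img_submod : submod_closed lin_img.
Proof.
split=> [|a _ _ /lin_imgP[u <-] /lin_imgP[v <-]]; apply/lin_imgP.
  by exists 0; rewrite linear0.
by exists (a *: u + v); rewrite linearP.
Qed.

HB.instance Definition _ := GRing.isSubmodClosed.Build R V lin_img lin_img_submod.

Definition coker : Type := {ideal_quot lin_img}.
HB.instance Definition _ := GRing.Zmodule.on coker.

Definition coker_pi_fun (v : V) : coker := \pi_({ideal_quot lin_img})%qT v.
Definition coker_repr (x : coker) : V := repr (x : {ideal_quot lin_img}).

Lemma coker_reprK : cancel coker_repr coker_pi_fun.
Proof. by move=> x; rewrite /coker_pi_fun /coker_repr reprK. Qed.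

Lemma coker_pi_eq u v : coker_pi_fun u = coker_pi_fun v <-> u - v \in lin_img.
Proof.
by rewrite (rwP eqP) -[_ == _]/(_ == _ %[mod {ideal_quot lin_img}])%qT
   -Quotient.idealrBE.
Qed.

Lemma coker_piB : {morph coker_pi_fun : x y / x - y}.
Proof. by move=> x y; rewrite /coker_pi_fun; exact: (raddfB (\pi_({ideal_quot lin_img})%qT)). Qed.

Lemma coker_piD : {morph coker_pi_fun : x y / x + y}.
Proof. by move=> x y; rewrite /coker_pi_fun; exact: (raddfD (\pi_({ideal_quot lin_img})%qT)). Qed.

Definition coker_scale (a : R) (x : coker) : coker :=
  coker_pi_fun (a *: coker_repr x).

Lemma coker_scale_pi a v : coker_scale a (coker_pi_fun v) = coker_pi_fun (a *: v).
Proof.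
apply/coker_pi_eq; rewrite -scalerBr rpredZ //.
by apply/coker_pi_eq; rewrite coker_reprK.
Qed.

Lemma coker_scaleA a b x :
  coker_scale a (coker_scale b x) = coker_scale (a * b) x.
Proof.
by rewrite -(coker_reprK x) !coker_scale_pi scalerA.
Qed.

Lemma coker_scale1 : left_id 1 coker_scale.
Proof. by move=> x; rewrite -(coker_reprK x) coker_scale_pi scale1r. Qed.

Lemma coker_scaleDr : right_distributive coker_scale +%R.
Proof.
move=> a x y; rewrite -(coker_reprK x) -(coker_reprK y).
by rewrite -coker_piD !coker_scale_pi scalerDr coker_piD.
Qed.

Lemma coker_scaleDl x : {morph coker_scale^~ x : a b / a + b}.
Proof.
move=> a b; rewrite -(coker_reprK x).
by rewrite !coker_scale_pi scalerDl coker_piD.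
Qed.

HB.instance Definition _ := GRing.Zmodule_isLmodule.Build R coker
  coker_scaleA coker_scale1 coker_scaleDr coker_scaleDl.

Lemma coker_pi_is_linear : linear coker_pi_fun.
Proof. by move=> a u v; rewrite coker_piD -coker_scale_pi. Qed.

HB.instance Definition _ :=
  GRing.isLinear.Build R V coker _ coker_pi_fun coker_pi_is_linear.

Definition coker_pi : {linear V -> coker} := coker_pi_fun.

Lemma coker_is_coker : is_coker f coker_pi.
Proof.
split=> [w|v]; first by exists (coker_repr w); exact: coker_reprK.
rewrite -(linear0 coker_pi) coker_pi_eq subr0.
by split=> /lin_imgP.
Qed.

End Coker.

Section MonoIdeals.
Variables (K : fieldType) (n : nat).
Local Notation S := {mpoly K[n]}.

Definition mono_stable (I : S -> Prop) : Prop :=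
  forall p m, I p -> I (p@_m *: 'X_[m]).

Lemma mterm_mul (p q : S) m : (p * q)@_m *: 'X_[m] =
  \sum_(k : 'X_{1..n < (mdeg m).+1, (mdeg m).+1} | m == (k.1 + k.2)%MM)
    (p@_k.1 *: 'X_[k.1]) * (q@_k.2 *: 'X_[k.2]) :> S.
Proof.
rewrite mcoeffM scaler_suml; apply: eq_bigr => k /eqP e.
have -> : 'X_[m] = 'X_[k.1] * 'X_[k.2] :> S by rewrite -mpolyXD -e.
by rewrite -scalerAl -scalerAr scalerA.
Qed.

Lemma ideal_gen_mono (X : S -> Prop) :
  (forall x m, X x -> ideal_gen X (x@_m *: 'X_[m])) -> mono_stable (ideal_gen X).
Proof.
move=> hX _ m [k [c [x [Xx ->]]]].
rewrite raddf_sum /= scaler_suml; apply: ideal_gen_sum => i _.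
by rewrite mterm_mul; apply: ideal_gen_sum => l _; apply/ideal_genM/hX.
Qed.

Lemma ideal_mul_mono (I J : S -> Prop) :
  mono_stable I -> mono_stable J -> mono_stable (ideal_mul I J).
Proof.
move=> hI hJ; apply: ideal_gen_mono => _ m [u [v [Iu Jv ->]]].
rewrite mterm_mul; apply: ideal_gen_sum => l _; apply: ideal_gen_sub.
by exists (u@_l.1 *: 'X_[l.1]), (v@_l.2 *: 'X_[l.2]); split; auto.
Qed.

Lemma ideal_exp_mono (I : S -> Prop) k : mono_stable I -> mono_stable (ideal_exp I k).
Proof. by move=> hI; elim: k => [|k IHk] //=; exact: ideal_mul_mono. Qed.

End MonoIdeals.

Section Expansion.
Variables (K : fieldType) (n : nat) (ii : 'I_n -> nat).

(* The variables of S^* are indexed by 'I_(\sum_j ii j); the variable x_jk is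
   the one of index tagnat.Rank j k, so that index k lies in block
   tagnat.sig1 k and the numbering is the lexicographic one on pairs. *)
Local Notation eta := (\sum_(j < n) ii j)%N.
Local Notation Ss := {mpoly K[eta]}.

(* P_j *)
Definition PI (j : 'I_n) : Ss -> Prop :=
  ideal_gen (fun p => exists2 k : 'I_eta, tagnat.sig1 k = j & p = 'X_k).

(* (x^a)^* *)
Definition xstar (a : 'X_{1..n}) : Ss -> Prop :=
  \big[@ideal_mul Ss/@ideal1 Ss]_(j < n) ideal_exp (PI j) (a j).

Lemma PI_mono j : mono_stable (PI j).
Proof.
apply: ideal_gen_mono => _ m [k kj ->]; rewrite mcoeffX.
case: eqP => [<-|_]; last by rewrite scale0r; exact: ideal_gen0.
by rewrite scale1r; apply: ideal_gen_sub; exists k.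
Qed.

Lemma xstar_ideal a : is_ideal (xstar a).
Proof.
apply: (big_ind (@is_ideal Ss)) => // [I J _ _|j _].
  exact: ideal_mul_ideal.
exact: ideal_exp_ideal.
Qed.

Lemma xstar_mono a : mono_stable (xstar a).
Proof.
apply: (big_ind (@mono_stable K eta)) => // [I J|j _]; first exact: ideal_mul_mono.
exact/ideal_exp_mono/PI_mono.
Qed.

Lemma xstar_le a b p : (b <= a)%MM -> xstar a p -> xstar b p.
Proof.
move=> /mnm_lepP le; move: p.
apply: (big_ind2 (fun I J : Ss -> Prop => forall p, I p -> J p)) => // [I1 J1 I2 J2 h1 h2|j _ p]; first exact: ideal_mulSS.
exact: ideal_exp_le.
Qed.

Section Object.
Variable F : mgfree K n.
Local Notation V := {ffun fbasis F -> Ss^o}.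

Definition expF_pred : {pred V} := fun v => `[< forall i, xstar (fdeg i) (v i) >].

Lemma expF_predP (v : V) : reflect (forall i, xstar (fdeg i) (v i)) (v \in expF_pred).
Proof. exact: asboolP. Qed.

Lemma expF_submod : submod_closed expF_pred.
Proof.
split=> [|a u v /expF_predP hu /expF_predP hv]; apply/expF_predP => i.
  by rewrite ffunE; case: (xstar_ideal (fdeg i)).
case: (xstar_ideal (fdeg i)) => h0 hD hM.
by rewrite !ffunE; apply: hD => //; apply: hM.
Qed.

HB.instance Definition _ := GRing.isSubmodClosed.Build Ss V expF_pred expF_submod.

(* F^*, the direct sum over the basis of F of the ideals (x^(fdeg i))^*, with
   the grading inherited from S^*. *)
Definition expF : Type := {v : V | v \in expF_pred}.
Definition expF_sub (v : V) (hv : v \in expF_pred) : expF := exist _ v hv.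
HB.instance Definition _ := SubChoice.on expF.
HB.instance Definition _ := [SubChoice_isSubLmodule of expF by <:].

Definition expF_comp (c : 'X_{1..eta}) (v : expF) : Prop :=
  ffun_comp (fun=> 0%MM) c (val v).

Lemma expF_multigrading : is_multigrading expF_comp.
Proof.
split.
- by move=> a; rewrite /expF_comp linear0; exact: ffun_comp0.
- by move=> a x y; rewrite /expF_comp linearB; exact: ffun_compB.
- by move=> a b c x; rewrite /expF_comp linearZ; exact: ffun_compZ.
- move=> v.
  have hpart a : ffun_part (fun=> 0%MM) a (val v) \in expF_pred.
    apply/expF_predP => i; rewrite ffunE; case: ifP => _; last first.
      by case: (xstar_ideal (fdeg i)).
    apply: xstar_mono; exact: (expF_predP _ (valP v)).
  have [s _ e] := ffun_part_sum (fun=> 0%MM) (val v).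
  exists s, (fun a => expF_sub (hpart a)); split.
    by move=> a; exact: ffun_part_comp.
  apply: val_inj; rewrite raddf_sum {1}e; exact: eq_bigr.
- move=> s y us gy sum0 a sa; apply: val_inj; rewrite linear0.
  apply: (ffun_direct us gy _ sa).
  by move/(congr1 val): sum0; rewrite raddf_sum linear0.
Qed.

Definition expF_mod : mgmod K eta := MGMod expF_multigrading.

End Object.

(* The monomial matrix expression [lambda_ji] of psi, j indexing the target. *)
Definition mon_mat (E F : mgfree K n) (psi : {linear E -> F})
    (j : fbasis F) (i : fbasis E) : K :=
  if (fdeg j <= fdeg i)%MM then (mgcoord (psi (bvec i)) j)@_(fdeg i - fdeg j) else 0.

Section Morphism.
Variables (E F : mgfree K n) (psi : {linear E -> F}).

Definition expM_ffun (v : expF E) : {ffun fbasis F -> Ss^o} :=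
  [ffun j => \sum_i (mon_mat psi j i)%:MP * (val v i : Ss)].

Lemma expM_mem v : expM_ffun v \in @expF_pred F.
Proof.
apply/expF_predP => j; rewrite ffunE.
have [h0 hD hM] := xstar_ideal (fdeg j).
apply: big_ind => // i _; rewrite /mon_mat; case: ifP => [le|_].
  by apply: hM; apply: xstar_le le _; exact: (expF_predP _ (valP v)).
by rewrite mul0r.
Qed.

Definition expM_fun (v : expF E) : expF F := expF_sub (expM_mem v).

Lemma expM_is_linear : linear expM_fun.
Proof.
move=> a u v; apply: val_inj; rewrite linearP /=; apply/ffunP => j.
rewrite !ffunE [RHS](_ : _ = a * (\sum_i (mon_mat psi j i)%:MP * (val u i : Ss))
   + \sum_i (mon_mat psi j i)%:MP * (val v i : Ss)) //.
rewrite big_distrr -big_split /=; apply: eq_bigr => i _.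
rewrite [X in _ * X](_ : _ = a * (sval u i : Ss) + (sval v i : Ss)); last first.
  by rewrite !ffunE.
by rewrite mulrDr !mulrA [_%:MP_[_] * a]mulrC.
Qed.

HB.instance Definition _ :=
  GRing.isLinear.Build Ss (expF E) (expF F) _ expM_fun expM_is_linear.

(* psi^* *)
Definition expM : {linear expF_mod E -> expF_mod F} := expM_fun.

Lemma expM_mghom : mghom expM.
Proof.
move=> c v gv i m; rewrite -[val _]/(expM_ffun v) ffunE => hm.
apply: contrapT => ne; move: hm; rewrite mcoeff_msupp raddf_sum /=.
rewrite big1 ?eqxx // => j _; rewrite mcoeffCM.
by move/ffun_compP: gv => -> //; rewrite mulr0.
Qed.

End Morphism.
End Expansion.

(* The cokernel of a degree-preserving map of multigraded modules, graded by
   the images of the homogeneous components. *)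
Section GradedCoker.
Variables (K : fieldType) (n : nat) (U V : mgmod K n) (f : {linear U -> V}).

Definition coker_comp (a : 'X_{1..n}) (x : coker f) : Prop :=
  exists2 v, mg_comp a v & coker_pi f v = x.

Hypothesis hf : mghom f.

Lemma multigr_sum (M : mgmod K n) (x : M) : exists (s : seq 'X_{1..n})
  (y : 'X_{1..n} -> M), [/\ forall a, mg_comp a (y a),
    forall a, a \notin s -> y a = 0, uniq s & x = \sum_(a <- s) y a].
Proof.
have gM := mg_axiom M; have [s [y [gy ->]]] := multigr_gen gM x.
exists (undup s), (fun a => y a *+ count_mem a s); split.
- move=> a; elim: (count_mem a s) => [|k IHk].
    by rewrite mulr0n; exact: (multigr0 gM).
  have := multigrB gM IHk (multigrB gM (multigr0 gM a) (gy a)).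
  by rewrite sub0r opprK -mulrSr.
- by move=> a; rewrite mem_undup => /count_memPn ->; rewrite mulr0n.
- exact: undup_uniq.
rewrite -big_undup_iterop_count; apply: eq_bigr => a _.
by rewrite Monoid.iteropE iter_addr_0.
Qed.

Lemma multigr_sumW (M : mgmod K n) (s t : seq 'X_{1..n}) (y : 'X_{1..n} -> M) :
  uniq s -> uniq t -> {subset s <= t} -> (forall a, a \notin s -> y a = 0) ->
  \sum_(a <- s) y a = \sum_(a <- t) y a.
Proof.
move=> us ut st z; rewrite [RHS](bigID (mem s)) /= [X in _ + X]big1 ?addr0 //.
rewrite -[RHS]big_filter; apply: perm_big; apply: uniq_perm => //.
  exact: filter_uniq.
by move=> a; rewrite mem_filter; apply/idP/andP => [sa|[]//]; split=> //; exact: st.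
Qed.

Lemma coker_multigrading : is_multigrading coker_comp.
Proof.
have gV := mg_axiom V; split.
- by move=> a; exists 0; [exact: (multigr0 gV)|rewrite linear0].
- move=> a _ _ [u gu <-] [v gv <-]; exists (u - v); last by rewrite linearB.
  exact: (multigrB gV).
- move=> a b c _ [v gv <-]; exists ((c *: 'X_[b]) *: v); last by rewrite linearZ.
  exact: (multigrZ gV).
- move=> x; have [v <-] := (coker_is_coker f).1 x.
  have [s [y [gy ->]]] := multigr_gen gV v.
  exists s, (fun a => coker_pi f (y a)); split=> [a|]; first by exists (y a).
  by rewrite linear_sum.
move=> s y us gy sum0.
have [z hz] : exists z : 'X_{1..n} -> V,
    forall a, mg_comp a (z a) /\ coker_pi f (z a) = y a.
  have h a : {v | mg_comp a v /\ coker_pi f v = y a}.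
    by apply: cid; have [v] := gy a; exists v.
  by exists (fun a => sval (h a)) => a; case: (h a).
pose z' a := if a \in s then z a else 0.
have gz' a : mg_comp a (z' a).
  by rewrite /z'; case: ifP => _; [have [] := hz a|exact: (multigr0 gV)].
have z'0 a : a \notin s -> z' a = 0 by rewrite /z' => /negbTE ->.
have zz' : \sum_(a <- s) z' a = \sum_(a <- s) z a.
  by rewrite !big_seq; apply: eq_bigr => a sa; rewrite /z' sa.
have /(coker_is_coker f).2[w fw] : coker_pi f (\sum_(a <- s) z' a) = 0.
  rewrite zz' linear_sum; transitivity (\sum_(a <- s) y a) => //.
  by apply: eq_bigr => a _; have [] := hz a.
have [t [x [gx x0 ut ew]]] := multigr_sum w.
pose r := undup (s ++ t).
have rs : {subset s <= r} by move=> a sa; rewrite mem_undup mem_cat sa.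
have rt : {subset t <= r} by move=> a sa; rewrite mem_undup mem_cat sa orbT.
have ur : uniq r by exact: undup_uniq.
move=> a sa; have [_ <-] := hz a; apply/(coker_is_coker f).2; exists (x a).
have -> : z a = z' a by rewrite /z' sa.
apply/esym/subr0_eq; apply: (multigr_direct gV (s := r)
  (y := fun b => z' b - f (x b))) => //; last exact: rs.
- by move=> b; apply: (multigrB gV) => //; exact: hf.
rewrite big_split /= sumrN -(multigr_sumW us ur rs z'0) -fw ew.
rewrite -linear_sum -(multigr_sumW ut ur rt x0) subrr //.
Qed.

Definition coker_mod : mgmod K n := MGMod coker_multigrading.

End GradedCoker.

(* M^* for a module M presented by psi : E1 -> E0. *)
Definition expansion (K : fieldType) (n : nat) (ii : 'I_n -> nat)
    (E1 E0 : mgfree K n) (psi : {linear E1 -> E0}) : mgmod K (\sum_(j < n) ii j)%N :=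
  coker_mod (@expM_mghom K n ii E1 E0 psi).

(* A bounded complex of multigraded free modules given by a homogeneous basis:
   bc_diff x y is the coefficient of y in the differential of x; it only
   matters when bc_hdeg x = (bc_hdeg y).+1. *)
Record bcomplex (K : fieldType) (m : nat) := BComplex {
  bc_basis : finType;
  bc_hdeg : bc_basis -> nat;
  bc_mdeg : bc_basis -> 'X_{1..m};
  bc_diff : bc_basis -> bc_basis -> {mpoly K[m]}
}.

Section BComplex.
Variables (K : fieldType) (m : nat).
Local Notation R := {mpoly K[m]}.

Definition bc_part (C : bcomplex K m) (s : nat) : mgfree K m :=
  @MGFree K m {x : bc_basis C | bc_hdeg x == s} (fun x => bc_mdeg (val x)).

Definition bc_part_diff (C : bcomplex K m) (s : nat) :
    {linear bc_part C s.+1 -> bc_part C s} :=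
  @lin_ext K m (bc_part C s.+1) (bc_part C s)
    (fun x y => bc_diff (val x) (val y)).

Definition bc_part_map (C D : bcomplex K m) (f : bc_basis C -> bc_basis D -> R)
    (s : nat) : {linear bc_part C s -> bc_part D s} :=
  @lin_ext K m (bc_part C s) (bc_part D s) (fun x y => f (val x) (val y)).

Section Sum.
Variables (I : finType) (C : I -> bcomplex K m).

(* tagged_as x y is tagged y, transported along tag y = tag x. *)
Definition bc_sum : bcomplex K m :=
  @BComplex K m {i : I & bc_basis (C i)}
    (fun x => bc_hdeg (tagged x))
    (fun x => bc_mdeg (tagged x))
    (fun x y => if tag x == tag y then bc_diff (tagged x) (tagged_as x y) else 0).

End Sum.

(* The tensor product of a family of complexes, with the usual sign rule. *)
Section Tensor.
Variable n : nat.

Definition bc_tensor (C : 'I_n -> bcomplex K m) : bcomplex K m :=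
  @BComplex K m {dffun forall j : 'I_n, bc_basis (C j)}
    (fun x => \sum_(j < n) bc_hdeg (x j))%N
    (fun x => \sum_(j < n) bc_mdeg (x j))%MM
    (fun x y => \sum_(j < n)
       (-1) ^+ (\sum_(i < n | (i < j)%N) bc_hdeg (x i))
       * (bc_diff (x j) (y j)
          * [forall i, (i != j) ==> (x i == y i)]%:R)).

Definition bc_tensor_map (C D : 'I_n -> bcomplex K m)
    (f : forall j, bc_basis (C j) -> bc_basis (D j) -> R)
    (x : bc_basis (bc_tensor C)) (y : bc_basis (bc_tensor D)) : R :=
  \prod_j f j (x j) (y j).

End Tensor.
End BComplex.

Section Powers.
Variables (K : fieldType) (n : nat) (ii : 'I_n -> nat).
Local Notation eta := (\sum_(j < n) ii j)%N.
Local Notation Ss := {mpoly K[eta]}.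
Implicit Types (u v w : 'X_{1..eta}) (j : 'I_n) (a b : nat).

Definition mono_ideal (s : seq 'X_{1..eta}) : Ss -> Prop :=
  ideal_gen (fun p => exists2 w, w \in s & p = 'X_[w]).

Definition min_mono_gen (I : Ss -> Prop) u : Prop :=
  I 'X_[u] /\ forall v, (v <= u)%MM -> I 'X_[v] -> v = u.

(* u >= v in the lexicographic order with y_0 > y_1 > ... *)
Definition lex_ge u v : bool :=
  (u == v) ||
  [exists k : 'I_eta, (v k < u k)%N && [forall l : 'I_eta, (l < k)%N ==> (u l == v l)]].

(* The generators have degree at most a (see mem_gens), so that it suffices to
   enumerate monomials up to that degree. *)
Definition gens j a : seq 'X_{1..eta} :=
  sort lex_ge [seq u <- [seq val m | m <- enum {: 'X_{1..eta < a.+1}}]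
              | `[< min_mono_gen (ideal_exp (@PI K n ii j) a) u >]].

Definition set_gen j a u : {set 'I_eta} :=
  [set k | `[< ideal_colon (mono_ideal (take (index u (gens j a)) (gens j a)))
                 'X_[u] ('X_k : Ss) >]].

(* g_a(u) and c_a(u); for u not in P_j^a, g_a(u) is the default value 0. *)
Definition gfun j a u : 'X_{1..eta} :=
  nth 0%MM (gens j a)
    (find (fun l => `[< mono_ideal (take l.+1 (gens j a)) ('X_[u] : Ss) >])
          (iota 0 (size (gens j a)))).

Definition cfun j a u : 'X_{1..eta} := (u - gfun j a u)%MM.

(* The symbol f(sigma; u) is encoded as the pair (sigma, u). *)
Definition symbols j a : seq ({set 'I_eta} * 'X_{1..eta}) :=
  [seq (sigma, u) | u <- gens j a, sigma <- enum (powerset (set_gen j a u))].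

Definition alpha (sigma : {set 'I_eta}) (t : 'I_eta) : nat :=
  #|[set s in sigma | (s < t)%N]|.

(* Coordinate at the basis element y of f(sigma; u), which is 0 when
   (sigma, u) is not one of the symbols. *)
Definition fsym j a (sigma : {set 'I_eta}) u (y : seq_sub (symbols j a)) : Ss :=
  (ssval y == (sigma, u))%:R.

Definition gp_diff j a (x y : seq_sub (symbols j a)) : Ss :=
  let: (sigma, u) := ssval x in
  - (\sum_(t in sigma)
       (-1) ^+ alpha sigma t * 'X_t * fsym (sigma :\ t) u y)
  + \sum_(t in sigma)
       (-1) ^+ alpha sigma t * 'X_[U_(t) + u - gfun j a (U_(t) + u)]
       * fsym (sigma :\ t) (gfun j a (U_(t) + u)%MM) y.

(* G(P_j^a) *)
Definition GP j a : bcomplex K eta :=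
  @BComplex K eta (seq_sub (symbols j a))
    (fun x => #|(ssval x).1|)
    (fun x => [multinom ((i \in (ssval x).1) + (ssval x).2 i)%N | i < eta])
    (@gp_diff j a).

Definition phi j a b (x : bc_basis (GP j a)) (y : bc_basis (GP j b)) : Ss :=
  let: (sigma, u) := ssval x in
  'X_[cfun j b u] * fsym sigma (gfun j b u) y.

Definition Gtensor (a : 'X_{1..n}) : bcomplex K eta :=
  bc_tensor (fun j => GP j (a j)).

Definition phi_tensor (a b : 'X_{1..n}) :
    bc_basis (Gtensor a) -> bc_basis (Gtensor b) -> Ss :=
  bc_tensor_map (fun j => @phi j (a j) (b j)).

Section GensBound.
Variable j : 'I_n.

Let bd u := (\sum_(k < eta | tagnat.sig1 k == j) u k)%N.

Let bdD u v : bd (u + v)%MM = (bd u + bd v)%N.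
Proof. by rewrite /bd -big_split; apply: eq_bigr => k _; rewrite mnmDE. Qed.

Let D a (p : Ss) := forall m, m \in msupp p -> (a <= bd m)%N.

Let D0 a : D a 0.
Proof. by move=> m; rewrite msupp0. Qed.

Let DD a p q : D a p -> D a q -> D a (p + q).
Proof.
by move=> hp hq m /msuppD_le; rewrite mem_cat => /orP[/hp|/hq].
Qed.

Let DM a b p q : D a p -> D b q -> D (a + b) (p * q).
Proof.
move=> hp hq m /msuppM_le /allpairsP[[u v] /= [/hp hu /hq hv ->]].
by rewrite bdD leq_add.
Qed.

Let DM0 a p q : D a q -> D a (p * q).
Proof. by rewrite -[a in D a (p * q)]add0n; apply: DM. Qed.

Let PI_D p : PI j p -> D 1 p.
Proof.
apply: ideal_gen_incl; [exact: D0|exact: DD|by move=> r x; exact: DM0|].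
move=> _ [k kj ->] m; rewrite msuppX inE => /eqP ->.
by rewrite /bd (bigD1 k) ?kj //= mnm1E eqxx.
Qed.

Let exp_D a p : ideal_exp (PI j) a p -> D a p.
Proof.
elim: a p => [|a IHa] p //=.
apply: ideal_gen_incl; [exact: D0|exact: DD|by move=> r x; exact: DM0|].
by move=> _ [u [v [/PI_D hu /IHa hv ->]]]; rewrite -add1n; exact: DM.
Qed.

Let exp_dvd a m : (a <= bd m)%N -> exists v,
  [/\ (v <= m)%MM, mdeg v = a & ideal_exp (@PI K n ii j) a 'X_[v]].
Proof.
elim: a m => [|a IHa] m hm.
  by exists 0%MM; split=> //; [apply/mnm_lepP => i; rewrite mnm0E|exact: mdeg0].
have [k kj mk] : exists2 k : 'I_eta, tagnat.sig1 k = j & m k != 0%N.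
  apply: contrapT => h; move: hm; rewrite /bd big1 // => k /eqP kj.
  by apply/eqP; apply: contrapT => /negP nz; apply: h; exists k.
have kle : (U_(k) <= m)%MM by rewrite lep1mP.
have bdU : bd U_(k)%MM = 1%N.
  rewrite /bd (bigD1 k) ?kj //= mnm1E eqxx big1 ?addn0 // => i /andP[_ ne].
  by rewrite mnm1E eq_sym (negbTE ne).
have hm' : (a <= bd (m - U_(k))%MM)%N.
  by move: hm; rewrite -{1}(submK kle) bdD bdU addn1 ltnS.
have [v [vle dv hv]] := IHa _ hm'; exists (U_(k) + v)%MM; split.
- apply/mnm_lepP => i; rewrite mnmDE addnC -(submK kle) mnmDE leq_add2r.
  exact: (mnm_lepP vle).
- by rewrite mdegD mdeg1 dv.
rewrite mpolyXD /=; apply: ideal_gen_sub; exists 'X_k, 'X_[v]; split=> //.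
by apply: ideal_gen_sub; exists k.
Qed.

Lemma mem_gens a u :
  u \in gens j a <-> min_mono_gen (ideal_exp (@PI K n ii j) a) u.
Proof.
rewrite /gens mem_sort mem_filter; split=> [/andP[/asboolP //]|hu].
rewrite asboolT //=; have du : mdeg u = a.
  have [hI hmin] := hu; have /exp_dvd[v [vu dv hv]] : (a <= bd u)%N.
    by apply: (exp_D hI); rewrite msuppX inE.
  by rewrite -(hmin v).
have lu : (mdeg u < a.+1)%N by rewrite du.
by apply/mapP; exists (BMultinom lu); rewrite ?mem_enum.
Qed.

End GensBound.
End Powers.

Record mgdouble (K : fieldType) (m : nat) := MGDouble {
  dterm : nat -> nat -> mgfree K m;
  drow : forall i j, {linear dterm i.+1 j -> dterm i j};
  dcol : forall i j, {linear dterm i j.+1 -> dterm i j}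
}.

Section Total.
Variables (K : fieldType) (m : nat) (C : mgdouble K m).
Local Notation R := {mpoly K[m]}.

(* T_k is the direct sum of the C_(i, k - i) for 0 <= i <= k. *)
Definition tot_term (k : nat) : mgfree K m :=
  @MGFree K m {i : 'I_k.+1 & fbasis (dterm C i (k - i))}
    (fun x => fdeg (tagged x)).

Definition tot_idx : Type := {i : nat & {j : nat & fbasis (dterm C i j)}}.

Definition to_idx (k : nat) (x : fbasis (tot_term k)) : tot_idx :=
  existT _ (tag x : nat) (existT _ (k - tag x)%N (tagged x)).

(* Coordinate at y of the image in T_k of the basis element b of C_ij; it is 0
   unless i + j = k. *)
Definition tsym (k : nat) (y : fbasis (tot_term k))
    (i j : nat) (b : fbasis (dterm C i j)) : R :=
  (to_idx y == (existT _ i (existT _ j b) : tot_idx))%:R.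

Definition tot_row (k : nat) (y : fbasis (tot_term k)) (i j : nat) :
    fbasis (dterm C i j) -> R :=
  match i return fbasis (dterm C i j) -> R with
  | 0 => fun _ => 0
  | i'.+1 => fun b => \sum_c mgcoord (drow C i' j (bvec b)) c * tsym y c
  end.

Definition tot_col (k : nat) (y : fbasis (tot_term k)) (i j : nat) :
    fbasis (dterm C i j) -> R :=
  match j return fbasis (dterm C i j) -> R with
  | 0 => fun _ => 0
  | j'.+1 => fun b => \sum_c mgcoord (dcol C i j' (bvec b)) c * tsym y c
  end.

Definition tot_diff (k : nat) : {linear tot_term k.+1 -> tot_term k} :=
  @lin_ext K m (tot_term k.+1) (tot_term k)
    (fun x y => tot_row y (tagged x) + (-1) ^+ (tag x) * tot_col y (tagged x)).

Definition tot_complex : mgcomplex K m := MGComplex tot_diff.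

End Total.

Section DoubleComplex.
Variables (K : fieldType) (n : nat) (ii : 'I_n -> nat) (F : mgcomplex K n).
Local Notation eta := (\sum_(j < n) ii j)%N.

Definition Gsum (i : nat) : bcomplex K eta :=
  bc_sum (fun l : fbasis (F i) => Gtensor K ii (fdeg l)).

Definition Gsum_map (i : nat) (x : bc_basis (Gsum i.+1)) (y : bc_basis (Gsum i)) :
    {mpoly K[eta]} :=
  if (fdeg (tag y) <= fdeg (tag x))%MM
  then (mon_mat (cdiff F i) (tag y) (tag x))%:MP
       * phi_tensor (tagged x) (tagged y)
  else 0.

Definition expansion_double : mgdouble K eta :=
  @MGDouble K eta (fun i j => bc_part (Gsum i) j)
    (fun i j => bc_part_map (@Gsum_map i) j)
    (fun i j => bc_part_diff (Gsum i) j).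

End DoubleComplex.

(* Main.v *)
Require Import Defs.
From HB Require Import structures.
From mathcomp Require Import all_boot all_order all_algebra.
From mathcomp.multinomials Require Import mpoly.
From mathcomp.classical Require Import boolp.
From mathcomp Require Import zify.

Set Implicit Arguments.
Unset Strict Implicit.
Unset Printing Implicit Defensive.

Import GRing.Theory.
Local Open Scope ring_scope.

(* Everything is homogeneous, so it suffices to work in one multidegree c of S^*
   at a time, where the maps become matrices over K. In degree c the expansion
   F^* is just F in degree d, where d is the vector of block degrees of c:
   indeed x^c lies in (x^a)^* iff a <= d. This gives exactness of F^* and
   identifies M^* with the cokernel of F_1^* -> F_0^*.

   For T(C), a basis element of G^a is a symbol f(sigma; u) with u of block degree
   a and sigma contained in set(u). For fixed u the symbols of degree at most c
   form the full simplex on { t in set(u) : u_t < c_t }, and every other term of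
   the differential either lowers the degree i in F or exchanges a variable of u
   for an earlier one. Hence a filtration reduces T(C) to the symbols for which this
   simplex is empty; these are the f(0; g_a(c)), one for each generator of F of
   degree a <= d, and together they form the complex F in degree d. *)

(** * Monomials and their block degrees *)

Section BlockMonomials.
Variables (m n : nat) (bl : 'I_m -> 'I_n).
Implicit Types (u v w : 'X_{1..m}) (a b : 'X_{1..n}) (s t k : 'I_m).

(** The lexicographic order of monomials enters only to identify set(u) with [aset] and g_a with
    [isgen]. After that, the uniqueness in [isgen] proves every identity between the operations u ->
    g_a(u) and u -> g_a(y_t u): both sides are the canonical divisor of the same monomial. An
    obstacle is the convention f(sigma; u) = 0 for sigma outside set(u), which would force a case
    distinction at each term of a boundary. The differential is therefore studied through its
    transpose, acting on functionals on all triples (generator, sigma, u); the convention becomes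
    the condition [vanish], which the transpose preserves. The filtration must be lowered both by
    the row maps and by the exchanges; this is achieved by the index in F followed by a weighted
    degree of u. A nonempty full simplex, with its empty face, is acyclic, and coning from its first
    vertex contracts it. The critical symbols carry exactly the differential of F because
    g_b(g_a(c)) = g_b(c). Since M^* is presented by an arbitrary psi, the augmentation of T(C) has
    to pass through a comparison of F_0 with the target of psi. *)

Definition bdeg u : 'X_{1..n} :=
  [multinom (\sum_(k < m | bl k == j) u k)%N | j < n].

Lemma bdegE u j : bdeg u j = (\sum_(k < m | bl k == j) u k)%N.
Proof. by rewrite mnmE. Qed.

Lemma bdegD u v : bdeg (u + v)%MM = (bdeg u + bdeg v)%MM.
Proof.
apply/mnmP => j; rewrite mnmDE !bdegE -big_split /=.
by apply: eq_bigr => k _; rewrite mnmDE.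
Qed.

Lemma bdeg0 : bdeg 0%MM = 0%MM.
Proof. by apply/mnmP => j; rewrite bdegE mnm0E big1 // => k _; rewrite mnm0E. Qed.

Lemma bdegU k : bdeg U_(k)%MM = U_(bl k)%MM.
Proof.
apply/mnmP => j; rewrite bdegE mnm1E big_mkcond (bigD1 k) //= mnm1E eqxx.
rewrite big1 ?addn0; first by case: eqP.
by move=> i ne; rewrite mnm1E (eq_sym k) (negbTE ne) if_same.
Qed.

Lemma bdeg_le u v : (u <= v)%MM -> (bdeg u <= bdeg v)%MM.
Proof. by move/submK <-; rewrite bdegD lem_addl. Qed.

Lemma mdeg_bdeg u : mdeg (bdeg u) = mdeg u.
Proof.
rewrite !mdegE (partition_big bl predT) //=.
by apply: eq_bigr => j _; rewrite bdegE.
Qed.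

Lemma lem_mdeg_eq (p : nat) (u v : 'X_{1..p}) :
  (u <= v)%MM -> mdeg v = mdeg u -> u = v.
Proof.
move/submK => <-; rewrite mdegD -[in RHS](add0n (mdeg u)) => /addIn /eqP.
by rewrite mdeg_eq0 => /eqP ->; rewrite add0m.
Qed.

Lemma le_bdeg_eq u v : (u <= v)%MM -> bdeg u = bdeg v -> u = v.
Proof. by move=> le e; apply: lem_mdeg_eq => //; rewrite -!mdeg_bdeg e. Qed.

Lemma bdeg_gt0 u k : (0 < u k)%N -> (0 < bdeg u (bl k))%N.
Proof. by move=> uk; rewrite bdegE (bigD1 k) //= ltn_addr. Qed.

Lemma sub_bdeg a v : (a <= bdeg v)%MM -> exists2 u, (u <= v)%MM & bdeg u = a.
Proof.
elim: {v}(mdeg v) {-2}v (leqnn (mdeg v)) => [|d IHd] v dv le.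
  exists v; first exact: lepm_refl.
  apply/esym/lem_mdeg_eq => //; move: dv (mdegD (bdeg v - a)%MM a).
  rewrite submK // mdeg_bdeg; lia.
have [e|/eqP ne] := eqVneq (bdeg v) a; first by exists v; rewrite ?lepm_refl.
have [j lt] : exists j, (a j < bdeg v j)%N.
  apply/existsP; apply: contra_notT ne => /existsPn h; apply/mnmP => j.
  by apply/eqP; rewrite eqn_leq (mnm_lepP le) leqNgt h.
have [k kj vk] : exists2 k, bl k = j & (0 < v k)%N.
  move: lt; rewrite bdegE => /(leq_ltn_trans (leq0n _)); rewrite lt0n sum_nat_eq0.
  by rewrite negb_forall => /existsP[k]; rewrite negb_imply -lt0n => /andP[/eqP]; exists k.
have Uv : (U_(k) <= v)%MM by rewrite lep1mP -lt0n.
have ev := submK Uv.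
have [||u uv du] := IHd (v - U_(k))%MM.
- by move: dv; rewrite -{1}ev mdegD mdeg1 addn1.
- apply/mnm_lepP => i; move: (mnm_lepP le i) lt.
  have e l : bdeg v l = (bdeg (v - U_(k)) l + (j == l))%N.
    by rewrite -{1}ev bdegD bdegU mnmDE mnm1E kj.
  by rewrite !e eqxx; case: eqP => [<-|_]; lia.
exists u => //; exact: lepm_trans uv (lem_subr _ _).
Qed.

(** This is set(u) read off from exponents: an earlier generator divides y_t u exactly when y_t can
    replace a later variable of its block. All blocks are treated together, so the same definition
    serves the tensor product. *)
Definition aset u : {set 'I_m} :=
  [set t : 'I_m | [exists s : 'I_m, [&& (t < s)%N, bl s == bl t & (0 < u s)%N]]].

Lemma asetP u t :
  reflect (exists s : 'I_m, [/\ (t < s)%N, bl s = bl t & (0 < u s)%N]) (t \in aset u).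
Proof.
rewrite inE; apply: (iffP existsP) => -[s].
  by case/and3P=> ? /eqP ? ?; exists s.
by case=> ? /eqP ? ?; exists s; apply/and3P.
Qed.

Lemma aset_le u v : (u <= v)%MM -> aset u \subset aset v.
Proof.
move=> /mnm_lepP le; apply/subsetP => t /asetP[s [ts bs us]].
by apply/asetP; exists s; split=> //; apply: leq_trans (le s).
Qed.

(** The only new factor is y_t, and an index before t in its block is also before the later variable
    that puts t into [aset u]. *)
Lemma aset_mul u s t : t \in aset u -> s \in aset (U_(t) + u)%MM -> s \in aset u.
Proof.
move=> /asetP[r [tr br ur]] /asetP[r' [sr' br']]; rewrite mnmDE mnm1E.
have [e|_] := eqVneq t r'; last by move=> ?; apply/asetP; exists r'.
rewrite -e in sr' br'.
by move=> _; apply/asetP; exists r; rewrite br; split=> //; apply: ltn_trans tr.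
Qed.

(* [isgen a v w] characterizes w = g_a(v), the lexicographically largest
   monomial of block degree a dividing v: no factor y_s of w can be exchanged
   for an earlier variable y_t of the same block. *)
Definition isgen a v w := [/\ (w <= v)%MM, bdeg w = a &
  forall t, t \in aset w -> w t = v t].

(** At the first index where the two differ, say with [w] smaller, there are two cases. Either [w]
    has an excess at a later variable of the block, and the condition on [aset w] makes its exponent
    as large as that of [v]; or the block degree of [w] is too small. *)
Lemma isgen_uniq a v w w' : isgen a v w -> isgen a v w' -> w = w'.
Proof.
move=> [le d h] [le' d' h']; apply/mnmP => k; have [//|nek] := eqVneq (w k) (w' k); exfalso.
have [k0 /= nk0 mink0] : exists2 k0 : 'I_m, w k0 != w' k0 &
    forall l : 'I_m, (l < k0)%N -> w l = w' l.
  have [k0 nk0 mk0] := @arg_minnP _ k (fun k => w k != w' k) val nek.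
  exists k0 => // l; rewrite ltnNge; apply: contraNeq => /mk0.
  by [].
wlog lt : w w' le d h le' d' h' {nek} nk0 mink0 / (w k0 < w' k0)%N.
  move=> wl; have := nk0; rewrite neq_ltn => /orP[lt|lt].
    exact: (wl w w').
  apply: (wl w' w) => //; first by rewrite eq_sym.
  by move=> l /mink0.
have [/existsP[s /and3P[ks bs ws]]|/existsPn hn] :=
    boolP [exists s : 'I_m, [&& (k0 < s)%N, bl s == bl k0 & (w' s < w s)%N]].
  have : k0 \in aset w.
    by apply/asetP; exists s; split; [|apply/eqP|apply: leq_ltn_trans ws].
  by move/h => e; move: (mnm_lepP le' k0) lt; rewrite e; lia.
have : bdeg w (bl k0) = bdeg w' (bl k0) by rewrite d d'.
rewrite !bdegE (bigD1 k0) //= [RHS](bigD1 k0) //=.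
have : (\sum_(i | (bl i == bl k0) && (i != k0)) w i <=
        \sum_(i | (bl i == bl k0) && (i != k0)) w' i)%N.
  apply: leq_sum => i /andP[bi ni]; case: (ltngtP i k0) => [/mink0 -> //|ki|e].
    by have := hn i; rewrite ki bi /= -leqNgt.
  by case/eqP: ni; apply: val_inj.
move=> leS e; have := leq_add lt leS; rewrite addSn => /leq_trans.
by move/(_ _ (eq_leq (esym e))); rewrite ltnn.
Qed.

Lemma isgen_id u : isgen (bdeg u) u u.
Proof. by split=> //; apply: lepm_refl. Qed.

Lemma isgen_trans a b v w w' : isgen a v w -> isgen b w w' -> isgen b v w'.
Proof.
move=> [le d h] [le' d' h']; split=> //; first exact: lepm_trans le' le.
by move=> t tw; rewrite h' // h // (subsetP (aset_le le')).
Qed.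

Lemma isgen_mulN a v u t : isgen a v u -> t \notin aset u -> isgen a (U_(t) + v)%MM u.
Proof.
move=> [le d h] tu; split=> //; first by apply: lepm_trans le (lem_addl _ _).
move=> s su; rewrite mnmDE mnm1E -h //.
by case: eqP => // e; rewrite -e in su; rewrite su in tu.
Qed.

(** The rule g_a(y_t v) = g_a(y_t g_a(v)). For t outside [aset u] both sides are [u]; otherwise
    [aset w] lies in [aset u], where [u] and [v] have equal exponents. *)
Lemma isgen_mul a v u w t : isgen a v u -> isgen a (U_(t) + u)%MM w ->
  isgen a (U_(t) + v)%MM w.
Proof.
move=> gu gw; have [tu|tu] := boolP (t \in aset u); last first.
  have gu' : isgen a (U_(t) + u)%MM u.
    by apply: isgen_mulN => //; have [_ <- _] := gu; exact: isgen_id.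
  by rewrite (isgen_uniq gw gu'); exact: isgen_mulN.
have [le d h] := gu; have [le' d' h'] := gw; split=> //.
  apply: lepm_trans le' _; apply/mnm_lepP => i; rewrite !mnmDE leq_add2l.
  exact: (mnm_lepP le).
move=> s sw; rewrite h' // !mnmDE h // (aset_mul tu) //.
exact: (subsetP (aset_le le')).
Qed.

(** Here y_t u = y_s w with s in the block of t. If s were at most t, the later variable that puts t
    into [aset u] would put s into [aset w], and [w] would already contain the full power of y_s. So
    s is later than t, and the weight drops by s - t. *)
Lemma isgen_weight a u w t : bdeg u = a -> t \in aset u ->
  isgen a (U_(t) + u)%MM w -> (mnmwgt w < mnmwgt u)%N.
Proof.
move=> du tu [le d h]; have ev := submK le.
have : bdeg (U_(t) + u - w)%MM = U_(bl t)%MM.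
  by apply: (@addIm _ a); rewrite -{1}d -bdegD ev bdegD bdegU du.
move=> bv; have := congr1 (@mdeg _) bv; rewrite mdeg_bdeg mdeg1 => /eqP/mdeg1P[s /eqP es].
move: bv; rewrite es bdegU => /eqP; rewrite eq_mnm1 => /eqP bs.
rewrite es in ev; have := congr1 (@mnmwgt _) ev; rewrite !mnmwgtD !mnmwgt1.
suff ts : (t < s)%N by lia.
rewrite ltnNge; apply/negP => st.
have [r [tr br ur]] := asetP _ _ tu.
have : s \in aset w.
  apply/asetP; exists r; split; [exact: leq_ltn_trans tr|by rewrite br|].
  have := congr1 (fun v => v r) ev; rewrite !mnmDE !mnm1E.
  by have /negbTE -> : s != r; [apply: contraTneq tr => <-; rewrite -leqNgt|lia].
move/h => e; have := congr1 (fun v => v s) ev.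
by rewrite [LHS]mnmDE mnm1E eqxx -e; lia.
Qed.

(* In multidegree c, the critical u are the g_a(c). *)
Definition crit c u : bool := [forall t in aset u, u t == c t].

Lemma critP c u : reflect (forall t, t \in aset u -> u t = c t) (crit c u).
Proof.
by apply: (iffP forall_inP) => h t tu; apply/eqP; apply: h.
Qed.

Lemma crit_isgen c u : (u <= c)%MM -> crit c u -> isgen (bdeg u) c u.
Proof. by move=> le /critP h; split. Qed.

End BlockMonomials.

(** * Generators of the powers of P_j *)

Section Generators.
Variables (K : fieldType) (n : nat) (ii : 'I_n -> nat).
Local Notation eta := (\sum_(j < n) ii j)%N.
Local Notation Ss := {mpoly K[eta]}.
Local Notation bl := (@tagnat.sig1 n ii).
Local Notation bdeg := (bdeg bl).
Local Notation aset := (aset bl).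
Local Notation isgen := (isgen bl).
Local Notation PI := (@PI K n ii).
Implicit Types (u v w : 'X_{1..eta}) (a b : 'X_{1..n}) (j : 'I_n) (d : nat).

(** Ideal products are defined by the existence of combinations, so excluding a monomial needs an
    invariant; block degrees of the occurring monomials provide it. *)
Definition suppge a (p : Ss) := forall u, u \in msupp p -> (a <= bdeg u)%MM.

Lemma suppge_ideal a : is_ideal (suppge a).
Proof.
split=> [u|p q hp hq u|r p hp u].
- by rewrite msupp0.
- by move=> /msuppD_le; rewrite mem_cat => /orP[/hp|/hq].
move=> /msuppM_le /allpairsP[[v w] /= [_ /hp hw ->]].
by apply: lepm_trans hw _; rewrite bdegD lem_addl.
Qed.

Lemma suppge_mul I J a b : (forall p, I p -> suppge a p) ->
  (forall p, J p -> suppge b p) -> forall p, ideal_mul I J p -> suppge (a + b)%MM p.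
Proof.
move=> hI hJ p; have [h0 hD hM] := suppge_ideal (a + b)%MM.
apply: ideal_gen_incl => // _ [q [r [/hI hq /hJ hr ->]]] u.
move=> /msuppM_le /allpairsP[[v w] /= [/hq hv /hr hw ->]].
rewrite bdegD; apply/mnm_lepP => i; rewrite !mnmDE.
by apply: leq_add; apply: mnm_lepP.
Qed.

Lemma suppge_exp j d p : ideal_exp (PI j) d p -> suppge (U_(j) *+ d)%MM p.
Proof.
elim: d p => [|d IHd] p.
  by move=> _ u _; rewrite mulm0n; apply/mnm_lepP => i; rewrite mnm0E.
rewrite mulmS; apply: suppge_mul => // {}p; have [h0 hD hM] := suppge_ideal U_(j)%MM.
apply: ideal_gen_incl => // _ [k kj ->] u; rewrite msuppX inE => /eqP ->.
by rewrite bdegU kj lepm_refl.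
Qed.

Lemma ideal_mulX (I J : Ss -> Prop) a b : (forall u, bdeg u = a -> I 'X_[u]) ->
  (forall u, bdeg u = b -> J 'X_[u]) ->
  forall u, bdeg u = (a + b)%MM -> ideal_mul I J 'X_[u].
Proof.
move=> hI hJ u du; have [|v vu dv] := @sub_bdeg _ _ bl a u.
  by rewrite du lem_addr.
have := submK vu => e; rewrite -e addmC mpolyXD; apply: ideal_gen_sub.
exists 'X_[v], 'X_[u - v]; split=> //; first exact: hI.
by apply: hJ; apply: (@addIm _ a); rewrite -{1}dv -bdegD e du addmC.
Qed.

Lemma ideal_expX j d u : bdeg u = (U_(j) *+ d)%MM -> ideal_exp (PI j) d 'X_[u].
Proof.
elim: d u => [|d IHd] u //=; rewrite mulmS; apply: ideal_mulX => // v dv.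
apply: ideal_gen_sub.
have : mdeg v == 1%N by rewrite -(mdeg_bdeg bl) dv mdeg1.
case/mdeg1P=> k /eqP ev; exists k; rewrite ?ev //.
by move/eqP: dv; rewrite ev bdegU eq_mnm1 => /eqP.
Qed.

Lemma ideal_X_le (I : Ss -> Prop) a : is_ideal I ->
    (forall u, bdeg u = a -> I 'X_[u]) ->
  forall u, (a <= bdeg u)%MM -> I 'X_[u].
Proof.
move=> [_ _ IM] h u /sub_bdeg[v vu dv].
by rewrite -(submK vu) mpolyXD; apply/IM/h.
Qed.

Lemma ideal_exp_X j d u : ideal_exp (PI j) d 'X_[u] <-> (U_(j) *+ d <= bdeg u)%MM.
Proof.
split=> [/suppge_exp h|]; first by apply: h; rewrite msuppX inE.
by apply: ideal_X_le; [exact: ideal_exp_ideal|exact: ideal_expX].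
Qed.

Lemma sum_mnm1 a : a = (\big[mnm_add/0]_(j < n) (U_(j) *+ a j))%MM.
Proof. exact: multinomUE_id. Qed.

(** Both directions build the product one block at a time: lower bounds for block degrees add under
    ideal products, and a monomial of block degree a + b splits into factors of block degrees a and
    b. *)
Lemma xstar_X a u : xstar a ('X_[u] : Ss) <-> (a <= bdeg u)%MM.
Proof.
split.
  suff h p : xstar a p -> suppge a p.
    by move/h; apply; rewrite msuppX inE.
  rewrite [in suppge _ _](sum_mnm1 a); move: p.
  apply: (big_ind2 (fun (I : Ss -> Prop) b => forall p, I p -> suppge b p)).
  - by move=> p _ v _; apply/mnm_lepP => i; rewrite mnm0E.
  - by move=> I b J b' hI hJ p; exact: suppge_mul.
  - by move=> j _ p; exact: suppge_exp.
apply: ideal_X_le; first exact: xstar_ideal.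
rewrite {1}(sum_mnm1 a).
apply: (big_ind2 (fun (I : Ss -> Prop) b => forall u, bdeg u = b -> I 'X_[u])) => //.
- by move=> I b J b' hI hJ; exact: ideal_mulX.
- by move=> j _; exact: ideal_expX.
Qed.

Local Notation gens := (@gens K n ii).
Local Notation set_gen := (@set_gen K n ii).
Local Notation gfun := (@gfun K n ii).
Local Notation mono_ideal := (@mono_ideal K n ii).

Lemma gensE j d u : (u \in gens j d) = (bdeg u == (U_(j) *+ d)%MM).
Proof.
apply/idP/eqP => [|du].
  rewrite mem_gens => -[/ideal_exp_X /sub_bdeg[v vu dv] h].
  by rewrite -dv (h v) //; apply/ideal_exp_X; rewrite dv lepm_refl.
rewrite mem_gens; split; first by apply/ideal_exp_X; rewrite du lepm_refl.
move=> v vu /ideal_exp_X hv; apply: (le_bdeg_eq (bl := bl)) => //.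
apply: lem_mdeg_eq; first exact: bdeg_le.
apply/eqP; rewrite eqn_leq.
have le_mdeg (p : nat) (x y : 'X_{1..p}) : (x <= y)%MM -> (mdeg x <= mdeg y)%N.
  by move/submK <-; rewrite mdegD leq_addl.
by rewrite du le_mdeg //= -du le_mdeg // bdeg_le.
Qed.

Lemma gens_block j d u k : u \in gens j d -> bl k != j -> u k = 0%N.
Proof.
rewrite gensE => /eqP du kj; have := @bdeg_gt0 _ _ bl u k.
by rewrite du mulmnE mnm1E eq_sym (negbTE kj) mul0n; case: (u k) => // ? /(_ isT).
Qed.

Lemma mono_ideal_X (s : seq 'X_{1..eta}) u :
  mono_ideal s 'X_[u] <-> exists2 w, w \in s & (w <= u)%MM.
Proof.
split=> [|[w ws wu]]; last first.
  rewrite -(submK wu) mpolyXD; apply/ideal_genM/ideal_gen_sub.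
  by exists w.
suff h p : mono_ideal s p -> forall v, v \in msupp p -> exists2 w, w \in s & (w <= v)%MM.
  by move/h; apply; rewrite msuppX inE.
apply: (ideal_gen_incl (I := fun p : Ss =>
  forall v, v \in msupp p -> exists2 w, w \in s & (w <= v)%MM))
  => {p} [v|p q hp hq v|r p hp v|_ [w ws ->] v].
- by rewrite msupp0.
- by move=> /msuppD_le; rewrite mem_cat => /orP[/hp|/hq].
- move=> /msuppM_le /allpairsP[[v' w'] /= [_ /hp[w ws le] ->]]; exists w => //.
  by apply: lepm_trans le (lem_addl _ _).
- by rewrite msuppX inE => /eqP ->; exists w; rewrite ?lepm_refl.
Qed.

Lemma lex_first u v : u != v ->
  exists2 k, u k != v k & forall l : 'I_eta, (l < k)%N -> u l = v l.
Proof.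
move=> ne; have [k nk] : exists k, u k != v k.
  apply/existsP; apply: contraNT ne => /existsPn h; apply/eqP/mnmP => k.
  by apply/eqP/negPn/h.
have [k0 nk0 mk0] := @arg_minnP _ k (fun k => u k != v k) val nk.
by exists k0 => // l; rewrite ltnNge; apply: contraNeq => /mk0.
Qed.

Lemma lex_geP u v k : u k != v k -> (forall l : 'I_eta, (l < k)%N -> u l = v l) ->
  lex_ge u v = (v k < u k)%N.
Proof.
move=> nk hk; apply/idP/idP => [|vk].
  case/orP=> [/eqP e|]; first by rewrite e eqxx in nk.
  case/existsP=> r /andP[lt /forallP h]; case: (ltngtP r k) => [/hk e|kr|/ord_inj <-//].
    by rewrite e ltnn in lt.
  by have := h k; rewrite kr (negbTE nk).
apply/orP; right; apply/existsP; exists k; rewrite vk; apply/forallP => l.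
by apply/implyP => /hk ->.
Qed.

Lemma lex_ge_total : total (@lex_ge n ii).
Proof.
move=> u v; have [->|/lex_first[k nk hk]] := eqVneq u v; first by rewrite /lex_ge eqxx.
rewrite (lex_geP nk hk) (@lex_geP v u k) 1?eq_sym //; last by move=> l /hk.
by case: ltngtP nk => // ->; rewrite eqxx.
Qed.

Lemma lex_ge_anti : antisymmetric (@lex_ge n ii).
Proof.
move=> u v; have [->//|/lex_first[k nk hk]] := eqVneq u v.
rewrite (lex_geP nk hk) (@lex_geP v u k) 1?eq_sym //; last by move=> l /hk.
by case: ltngtP.
Qed.

Lemma lex_ge_trans : transitive (@lex_ge n ii).
Proof.
move=> v u w /orP[/eqP -> //|/existsP[k /andP[lk /forallP hk]]].
case/orP=> [/eqP <-|/existsP[r /andP[lr /forallP hr]]].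
  by apply/orP; right; apply/existsP; exists k; rewrite lk; apply/forallP.
apply/orP; right; apply/existsP; exists (if (k < r)%N then k else r).
case: (ltngtP k r) => [kr|rk|/ord_inj e].
- have /eqP <- := implyP (hr k) kr; rewrite lk; apply/forallP => l; apply/implyP => lk'.
  by rewrite (eqP (implyP (hk l) lk')) (implyP (hr l)) // (ltn_trans lk').
- rewrite (eqP (implyP (hk r) rk)) lr; apply/forallP => l; apply/implyP => lr'.
  by rewrite (eqP (implyP (hk l) (ltn_trans lr' rk))) (implyP (hr l)).
- rewrite -e in lr hr *; rewrite (ltn_trans lr lk); apply/forallP => l; apply/implyP => lr'.
  by rewrite (eqP (implyP (hk l) lr')) (implyP (hr l)).
Qed.

Lemma lex_ge_refl : reflexive (@lex_ge n ii).
Proof. by move=> u; rewrite /lex_ge eqxx. Qed.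

Lemma gens_sorted j d : sorted (@lex_ge n ii) (gens j d).
Proof. exact/sort_sorted/lex_ge_total. Qed.

Lemma gens_index_lt j d u v : v \in gens j d -> u \in gens j d -> v != u ->
  lex_ge v u -> (index v (gens j d) < index u (gens j d))%N.
Proof.
move=> vg ug ne le; rewrite ltnNge; apply: contra ne => iuv; apply/eqP.
apply: lex_ge_anti; rewrite le /=.
exact: (sorted_leq_index lex_ge_trans lex_ge_refl (gens_sorted j d)).
Qed.

Lemma lex_ge_exchange u (s t : 'I_eta) : (t < s)%N -> (0 < u s)%N ->
  lex_ge (U_(t) + u - U_(s))%MM u /\ (U_(t) + u - U_(s))%MM != u.
Proof.
move=> ts us; have st : (s == t) = false by apply: contraTF ts => /eqP ->; rewrite ltnn.
have e1 : ((U_(t) + u - U_(s))%MM t = (u t).+1)%N.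
  by rewrite mnmBE mnmDE !mnm1E eqxx st; lia.
have ne : (U_(t) + u - U_(s))%MM t != u t by rewrite e1; lia.
split; last by apply: contraNneq ne => ->.
rewrite (lex_geP ne) ?e1 // => l lt; rewrite mnmBE mnmDE !mnm1E.
have -> : (t == l) = false by apply: contraTF lt => /eqP ->; rewrite ltnn.
have -> : (s == l) = false.
  by apply: contraTF lt => /eqP <-; rewrite -leqNgt ltnW.
by lia.
Qed.

Lemma bdeg_exchange u s t : bl s = bl t -> (0 < u s)%N ->
  bdeg (U_(t) + u - U_(s))%MM = bdeg u.
Proof.
move=> bs us; apply: (@addIm _ U_(bl s)%MM); rewrite -[in LHS](bdegU bl) -bdegD submK.
  by rewrite bdegD bdegU addmC bs.
by rewrite lep1mP mnmDE -lt0n addn_gt0 us orbT.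
Qed.

(** An earlier generator [v] dividing y_k u can exceed [u] only at k, so k is where the two first
    differ; equal degrees then leave a later variable of which [u] has more. Conversely, exchanging
    such a variable for y_k gives an earlier generator. *)
Lemma set_genE j d u : u \in gens j d -> set_gen j d u = aset u.
Proof.
move=> ug; apply/setP => k; rewrite inE; apply/asboolP/asetP.
  rewrite /ideal_colon -mpolyXD => /mono_ideal_X[v vs le].
  have vg : v \in gens j d by exact: mem_take vs.
  have ne : v != u by apply: contraTneq vs => ->; rewrite in_take ?ltnn.
  have lev : lex_ge v u.
    apply: (sorted_leq_index lex_ge_trans lex_ge_refl (gens_sorted j d)) => //.
    by rewrite ltnW // -in_take.
  have [r nr hr] := lex_first ne; rewrite (lex_geP nr hr) in lev.
  have ek : k = r.
    apply/eqP; have := mnm_lepP le r; rewrite mnmDE mnm1E; case: eqP => // _; lia.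
  rewrite -ek in nr hr lev.
  have dv : mdeg v = mdeg u.
    by rewrite -!(mdeg_bdeg bl); move: ug vg; rewrite !gensE => /eqP -> /eqP ->.
  have [s lts] : exists s, (v s < u s)%N.
    apply/existsP; apply: contraTT isT => /existsPn h.
    suff : u = v by move/eqP; rewrite eq_sym (negbTE ne).
    by apply: lem_mdeg_eq => //; apply/mnm_lepP => i; rewrite leqNgt.
  exists s; split.
  - rewrite ltnNge; apply/negP; rewrite leq_eqVlt => /orP[/eqP/ord_inj e|/hr e].
      by move: lts lev; rewrite e; lia.
    by rewrite e ltnn in lts.
  - transitivity j; apply/eqP; apply: contraTT isT => ne'.
      by move: lts; rewrite (gens_block ug ne') ltn0.
    by move: lev; rewrite (gens_block vg) 1?eq_sym // ltn0.
  - exact: leq_ltn_trans lts.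
case=> s [ks bs us]; rewrite /ideal_colon -mpolyXD; apply/mono_ideal_X.
have [le ne] := lex_ge_exchange ks us.
have vg : (U_(k) + u - U_(s))%MM \in gens j d.
  by rewrite gensE bdeg_exchange // -gensE.
exists (U_(k) + u - U_(s))%MM; last exact: lem_subr.
by rewrite in_take // gens_index_lt.
Qed.

(** The first generator dividing [v] admits no exchange inside [v]: if [v] had a further factor y_t,
    replacing a later variable of the block by y_t would give an earlier generator dividing [v]. *)
Lemma gfun_isgen j d v : (U_(j) *+ d <= bdeg v)%MM ->
  isgen (U_(j) *+ d)%MM v (gfun j d v).
Proof.
move=> le; rewrite /gfun.
set P := fun l => `[< mono_ideal (take l.+1 (gens j d)) ('X_[v] : Ss) >].
set s := iota 0 (size (gens j d)); set i := find P s.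
have [w0 w0v dw0] := sub_bdeg le.
have w0g : w0 \in gens j d by rewrite gensE dw0.
have PX w : w \in gens j d -> (w <= v)%MM -> P (index w (gens j d)).
  move=> wg wv; apply/asboolP/mono_ideal_X; exists w => //.
  by rewrite in_take_leq // index_mem.
have hasP : has P s.
  apply/hasP; exists (index w0 (gens j d)); last exact: PX.
  by rewrite mem_iota index_mem.
have isz : (i < size (gens j d))%N by rewrite -(size_iota 0 (size (gens j d))) -has_find.
have Pi : P i by have := nth_find 0%N hasP; rewrite -/i nth_iota.
have mini w : w \in gens j d -> (w <= v)%MM -> (i <= index w (gens j d))%N.
  move=> wg wv; rewrite leqNgt; apply/negP => lt.
  have := before_find 0%N lt; rewrite nth_iota ?add0n ?PX //.
  exact: ltn_trans isz.
have [w ws wv] : exists2 w, w \in take i.+1 (gens j d) & (w <= v)%MM.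
  by move/asboolP/mono_ideal_X: Pi.
have wg : w \in gens j d by exact: mem_take ws.
(* [take i.+1] holds the indices up to [i], and no generator dividing [v] has a smaller index. *)
have ew : index w (gens j d) = i.
  apply/eqP; rewrite eqn_leq mini // andbT -ltnS.
  by rewrite -in_take_leq.
rewrite -ew nth_index //; split=> //.
  by apply/eqP; rewrite -gensE.
move=> t /asetP[s' [ts bs ws']]; apply/eqP; rewrite eqn_leq (mnm_lepP wv) leqNgt.
apply/negP => lt; have [leL ne] := lex_ge_exchange ts ws'.
have vg : (U_(t) + w - U_(s'))%MM \in gens j d.
  by rewrite gensE bdeg_exchange // -gensE.
have := gens_index_lt vg wg ne leL; rewrite ew ltnNge mini //.
apply/mnm_lepP => l; rewrite mnmBE mnmDE !mnm1E; apply: leq_trans (leq_subr _ _) _.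
by case: eqP => [<-|_] //; exact: (mnm_lepP wv).
Qed.

(** The map g_a of the whole product. Its factors live in disjoint blocks, so the blockwise choices
    together are again characterized by [isgen]. *)
Definition gcomb a v : 'X_{1..eta} := (\big[mnm_add/0]_(j < n) gfun j (a j) v)%MM.

Lemma gfun_block j d v k : (U_(j) *+ d <= bdeg v)%MM -> bl k != j -> gfun j d v k = 0%N.
Proof.
move=> le; apply: (@gens_block j d); rewrite gensE.
by have [_ -> _] := gfun_isgen le.
Qed.

Lemma le_mulmn1 a v j : (a <= bdeg v)%MM -> (U_(j) *+ a j <= bdeg v)%MM.
Proof.
move=> le; apply/mnm_lepP => i; rewrite mulmnE mnm1E.
by case: eqP => [<-|_]; rewrite ?mul1n // (mnm_lepP le).
Qed.

Lemma gcombE a v k : (a <= bdeg v)%MM -> gcomb a v k = gfun (bl k) (a (bl k)) v k.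
Proof.
move=> le; rewrite /gcomb mnm_sumE (bigD1 (bl k)) //= [X in (_ + X)%N]big1 ?addn0 // => j ne.
by rewrite gfun_block 1?eq_sym // le_mulmn1.
Qed.

Lemma gcomb_isgen a v : (a <= bdeg v)%MM -> isgen a v (gcomb a v).
Proof.
move=> le; have hj j := gfun_isgen (le_mulmn1 j le); split.
- apply/mnm_lepP => k; rewrite gcombE //.
  by have [/mnm_lepP + _ _] := hj (bl k); apply.
- rewrite [RHS]sum_mnm1 /gcomb.
  apply: (big_ind2 (fun u b => bdeg u = b)); first exact: bdeg0.
    by move=> u b u' b' <- <-; rewrite bdegD.
  by move=> j _; have [] := hj j.
move=> t /asetP[s [ts bs]]; rewrite !gcombE // bs => gs.
have [_ _] := hj (bl t); apply; apply/asetP; exists s; split=> //.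
Qed.

End Generators.

(** * The total complex in terms of symbols *)

Section AlternatingSums.
Variables (K : fieldType) (m : nat).
Implicit Types (sigma : {set 'I_m}) (s t : 'I_m).

Definition below sigma t : nat := #|[set s in sigma | (s < t)%N]|.

Lemma belowD1 sigma s t : s \in sigma -> s != t ->
  below sigma t = (below (sigma :\ s) t + (s < t))%N.
Proof.
move=> ss st; rewrite /below (cardsD1 s) inE ss addnC /=; congr (_ + _)%N.
by apply: eq_card => r; rewrite !inE andbA.
Qed.

Lemma belowU1 sigma t : below (t |: sigma) t = below sigma t.
Proof.
apply: eq_card => r; rewrite !inE; case: eqP => //= ->.
by rewrite ltnn andbF.
Qed.

Lemma below_min sigma t : (forall s, s \in sigma -> (t <= s)%N) -> below sigma t = 0%N.
Proof.
move=> h; apply/eqP; rewrite cards_eq0; apply/eqP/setP => s; rewrite !inE.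
by apply/negP => /andP[/h]; rewrite leqNgt => /negP.
Qed.

(** Removing the smaller of two elements first shifts the position of the larger one, so (t, s) and
    (s, t) carry opposite signs and a symmetric [Q] cancels in pairs. *)
Lemma alternating_sum0 sigma (Q : 'I_m -> 'I_m -> K) : (forall s t, Q s t = Q t s) ->
  \sum_(t in sigma) (-1) ^+ below sigma t *
    (\sum_(s in sigma :\ t) (-1) ^+ below (sigma :\ t) s * Q t s) = 0.
Proof.
move=> symQ; pose G t s := (-1) ^+ below sigma t * ((-1) ^+ below (sigma :\ t) s * Q t s).
have -> : \sum_(t in sigma) (-1) ^+ below sigma t *
    (\sum_(s in sigma :\ t) (-1) ^+ below (sigma :\ t) s * Q t s) =
  \sum_(t in sigma) \sum_(s in sigma | (s < t)%N) G t s +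
  \sum_(t in sigma) \sum_(s in sigma | (t < s)%N) G t s.
  rewrite -big_split; apply: eq_bigr => t ts /=; rewrite big_distrr /=.
  rewrite (bigID (fun s : 'I_m => (s < t)%N)) /=; congr (_ + _).
    apply: eq_bigl => s; rewrite !inE; case: eqP => [->|] //=.
    by rewrite ltnn andbF.
  apply: eq_bigl => s; rewrite !inE -leqNgt leq_eqVlt.
  have [->|ne] := eqVneq s t; first by rewrite ltnn andbF.
  by rewrite eq_sym (negbTE (ne : (s : nat) != t)).
rewrite [X in _ + X](exchange_big_dep (mem sigma)) /=; last by move=> ? ? _ /andP[].
rewrite -big_split big1 //= => t ts.
apply/eqP; rewrite addr_eq0 -sumrN; apply/eqP; apply: eq_big => [s|s /andP[ss st]].
  by rewrite ts.
have nst : s != t by apply: contraTneq st => ->; rewrite ltnn.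
have nts : t != s by rewrite eq_sym.
rewrite /G (belowD1 ss nst) (belowD1 ts nts) (symQ s t) st.
have -> : (t < s)%N = false by rewrite ltnNge ltnW.
by rewrite addn0 addn1 exprS mulN1r mulNr; congr (- _); rewrite mulrCA.
Qed.

End AlternatingSums.

(** * The complex of symbols with scalar coefficients *)

Section SymbolComplex.
Variables (K : fieldType) (m n : nat) (bl : 'I_m -> 'I_n).
Variables (F : nat -> mgfree K n).
Variable lam : forall i, fbasis (F i) -> fbasis (F i.+1) -> K.
Variable g : 'X_{1..n} -> 'X_{1..m} -> 'X_{1..m}.
Local Notation bdeg := (bdeg bl).
Local Notation aset := (aset bl).
Local Notation isgen := (isgen bl).

Hypothesis lam_le : forall i b' b, @lam i b' b != 0 -> (fdeg b' <= fdeg b)%MM.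
Hypothesis lam_comp : forall i b'' (b : fbasis (F i.+2)),
  \sum_b' lam b'' b' * @lam i.+1 b' b = 0.
Hypothesis gP : forall a v, (a <= bdeg v)%MM -> isgen a v (g a v).

(** A cell is a basis element of some F_i. A point (l, sigma, u) stands for the symbol f(sigma; u)
    of G^a, where a is the degree of l, with sigma and u taken over all blocks together. *)
Local Notation cell := {i : nat & fbasis (F i)}.
Local Notation point := (cell * {set 'I_m} * 'X_{1..m})%type.
Implicit Types (l : cell) (sigma : {set 'I_m}) (u v c : 'X_{1..m}) (s t : 'I_m)
  (q : point) (H : cell -> {set 'I_m} -> 'X_{1..m} -> K).

Definition cdeg l : 'X_{1..n} := fdeg (tagged l).
Definition bcell i (b : fbasis (F i)) : cell := Tagged (fun i => fbasis (F i)) b.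

(** The transpose of the differential of F. Nothing leaves F_0, hence the zero branch. *)
Definition rowsum l (f : cell -> K) : K :=
  match l with existT i b =>
    match i return fbasis (F i) -> K with
    | 0 => fun=> 0
    | i'.+1 => fun b => \sum_b' lam b' b * f (bcell b')
    end b
  end.

Lemma rowsumE i (b : fbasis (F i.+1)) f :
  rowsum (bcell b) f = \sum_b' lam b' b * f (bcell b').
Proof. by []. Qed.

Lemma eq_rowsum l f f' :
    (forall l', tag l = (tag l').+1 -> (cdeg l' <= cdeg l)%MM -> f l' = f' l') ->
  rowsum l f = rowsum l f'.
Proof.
case: l => -[|i] b //= h; apply: eq_bigr => b' _.
have [->|/lam_le le] := eqVneq (lam b' b) 0; first by rewrite !mul0r.
by rewrite h.
Qed.

Lemma rowsum_eq0 l f :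
    (forall l', tag l = (tag l').+1 -> (cdeg l' <= cdeg l)%MM -> f l' = 0) ->
  rowsum l f = 0.
Proof.
move=> h; rewrite (eq_rowsum (f' := fun=> 0)) //.
by case: l {h} => -[|i] b //=; rewrite big1 // => b' _; rewrite mulr0.
Qed.

Lemma rowsum_sum (J : Type) (r : seq J) (P : pred J) l (f : J -> cell -> K) :
  rowsum l (fun l' => \sum_(y <- r | P y) f y l') = \sum_(y <- r | P y) rowsum l (f y).
Proof.
case: l => -[|i] b /=; first by rewrite big1.
by rewrite exchange_big; apply: eq_bigr => b' _; rewrite big_distrr.
Qed.

Lemma rowsumD l f f' : rowsum l (fun l' => f l' + f' l') = rowsum l f + rowsum l f'.
Proof.
case: l => -[|i] b /=; first by rewrite addr0.
by rewrite -big_split; apply: eq_bigr => b' _; rewrite mulrDr.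
Qed.

Lemma rowsumZ l a f : rowsum l (fun l' => a * f l') = a * rowsum l f.
Proof.
case: l => -[|i] b /=; first by rewrite mulr0.
by rewrite big_distrr; apply: eq_bigr => b' _; rewrite mulrCA.
Qed.

Lemma rowsum_comp l f : rowsum l (fun l' => rowsum l' f) = 0.
Proof.
case: l => -[|[|i]] b //=; first by rewrite big1 // => ? _; rewrite mulr0.
under eq_bigr do rewrite big_distrr.
rewrite exchange_big big1 //= => b'' _; under eq_bigr do rewrite mulrA [lam _ b * _]mulrC.
by rewrite -big_distrl /= lam_comp mul0r.
Qed.

Definition exch l t u : 'X_{1..m} := g (cdeg l) (U_(t) + u)%MM.

Definition rowT H l sigma u : K := rowsum l (fun l' => H l' sigma (g (cdeg l') u)).

Definition colT H l sigma u : K := \sum_(t in sigma) (-1) ^+ below sigma t *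
  (H l (sigma :\ t) (exch l t u) - H l (sigma :\ t) u).

(* The transpose of the total differential: the value of H, extended linearly to
   the span of the symbols, at the boundary of the symbol (l, sigma, u). Symbols
   with sigma not contained in set(u) stand for 0 exactly when H vanishes there. *)
Definition diffT H l sigma u : K :=
  rowT H l sigma u + (-1) ^+ tag l * colT H l sigma u.

Definition wf l u := bdeg u = cdeg l.

Lemma exch_isgen l t u : wf l u -> isgen (cdeg l) (U_(t) + u)%MM (exch l t u).
Proof. by move=> e; apply: gP; rewrite -e bdegD lem_addl. Qed.

Lemma exch_wf l t u : wf l u -> wf l (exch l t u).
Proof. by case/(exch_isgen t). Qed.

Lemma g_isgen l l' u : wf l u -> (cdeg l' <= cdeg l)%MM ->
  isgen (cdeg l') u (g (cdeg l') u).
Proof. by move=> e le; apply: gP; rewrite e. Qed.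

Lemma g_wf l l' u : wf l u -> (cdeg l' <= cdeg l)%MM -> wf l' (g (cdeg l') u).
Proof. by move=> e le; have [] := g_isgen e le. Qed.

(** Both sides are the canonical divisor of y_t u in the degree of [l']. This is what makes the maps
    phi commute with the column differentials. *)
Lemma g_exch l l' t u : wf l u -> (cdeg l' <= cdeg l)%MM ->
  g (cdeg l') (exch l t u) = exch l' t (g (cdeg l') u).
Proof.
move=> e le; apply: (isgen_uniq (bl := bl) (a := cdeg l') (v := (U_(t) + u)%MM)).
  apply: isgen_trans (exch_isgen t e) _; apply: g_isgen (exch_wf t e) le.
exact: isgen_mul (g_isgen e le) (exch_isgen t (g_wf e le)).
Qed.

Lemma exchC l s t u : wf l u -> exch l s (exch l t u) = exch l t (exch l s u).
Proof.
move=> e; apply: (isgen_uniq (bl := bl) (a := cdeg l) (v := (U_(s) + (U_(t) + u))%MM)).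
  exact: isgen_mul (exch_isgen t e) (exch_isgen s (exch_wf t e)).
rewrite addmA [(U_(s) + _)%MM]addmC -addmA.
exact: isgen_mul (exch_isgen s e) (exch_isgen t (exch_wf s e)).
Qed.

Lemma exch_id l t u : wf l u -> t \notin aset u -> exch l t u = u.
Proof.
move=> e tu; apply: isgen_uniq (exch_isgen t e) _.
by rewrite -e; apply: isgen_mulN => //; exact: isgen_id.
Qed.

Lemma aset_exch l t u : wf l u -> t \in aset u -> aset (exch l t u) \subset aset u.
Proof.
move=> e tu; have [le _ _] := exch_isgen t e.
apply/subsetP => s /(subsetP (aset_le bl le)); exact: aset_mul.
Qed.

Lemma eq_diffT H H' l sigma u : wf l u ->
    (forall l' sigma' u', wf l' u' -> (tag l' + #|sigma'|).+1 = (tag l + #|sigma|)%N ->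
      H l' sigma' u' = H' l' sigma' u') ->
  diffT H l sigma u = diffT H' l sigma u.
Proof.
move=> e h; congr (_ + _ * _).
  apply: eq_rowsum => l' tl le; apply: h; last by rewrite tl.
  exact: g_wf e le.
apply: eq_bigr => t ts; congr (_ * _).
by congr (_ - _); apply: h; rewrite ?(cardsD1 t sigma) ?ts ?addnS //; exact: exch_wf.
Qed.

Lemma diffT_sum (J : finType) (H : J -> cell -> {set 'I_m} -> 'X_{1..m} -> K)
    (a : J -> K) l sigma u :
  \sum_y diffT (H y) l sigma u * a y =
  diffT (fun l sigma u => \sum_y H y l sigma u * a y) l sigma u.
Proof.
rewrite /diffT; under eq_bigr do rewrite mulrDl; rewrite big_split /=; congr (_ + _).
  rewrite /rowT rowsum_sum; apply: eq_bigr => y _; rewrite mulrC -rowsumZ.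
  by congr rowsum; apply/funext => l'; rewrite mulrC.
under eq_bigr do rewrite -mulrA; rewrite -big_distrr /=; congr (_ * _).
rewrite /colT; under eq_bigr do rewrite big_distrl /=.
rewrite exchange_big /=; apply: eq_bigr => t _.
under eq_bigr do rewrite -mulrA mulrBl; rewrite -big_distrr /=; congr (_ * _).
by rewrite sumrB.
Qed.

Lemma rowT_rowT H l sigma u : wf l u -> rowT (rowT H) l sigma u = 0.
Proof.
move=> e; rewrite -[RHS](rowsum_comp l (fun l'' => H l'' sigma (g (cdeg l'') u))).
apply: eq_rowsum => l' _ le; apply: eq_rowsum => l'' _ le'.
congr H; apply: (isgen_uniq (bl := bl) (a := cdeg l'') (v := u)).
  apply: isgen_trans (g_isgen e le) _; exact: g_isgen (g_wf e le) le'.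
exact: g_isgen e (lepm_trans le' le).
Qed.

(** The inner differences combine to a second difference in s and t. It is symmetric because
    exchanges commute, so the alternating sum vanishes. *)
Lemma colT_colT H l sigma u : wf l u -> colT (colT H) l sigma u = 0.
Proof.
move=> e; rewrite /colT.
rewrite -[RHS](@alternating_sum0 K m sigma (fun t s =>
  let r := sigma :\ t :\ s in H l r (exch l s (exch l t u)) - H l r (exch l t u)
  - (H l r (exch l s u) - H l r u))); last first.
  move=> s t /=; have -> : sigma :\ s :\ t = sigma :\ t :\ s.
    by apply/setP => r; rewrite !inE andbCA.
  rewrite (exchC s t e); set x := H _ _ _; set y := H _ _ _; set z := H _ _ _.
  by rewrite !opprB !addrA addrAC [RHS]addrAC; congr (_ + _); exact: addrAC.
apply: eq_bigr => t _; congr (_ * _); rewrite -sumrB; apply: eq_bigr => s _.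
by rewrite -mulrBr.
Qed.

Lemma rowT_colT H l sigma u : wf l u -> rowT (colT H) l sigma u = colT (rowT H) l sigma u.
Proof.
move=> e; rewrite /colT /rowT.
under [RHS]eq_bigr => t _ do rewrite -[X in _ - X]mul1r -mulNr -rowsumZ -rowsumD -rowsumZ.
rewrite -rowsum_sum; apply: eq_rowsum => l' _ le.
by apply: eq_bigr => t _; rewrite (g_exch t e le) mulN1r.
Qed.

(** A row map lowers the index of the cell by one and so changes the sign (-1)^i; hence the two
    mixed terms cancel. *)
Lemma diffT_diffT H l sigma u : wf l u -> diffT (diffT H) l sigma u = 0.
Proof.
move=> e; rewrite /diffT {1}/rowT rowsumD.
rewrite [X in X + _ + _](rowT_rowT H sigma e) add0r.
have -> : rowsum l (fun l' => (-1) ^+ tag l' * colT H l' sigma (g (cdeg l') u)) =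
    - ((-1) ^+ tag l * rowT (colT H) l sigma u).
  rewrite -mulNr -rowsumZ; apply: eq_rowsum => l' -> _.
  by rewrite exprS mulN1r opprK.
have -> : colT (fun l sigma u => rowT H l sigma u + (-1) ^+ tag l * colT H l sigma u)
    l sigma u = colT (rowT H) l sigma u + (-1) ^+ tag l * colT (colT H) l sigma u.
  rewrite [in RHS]/colT big_distrr -big_split; apply: eq_bigr => t _ /=.
  by rewrite [X in _ = _ + X]mulrCA -mulrDr; congr (_ * _); rewrite mulrBr opprD addrACA.
by rewrite (colT_colT H sigma e) mulr0 addr0 (rowT_colT H sigma e) addNr.
Qed.

Definition vanish H := forall l sigma u, wf l u -> ~~ (sigma \subset aset u) ->
  H l sigma u = 0.

(** The convention f(sigma; u) = 0 is compatible with the differential: set(u) shrinks under row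
    maps and under exchanges with t in set(u), while for t outside set(u) the exchange fixes u and
    the two column terms cancel. *)
Lemma diffT_vanish H : vanish H -> vanish (diffT H).
Proof.
move=> h l sigma u e su; rewrite /diffT [rowT _ _ _ _]rowsum_eq0 ?add0r; last first.
  move=> l' _ le; apply: h; first exact: g_wf e le.
  have [gu _ _] := g_isgen e le; apply: contra su => /subset_trans; apply.
  exact: aset_le.
rewrite [colT _ _ _ _]big1 ?mulr0 // => t ts.
have [tu|/(exch_id e) ->] := boolP (t \in aset u); last by rewrite subrr mulr0.
have su' : ~~ (sigma :\ t \subset aset u).
  apply: contra su => /subsetP su; apply/subsetP => s ss.
  by have [->//|ne] := eqVneq s t; apply: su; rewrite !inE ne.
rewrite !h ?subrr ?mulr0 //; first exact: exch_wf.
by apply: contra su' => /subset_trans; apply; exact: aset_exch.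
Qed.

Definition delta q l sigma u : K := (q == (l, sigma, u))%:R.

Definition valid q := bdeg q.2 = cdeg q.1.1 /\ q.1.2 \subset aset q.2.

Lemma delta_vanish q : valid q -> vanish (delta q).
Proof.
move=> [_ vq] l sigma u e; rewrite /delta; case: eqP => // eq_q.
by move: vq; rewrite eq_q /= => ->.
Qed.

Definition pdeg q : 'X_{1..m} := [multinom ((i \in q.1.2) + q.2 i)%N | i < m].

Lemma pdeg_le l sigma sigma' u u' c : sigma' \subset sigma -> (u' <= u)%MM ->
  (pdeg (l, sigma, u) <= c)%MM -> (pdeg (l, sigma', u') <= c)%MM.
Proof.
move=> ss /mnm_lepP uu /mnm_lepP h; apply/mnm_lepP => i; apply: leq_trans (h i).
rewrite !mnmE /= leq_add //; case: (boolP (i \in sigma')) => // /(subsetP ss) ->.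
by [].
Qed.

(** The alternatives are the row, exchange and Koszul terms. The row case keeps the nonvanishing of
    the coefficient of [l'], since minimality depends on that entry of the matrix of F. *)
Lemma diffT_delta_neq0 q l sigma u : diffT (delta q) l sigma u != 0 ->
  [\/ exists l', [/\ rowsum l (fun l1 => (l' == l1)%:R) != 0, tag l = (tag l').+1,
        (cdeg l' <= cdeg l)%MM & q = (l', sigma, g (cdeg l') u)],
      exists2 t, t \in sigma & q = (l, sigma :\ t, exch l t u)
    | exists2 t, t \in sigma & q = (l, sigma :\ t, u)].
Proof.
move=> nz; apply: contrapT => hn; case/eqP: nz; rewrite /diffT.
rewrite [colT _ _ _ _]big1 ?mulr0 ?addr0 => [|t ts]; last first.
  rewrite /delta; case: eqP => [e|_]; first by case: hn; apply: Or32; exists t.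
  by case: eqP => [e|_]; [case: hn; apply: Or33; exists t|rewrite subrr mulr0].
apply: contrapT => /eqP r0; apply: hn; apply: Or31; apply: contrapT => hn.
case/eqP: (r0); apply: rowsum_eq0 => l' tl le; rewrite /delta.
case: eqP => // eq_q; case: hn; exists l'; split=> //.
apply: contra_neq r0 => r0; rewrite -[RHS]r0; apply: eq_rowsum => l1 _ _.
rewrite /delta eq_q; congr (_%:R); have [<-|ne] := eqVneq l' l1; first by rewrite eqxx.
by congr nat_of_bool; apply/negbTE/eqP => -[]/eqP; rewrite (negbTE ne).
Qed.

Lemma diffT_delta_pdeg q l sigma u : wf l u -> diffT (delta q) l sigma u != 0 ->
  (pdeg q <= pdeg (l, sigma, u))%MM.
Proof.
move=> e /diffT_delta_neq0[[l' [_ _ le ->]]|[t ts ->]|[t ts ->]].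
- have [gu _ _] := g_isgen e le.
  exact: (@pdeg_le l sigma sigma u _ _ (subxx _) gu (lepm_refl _)).
- have [/mnm_lepP gu _ _] := exch_isgen t e.
  apply/mnm_lepP => i; rewrite !mnmE /= !inE.
  have := gu i; rewrite mnmDE mnm1E.
  have [->|ne] := eqVneq i t; first by rewrite ts /=; lia.
  by rewrite /= add0n leq_add2l.
- exact: (@pdeg_le l sigma _ u _ _ (subsetDl _ _) (lepm_refl _) (lepm_refl _)).
Qed.

(* Chains of degree k are functions on the finite type X k, which enumerates
   the valid symbols of total degree k. *)
Variables (X : nat -> finType) (pt : forall k, X k -> point).

Definition tdeg q : nat := (tag q.1.1 + #|q.1.2|)%N.

Hypothesis pt_inj : forall k, injective (@pt k).
Hypothesis pt_valid : forall k (x : X k), valid (pt x).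
Hypothesis pt_tdeg : forall k (x : X k), tdeg (pt x) = k.
Hypothesis pt_surj : forall q, valid q -> exists x : X (tdeg q), pt x = q.

(** The coefficient of q' in the boundary of q, obtained by evaluating the transpose on the
    coordinate functional of q'. *)
Definition ent q q' : K := diffT (delta q') q.1.1 q.1.2 q.2.

Lemma pt_surj_k k q : valid q -> tdeg q = k -> exists x : X k, pt x = q.
Proof. by move=> vq <-; exact: pt_surj. Qed.

Lemma sum_delta k H l sigma u : vanish H -> wf l u -> (tag l + #|sigma|)%N = k ->
  \sum_(y : X k) delta (pt y) l sigma u * H (pt y).1.1 (pt y).1.2 (pt y).2 = H l sigma u.
Proof.
move=> h e dk; have [su|su] := boolP (sigma \subset aset u); last first.
  rewrite h // big1 // => y _; rewrite /delta; case: eqP => [ey|_]; last by rewrite mul0r.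
  by have [_] := pt_valid y; rewrite ey (negbTE su).
have [x ex] : exists x : X k, pt x = (l, sigma, u) by apply: pt_surj_k.
rewrite (bigD1 x) //= big1 => [|y ne]; first by rewrite /delta ex eqxx mul1r addr0.
rewrite /delta -ex; case: eqP => [/pt_inj e'|_]; last by rewrite mul0r.
by rewrite e' eqxx in ne.
Qed.

(** A functional that respects the convention is a combination of the coordinates of the enumerated
    symbols, so composing it with the matrix [ent] gives [diffT]. Identities for [diffT] thus become
    identities for boundaries. *)
Lemma sum_ent k H q : vanish H -> valid q -> tdeg q = k.+1 ->
  \sum_(y : X k) ent q (pt y) * H (pt y).1.1 (pt y).1.2 (pt y).2 =
  diffT H q.1.1 q.1.2 q.2.
Proof.
move=> h [wq _] dq; rewrite /ent diffT_sum; apply: eq_diffT => // l' sigma' u' e'.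
by rewrite -/(tdeg q) dq => -[dk]; exact: sum_delta.
Qed.

Definition bnd k (z : X k -> K) q : K := \sum_x z x * ent (pt x) q.

Lemma bnd_bnd k (z : X k.+1 -> K) q : valid q -> bnd (fun y : X k => bnd z (pt y)) q = 0.
Proof.
move=> vq; rewrite /bnd; under eq_bigr do rewrite big_distrl /=.
rewrite exchange_big big1 //= => x _; under eq_bigr do rewrite -mulrA.
rewrite -big_distrr /= [X in _ * X](@sum_ent k (diffT (delta q))) //.
- by rewrite diffT_diffT ?mulr0 //; have [] := pt_valid x.
- exact/diffT_vanish/delta_vanish.
Qed.

Lemma bndB k (z z' : X k -> K) q : bnd (fun x => z x - z' x) q = bnd z q - bnd z' q.
Proof. by rewrite /bnd -sumrB; apply: eq_bigr => x _; rewrite mulrBl. Qed.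

Lemma bndD k (z z' : X k -> K) q : bnd (fun x => z x + z' x) q = bnd z q + bnd z' q.
Proof. by rewrite /bnd -big_split; apply: eq_bigr => x _; rewrite mulrDl. Qed.

(** The chains of multidegree [c]: the coefficient at a symbol multiplies the monomial that raises
    its degree to [c]. *)
Definition psupp c k (z : X k -> K) := forall x, z x != 0 -> (pdeg (pt x) <= c)%MM.

Lemma psuppB c k (z z' : X k -> K) : psupp c z -> psupp c z' -> psupp c (fun x => z x - z' x).
Proof.
move=> h h' x; have [->|/h //] := eqVneq (z x) 0.
by rewrite sub0r oppr_eq0 => /h'.
Qed.

Lemma psuppD c k (z z' : X k -> K) : psupp c z -> psupp c z' -> psupp c (fun x => z x + z' x).
Proof. by move=> h h' x; have [->|/h //] := eqVneq (z x) 0; rewrite add0r => /h'. Qed.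

Lemma bnd_neq0 c k (z : X k -> K) q : psupp c z -> bnd z q != 0 -> (pdeg q <= c)%MM.
Proof.
move=> h nz; apply: contrapT => hn; case/eqP: nz; rewrite /bnd big1 // => x _.
have [->|/h le] := eqVneq (z x) 0; first by rewrite mul0r.
have [->|] := eqVneq (ent (pt x) q) 0; first by rewrite mulr0.
have [wx _] := pt_valid x; move/(diffT_delta_pdeg wx) => le'; case: hn.
by apply: lepm_trans le' _; move: le; case: (pt x) => -[].
Qed.

Definition coefp k (z : X k -> K) l sigma u : K := \sum_x z x * delta (pt x) l sigma u.

Lemma coefp_pt k (z : X k -> K) l sigma u x : pt x = (l, sigma, u) ->
  coefp z l sigma u = z x.
Proof.
move=> ex; rewrite /coefp (bigD1 x) //= big1 => [|y ne].
  by rewrite /delta ex eqxx mulr1 addr0.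
rewrite /delta -ex; case: eqP => [/pt_inj e'|_]; last by rewrite mulr0.
by rewrite e' eqxx in ne.
Qed.

Lemma coefp_neq0 k (z : X k -> K) l sigma u : coefp z l sigma u != 0 ->
  exists x : X k, pt x = (l, sigma, u) /\ z x != 0.
Proof.
move=> nz; apply: contrapT => h; case/eqP: (nz); rewrite /coefp big1 // => x _.
rewrite /delta; case: eqP => [ex|_]; last by rewrite mulr0.
by case: h; exists x; split=> //; rewrite -(coefp_pt z ex).
Qed.

(** * One multidegree: contraction onto the critical symbols *)

Section FixedDegree.
Variable c : 'X_{1..m}.

(** The weight of a divisor of [c] is at most that of [c], so on such [u] the rank orders the pairs
    (index in F, weight of u) lexicographically. *)
Definition rk l u : nat := (tag l * (mnmwgt c).+1 + mnmwgt u)%N.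

Lemma le_mnmwgt u v : (u <= v)%MM -> (mnmwgt u <= mnmwgt v)%N.
Proof. by move/submK <-; rewrite mnmwgtD leq_addl. Qed.

Lemma pdeg_mon l sigma u : (pdeg (l, sigma, u) <= c)%MM -> (u <= c)%MM.
Proof.
move=> /mnm_lepP h; apply/mnm_lepP => i; apply: leq_trans (h i).
by rewrite mnmE /= leq_addl.
Qed.

Lemma pdeg_lt l sigma u t : (pdeg (l, sigma, u) <= c)%MM -> t \in sigma -> (u t < c t)%N.
Proof. by move=> /mnm_lepP /(_ t); rewrite mnmE /= => + ts; rewrite ts. Qed.

(* The row maps and the exchanges u -> g_a(y_t u) lower the rank, so that only the
   Koszul terms f(sigma \ t; u) contribute at a symbol of maximal rank. *)
Lemma bnd_diag k (z : X k -> K) l sigma u : psupp c z -> ~~ crit bl c u ->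
    (forall x, z x != 0 -> ~~ crit bl c (pt x).2 -> (rk (pt x).1.1 (pt x).2 <= rk l u)%N) ->
  bnd z (l, sigma, u) = - (-1) ^+ tag l *
    \sum_(t | t \notin sigma) (-1) ^+ below sigma t * coefp z l (t |: sigma) u.
Proof.
move=> sz nc hrk.
transitivity (\sum_x z x * (- (-1) ^+ tag l * \sum_(t | t \notin sigma)
    (-1) ^+ below sigma t * delta (pt x) l (t |: sigma) u)); last first.
  under eq_bigr do rewrite mulrCA; rewrite -big_distrr; congr (_ * _).
  under eq_bigr do rewrite big_distrr /=; rewrite exchange_big /=.
  by apply: eq_bigr => t _; rewrite big_distrr; apply: eq_bigr => x _; rewrite mulrCA.
apply: eq_bigr => x _; have [->|zx] := eqVneq (z x) 0; first by rewrite !mul0r.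
congr (_ * _); move: (sz _ zx) (hrk _ zx) (pt_valid x); rewrite /ent.
case: (pt x) => -[l1 sigma1] u1 /= lec hx [/= wx sx].
rewrite /diffT [rowT _ _ _ _]rowsum_eq0 ?add0r; last first.
  move=> l' tl le; rewrite /delta; case: eqP => // -[e1 e2 e3].
  (* A row map takes critical monomials to critical ones, so the noncritical [u] can only come from
     a noncritical [u1], to which the rank bound applies. *)
  have [gu dg hg] := g_isgen wx le; have [/critP c1|/hx] := boolP (crit bl c u1).
    case/negP: nc; rewrite e3; apply/critP => t tu; rewrite hg // c1 //.
    exact: (subsetP (aset_le bl gu)).
  rewrite /rk tl e1 e3 mulSnr -addnA leq_add2l => /leq_trans/(_ (le_mnmwgt gu)).
  by rewrite addSn ltnNge leq_addl.
have hth t : t \in sigma1 -> delta (l, sigma, u) l1 (sigma1 :\ t) (exch l1 t u1) = 0.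
  move=> ts; rewrite /delta; case: eqP => // -[e1 e2 e3].
  have tu := subsetP sx _ ts.
  have := isgen_weight wx tu (exch_isgen t wx); rewrite -e3.
  (* The degree bound gives u1 an exponent below that of c at [t], which lies in set(u1). *)
  have nc1 : ~~ crit bl c u1.
    by apply/negP => /critP /(_ t tu) e'; have := pdeg_lt lec ts; rewrite e' ltnn.
  by have := hx nc1; rewrite /rk e1 leq_add2l leqNgt => /negP.
rewrite /colT /=; under eq_bigr => t ts do rewrite hth // sub0r mulrN.
rewrite sumrN mulrN -mulNr.
have [->|nl] := eqVneq l l1; last first.
  rewrite !big1 ?mulr0 // => t _; rewrite /delta.
    by case: eqP => [[e1 _ _]|_]; [rewrite e1 eqxx in nl|rewrite mulr0].
  by case: eqP => [[e1 _ _]|_]; [rewrite e1 eqxx in nl|rewrite mulr0].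
congr (_ * _); rewrite big_mkcond [RHS]big_mkcond /=; apply: eq_bigr => t _.
have [ts|ts] := boolP (t \in sigma1); have [ts'|ts'] := boolP (t \in sigma) => //=.
- rewrite /delta; case: eqP => [[e1]|]; last by rewrite mulr0.
  by rewrite e1 !inE eqxx in ts'.
- have [e|ne] := eqVneq sigma (sigma1 :\ t).
    rewrite e /delta setD1K //; have -> : below (sigma1 :\ t) t = below sigma1 t.
      by rewrite -belowU1 setD1K.
    by rewrite !xpair_eqE !eqxx /= eq_sym.
  rewrite /delta; case: eqP => [[e1]|_]; first by rewrite e1 eqxx in ne.
  case: eqP => [[e1]|_]; last by rewrite !mulr0.
  by rewrite e1 setU1K // eqxx in ne.
- rewrite /delta; case: eqP => [[e1]|]; last by rewrite mulr0.
  by rewrite e1 !inE eqxx in ts.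
Qed.

Definition free_idx u t : bool := (t \in aset u) && (u t < c t)%N.

Definition first_free u : option 'I_m :=
  [pick t | free_idx u t && [forall s, free_idx u s ==> (t <= s)%N]].

Lemma first_freeP u : (u <= c)%MM -> ~~ crit bl c u ->
  exists t, [/\ first_free u = Some t, t \in aset u, (u t < c t)%N
    & forall s, s \in aset u -> (u s < c s)%N -> (t <= s)%N].
Proof.
move=> /mnm_lepP le nc.
have [t0 ft0] : exists t, free_idx u t.
  move: nc; rewrite /crit negb_forall => /existsP[t]; rewrite negb_imply => /andP[tu ne].
  by exists t; rewrite /free_idx tu ltn_neqAle ne le.
rewrite /first_free; case: pickP => [t /andP[/andP[tu lt] /forallP h]|none].
  by exists t; split=> // s su ls; apply: (implyP (h s)); rewrite /free_idx su.
have [t ft mt] := @arg_minnP _ t0 (free_idx u) val ft0.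
have := none t; rewrite ft /=; case: forallP => // h _; case: h => s.
by apply/implyP => /mt.
Qed.

(* For fixed (l, u), the sets sigma with f(sigma; u) of degree at most c are the faces of
   the simplex on the free indices of u; homotopy is the cone from its first vertex. *)
Definition homotopy N k (z : X k -> K) (x : X k.+1) : K :=
  let: (l, sigma, u) := pt x in
  if [&& (u <= c)%MM, ~~ crit bl c u & rk l u == N] then
    if first_free u is Some t then
      if t \in sigma then - (-1) ^+ tag l * coefp z l (sigma :\ t) u else 0
    else 0
  else 0.

Lemma homotopy_neq0 N k (z : X k -> K) x : homotopy N z x != 0 ->
  [/\ ((pt x).2 <= c)%MM, ~~ crit bl c (pt x).2 & rk (pt x).1.1 (pt x).2 = N].
Proof.
rewrite /homotopy; case: (pt x) => -[l sigma] u /=.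
by case: ifP => [/and3P[? ? /eqP]|_]; rewrite ?eqxx.
Qed.

Lemma homotopy_psupp N k (z : X k -> K) : psupp c z -> psupp c (homotopy N z).
Proof.
move=> sz x; rewrite /homotopy; case: (pt x) => -[l sigma] u /=.
case: ifP => [/and3P[uc nc _]|]; last by rewrite eqxx.
have [t [-> tu lt _]] := first_freeP uc nc.
case: ifP => [ts|]; last by rewrite eqxx.
rewrite mulf_eq0 negb_or => /andP[_ /coefp_neq0[y [ey /sz]]]; rewrite ey => /mnm_lepP le.
apply/mnm_lepP => i; have := le i; rewrite !mnmE /= !inE.
by have [->|] := eqVneq i t; rewrite ?ts.
Qed.

Lemma homotopy_coefp N k (z : X k -> K) l sigma u t : wf l u -> (u <= c)%MM ->
    ~~ crit bl c u -> rk l u = N -> first_free u = Some t ->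
    (tag l + #|sigma|)%N = k.+1 ->
  coefp (homotopy N z) l sigma u =
  if t \in sigma then - (-1) ^+ tag l * coefp z l (sigma :\ t) u else 0.
Proof.
move=> e uc nc rN ft dk; have [su|su] := boolP (sigma \subset aset u).
  have [x ex] : exists x : X k.+1, pt x = (l, sigma, u) by apply: pt_surj_k.
  by rewrite (coefp_pt _ ex) /homotopy ex uc nc rN eqxx ft.
have -> : coefp (homotopy N z) l sigma u = 0.
  apply/eqP; apply: contraNT su => /coefp_neq0[x [ex _]].
  by have [_] := pt_valid x; rewrite ex.
case: ifP => // ts; have [->|] := eqVneq (coefp z l (sigma :\ t) u) 0; first by rewrite mulr0.
move/coefp_neq0 => [x [ex _]]; have [_] := pt_valid x; rewrite ex /= => su'.
have [t' [ft' tu _ _]] := first_freeP uc nc.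
move: ft'; rewrite ft => -[et]; rewrite -et in tu.
by case/negP: su; rewrite -(setD1K ts) subUset sub1set tu.
Qed.

(** For k = 0 the condition is empty, so chains of degree 0 are reduced by the same argument. *)
Definition cycle k (z : X k -> K) := forall q, valid q -> (tdeg q).+1 = k -> bnd z q = 0.

(** Above rank N both sides vanish. At rank N let tau be the first free index. If tau is not in
    sigma, only the term adding tau contributes, and it returns the coefficient. If tau is in sigma,
    the cycle condition at sigma without tau expresses the coefficient through the remaining
    terms. *)
Lemma homotopy_bnd N k (z : X k -> K) y : psupp c z -> cycle z ->
    (forall x, ~~ crit bl c (pt x).2 -> (N < rk (pt x).1.1 (pt x).2)%N -> z x = 0) ->
    ~~ crit bl c (pt y).2 -> (N <= rk (pt y).1.1 (pt y).2)%N ->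
  bnd (homotopy N z) (pt y) = z y.
Proof.
move=> sz cz hz; have [wy sy] := pt_valid y; have dy := pt_tdeg y.
case ey: (pt y) wy sy dy => [[l sigma] u] /= wy sy; rewrite /tdeg /= => dy nc.
have [le|nle] := boolP (pdeg (l, sigma, u) <= c)%MM; last first.
  have [->|/sz] := eqVneq (z y) 0; last by rewrite ey (negbTE nle).
  by move=> _; apply/eqP; apply: contraNT nle => /(bnd_neq0 (homotopy_psupp (N := N) sz)).
have uc := pdeg_mon le.
rewrite leq_eqVlt => /orP[/eqP rN|rN]; last first.
  rewrite hz ?ey // (bnd_diag _ (homotopy_psupp (N := N) sz) nc) => [|x /homotopy_neq0[_ _ ->] _].
    rewrite big1 ?mulr0 // => t _.
    have [->|/coefp_neq0[x [ex /homotopy_neq0[_ _]]]] :=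
      eqVneq (coefp (homotopy N z) l (t |: sigma) u) 0; first by rewrite mulr0.
    by rewrite ex /= => e; rewrite e ltnn in rN.
  exact: ltnW.
rewrite (bnd_diag _ (homotopy_psupp (N := N) sz) nc) => [|x /homotopy_neq0[_ _ ->] _]; last by rewrite -rN.
have [tau [ft tauu lt mint]] := first_freeP uc nc.
have zs s sigma' : coefp z l sigma' u != 0 -> s \in sigma' -> (tau <= s)%N.
  move=> /coefp_neq0[x [ex /sz]]; rewrite ex => lex ss.
  apply: mint; last exact: pdeg_lt lex ss.
  by have [_ /subsetP] := pt_valid x; rewrite ex; apply.
transitivity (\sum_(t < m | t \notin sigma) (-1) ^+ below sigma t *
    (if tau \in t |: sigma then coefp z l ((t |: sigma) :\ tau) u else 0)).
  rewrite big_distrr; apply: eq_bigr => t ts /=.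
  rewrite (homotopy_coefp z wy uc nc (esym rN) ft); last first.
    by rewrite cardsU1 ts addnS dy.
  case: ifP => _; last by rewrite !mulr0.
  (* The sign built into [homotopy] is the inverse of the one in [bnd_diag]. *)
  by rewrite mulrCA; congr (_ * _); rewrite mulrA mulrNN -expr2 sqrr_sign mul1r.
rewrite -(coefp_pt z ey).
have [tsig|tsig] := boolP (tau \in sigma); last first.
  rewrite (bigD1 tau) //= big1 ?addr0 => [|t /andP[ts ne]]; last first.
    by rewrite !inE (negbTE tsig) eq_sym (negbTE ne) mulr0.
  rewrite !inE eqxx setU1K // below_min ?mul1r // => s ss.
  by apply: mint; [exact: (subsetP sy)|exact: pdeg_lt le ss].
have vq : valid (l, sigma :\ tau, u).
  by split=> //=; exact: subset_trans (subsetDl _ _) sy.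
have dq : (tdeg (l, sigma :\ tau, u)).+1 = k.
  by rewrite -dy /tdeg /= [in RHS](cardsD1 tau) tsig add1n addnS.
(* The cycle equation at the face opposite to tau; adding tau back gives the coefficient of [y]. *)
have := cz _ vq dq; rewrite (bnd_diag _ sz nc) => [|x zx ncx]; last first.
  by rewrite leqNgt; apply/negP => lx; rewrite hz ?eqxx // rN in zx.
move/eqP; rewrite mulf_eq0 oppr_eq0 signr_eq0 /= (bigD1 tau) ?inE ?eqxx //= setD1K //.
rewrite below_min ?mul1r => [|s]; last first.
  rewrite !inE => /andP[_ ss].
  by apply: mint; [exact: (subsetP sy)|exact: pdeg_lt le ss].
rewrite addr_eq0 => /eqP ->; rewrite -sumrN.
apply: eq_big => [t|t ts]; first by rewrite !inE; have [->|_] := eqVneq t tau; rewrite ?tsig ?andbT.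
have tt : (tau == t) = false by apply: contraNF ts => /eqP <-.
rewrite !inE tsig orbT.
have -> : (t |: sigma) :\ tau = t |: (sigma :\ tau).
  by apply/setP => s; rewrite !inE; case: (eqVneq s t) => [->|//]; rewrite eq_sym tt.
have [->|nz] := eqVneq (coefp z l (t |: sigma :\ tau) u) 0; first by rewrite !mulr0 oppr0.
(* Because tau precedes t, removing tau from sigma flips the sign of the term. *)
have lett : (tau < t)%N.
  rewrite ltn_neqAle (zs t _ nz) ?inE ?eqxx // andbT.
  by apply: contraFneq tt => /ord_inj ->.
by rewrite (belowD1 tsig) ?tt // lett addn1 exprS mulN1r mulNr.
Qed.

Lemma bnd_supp_cycle k (z : X k.+1 -> K) : cycle (fun y : X k => bnd z (pt y)).
Proof. by move=> q vq _; exact: bnd_bnd. Qed.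

(** Descending through the ranks: subtracting the boundary of [homotopy N z] clears the noncritical
    part at the top rank N, creates nothing above it, and leaves a cycle of the same multidegree. *)
Lemma reduce k (z : X k -> K) : psupp c z -> cycle z ->
  exists2 z' : X k.+1 -> K, psupp c z' &
    forall y, ~~ crit bl c (pt y).2 -> z y = bnd z' (pt y).
Proof.
pose r x := rk (pt x).1.1 (@pt k x).2.
have [N hN] : exists N, forall x, (r x < N)%N.
  exists (\max_x r x).+1 => x; rewrite ltnS; exact: (leq_bigmax x).
have : forall x, ~~ crit bl c (pt x).2 -> (N <= r x)%N -> z x = 0.
  by move=> x _; rewrite leqNgt hN.
elim: N z {hN} => [|N IHN] z hz sz cz.
  exists (fun=> 0) => [x|y ny]; first by rewrite eqxx.
  by rewrite hz // /bnd big1 // => x _; rewrite mul0r.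
pose h := homotopy N z.
have sb : psupp c (fun y : X k => bnd h (pt y)).
  by move=> y /(bnd_neq0 (homotopy_psupp (N := N) sz)).
have [||| z' sz' hz'] := IHN (fun y => z y - bnd h (pt y)).
- by move=> x nx lx; rewrite /h homotopy_bnd ?subrr.
- exact: psuppB.
- by move=> q vq dq; rewrite bndB cz // bnd_supp_cycle // subr0.
exists (fun x => h x + z' x); first exact/psuppD/sz'/homotopy_psupp.
by move=> y ny; rewrite bndD -hz' // addrC subrK.
Qed.

Definition fsupp k (h : fbasis (F k) -> K) := forall b, h b != 0 -> (fdeg b <= bdeg c)%MM.

(** The embedding of F in degree [bdeg c] into the chains of multidegree [c]; each generator goes to
    its critical symbol. *)
Definition crit_lift k (h : fbasis (F k) -> K) (y : X k) : K :=
  \sum_b h b * delta (pt y) (bcell b) set0 (g (fdeg b) c).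

Lemma bcell_inj i : injective (@bcell i).
Proof. by move=> b b' /eqP; rewrite /bcell eq_Tagged => /eqP. Qed.

Lemma bcell_ex l i : tag l = i -> exists b : fbasis (F i), l = bcell b.
Proof. by case: l => i' b /= <-; exists b. Qed.

Lemma g_valid i (b : fbasis (F i)) : (fdeg b <= bdeg c)%MM ->
  valid (bcell b, set0, g (fdeg b) c).
Proof. by move=> /gP[_ d _]; split; rewrite //= sub0set. Qed.

Lemma g_ex i (b : fbasis (F i)) : (fdeg b <= bdeg c)%MM ->
  exists x : X i, pt x = (bcell b, set0, g (fdeg b) c).
Proof. by move=> le; apply: pt_surj_k (g_valid le) _; rewrite /tdeg cards0 addn0. Qed.

Lemma crit_liftE k (h : fbasis (F k) -> K) y b :
  pt y = (bcell b, set0, g (fdeg b) c) -> crit_lift h y = h b.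
Proof.
move=> ey; rewrite /crit_lift (bigD1 b) //= big1 => [|b' ne].
  by rewrite /delta ey eqxx mulr1 addr0.
rewrite /delta ey; case: eqP => [[/bcell_inj e _]|_]; last by rewrite mulr0.
by rewrite e eqxx in ne.
Qed.

Lemma crit_lift_psupp k (h : fbasis (F k) -> K) : fsupp h -> psupp c (crit_lift h).
Proof.
move=> sh y nz.
have [b hb ey] : exists2 b, h b != 0 & pt y = (bcell b, set0, g (fdeg b) c).
  apply: contrapT => hn; case/eqP: nz; rewrite /crit_lift big1 // => b _.
  have [->|hb] := eqVneq (h b) 0; first by rewrite mul0r.
  rewrite /delta; case: eqP => [ey|_]; last by rewrite mulr0.
  by case: hn; exists b.
rewrite ey; have [/mnm_lepP le _ _] := gP (sh _ hb).
by apply/mnm_lepP => i; rewrite mnmE /= inE add0n.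
Qed.

(** For critical u, an index t of sigma would lie in set(u), where u_t = c_t, against the degree
    bound. So sigma is empty, and u is g_a(c) by uniqueness. *)
Lemma crit_lift_ex k (z : X k -> K) : psupp c z ->
    (forall y, ~~ crit bl c (pt y).2 -> z y = 0) ->
  exists2 h : fbasis (F k) -> K, fsupp h & forall y, z y = crit_lift h y.
Proof.
move=> sz cz.
exists (fun b => if (fdeg b <= bdeg c)%MM then coefp z (bcell b) set0 (g (fdeg b) c) else 0).
  by move=> b; case: ifP => //; rewrite eqxx.
move=> y; have [zy|nz] := eqVneq (z y) 0.
  rewrite /crit_lift big1 // => b _; rewrite /delta; case: eqP => [ey|_]; last by rewrite mulr0.
  by rewrite (coefp_pt _ ey) zy if_same mul0r.
have [wy sy] := pt_valid y; have cy : crit bl c (pt y).2.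
  by apply: contraNT nz => /cz ->.
have := sz _ nz; have := pt_tdeg y.
case ey: (pt y) wy sy cy => [[l sigma] u] /= wy sy cy; rewrite /tdeg /= => dy le.
have s0 : sigma = set0.
  apply/eqP; rewrite -subset0; apply/subsetP => t ts.
  by have := pdeg_lt le ts; rewrite (critP _ _ _ cy _ (subsetP sy _ ts)) ltnn.
have [b lb] : exists b : fbasis (F k), l = bcell b.
  by apply: bcell_ex; rewrite -dy s0 cards0 addn0.
have uc := pdeg_mon le; have leb : (fdeg b <= bdeg c)%MM.
  by have := bdeg_le bl uc; rewrite wy lb.
have ug : u = g (fdeg b) c.
  by apply: isgen_uniq (crit_isgen uc cy) _; rewrite wy lb; exact: gP.
rewrite lb s0 ug in ey; by rewrite (crit_liftE _ ey) leb (coefp_pt _ ey).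
Qed.

Lemma ent_set0 i (b : fbasis (F i)) u q : ent (bcell b, set0, u) q =
  rowsum (bcell b) (fun l' => delta q l' set0 (g (cdeg l') u)).
Proof. by rewrite /ent /diffT /colT big_set0 mulr0 addr0. Qed.

(** With sigma empty only row terms remain, and g_b(g_a(c)) = g_b(c) sends critical symbols to
    critical symbols. *)
Lemma bnd_lift k (h : fbasis (F k.+1) -> K) (y : X k) : fsupp h ->
  bnd (crit_lift h) (pt y) = crit_lift (fun b' => \sum_b lam b' b * h b) y.
Proof.
move=> sh; rewrite /bnd /crit_lift.
transitivity (\sum_b h b * ent (bcell b, set0, g (fdeg b) c) (pt y)).
  under eq_bigr do rewrite big_distrl /=; rewrite exchange_big; apply: eq_bigr => b _ /=.
  have [->|hb] := eqVneq (h b) 0; first by rewrite mul0r big1 // => x _; rewrite !mul0r.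
  have [x ex] := g_ex (sh _ hb).
  rewrite (bigD1 x) //= big1 => [|x' ne]; first by rewrite /delta ex eqxx mulr1 addr0.
  rewrite /delta -ex; case: eqP => [/pt_inj e|_]; last by rewrite mulr0 mul0r.
  by rewrite e eqxx in ne.
under [RHS]eq_bigr do rewrite big_distrl /=; rewrite [RHS]exchange_big.
apply: eq_bigr => b _; rewrite ent_set0 rowsumE big_distrr /=; apply: eq_bigr => b' _.
have [->|hb] := eqVneq (h b) 0; first by rewrite mulr0 !mul0r.
have [->|/lam_le le] := eqVneq (lam b' b) 0; first by rewrite !mul0r mulr0.
rewrite mulrCA mulrA; congr (_ * delta _ _ _ _).
apply: isgen_uniq (gP (lepm_trans le (sh _ hb))).
by apply: isgen_trans (gP (sh _ hb)) (gP _); have [_ -> _] := gP (sh _ hb).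
Qed.

Lemma lam_fsupp k (h : fbasis (F k.+1) -> K) : fsupp h ->
  fsupp (fun b' => \sum_b lam b' b * h b).
Proof.
move=> sh b' nz; apply: contrapT => hn; case/eqP: nz; rewrite big1 // => b _.
have [->|/sh leb] := eqVneq (h b) 0; first by rewrite mulr0.
have [->|/lam_le le] := eqVneq (lam b' b) 0; first by rewrite mul0r.
by case: hn; exact: lepm_trans leb.
Qed.

Lemma crit_lift0 k (h : fbasis (F k) -> K) : fsupp h ->
  (forall y, crit_lift h y = 0) -> forall b, h b = 0.
Proof.
move=> sh h0 b; have [//|/sh/g_ex[y ey]] := eqVneq (h b) 0.
by rewrite -(crit_liftE _ ey).
Qed.

Lemma reduce_lift k (z : X k -> K) : psupp c z -> cycle z ->
  exists z1 : X k.+1 -> K, exists f : fbasis (F k) -> K,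
    [/\ psupp c z1, fsupp f & forall y, z y = bnd z1 (pt y) + crit_lift f y].
Proof.
move=> sz cz; have [z1 sz1 hz1] := reduce sz cz.
have sb : psupp c (fun y : X k => bnd z1 (pt y)) by move=> y; exact: bnd_neq0.
have [|f sf hf] := crit_lift_ex (psuppB sz sb).
  by move=> y ny; rewrite hz1 ?subrr.
by exists z1, f; split=> // y; rewrite -hf addrC subrK.
Qed.

(** Up to a boundary, z is the lift of some f. Then f is a cycle of F in degree [bdeg c], and the
    assumed exactness there bounds it. *)
Lemma symbol_exact k (z : X k.+1 -> K) :
    (forall f : fbasis (F k.+1) -> K, fsupp f -> (forall b', \sum_b lam b' b * f b = 0) ->
      exists2 h : fbasis (F k.+2) -> K, fsupp h & forall b, f b = \sum_b2 lam b b2 * h b2) ->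
    psupp c z -> (forall y : X k, bnd z (pt y) = 0) ->
  exists2 z' : X k.+2 -> K, psupp c z' & forall y, z y = bnd z' (pt y).
Proof.
move=> Fex sz bz.
have cz : cycle z by move=> q vq [dq]; have [y <-] := pt_surj_k vq dq.
have [z1 [f [sz1 sf hf]]] := reduce_lift sz cz.
have [|h sh hh] := Fex f sf.
  apply: crit_lift0 => [|y]; first exact: lam_fsupp.
  rewrite -bnd_lift //; have := bz y.
  have -> : z = (fun y => bnd z1 (pt y) + crit_lift f y) by apply/funext.
  by rewrite bndD bnd_bnd ?add0r.
exists (fun x => z1 x + crit_lift h x); first exact/psuppD/crit_lift_psupp.
move=> y; rewrite bndD bnd_lift // hf; congr (_ + _).
by apply: eq_bigr => b _; rewrite hh.
Qed.

(** A symbol of total degree k over F_k has empty sigma, so this is the augmentation f(0; u) -> u in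
    a fixed multidegree, where every u contributes the same monomial. *)
Definition coaug k (z : X k -> K) (b : fbasis (F k)) : K :=
  \sum_x z x * ((pt x).1.1 == bcell b)%:R.

Lemma coaug_fsupp k (z : X k -> K) : psupp c z -> fsupp (coaug z).
Proof.
move=> sz b nz; apply: contrapT => hn; case/eqP: nz; rewrite /coaug big1 // => x _.
have [->|/sz] := eqVneq (z x) 0; first by rewrite mul0r.
case: eqP => [ex|_]; last by rewrite mulr0.
have [+ _] := pt_valid x; move: ex; case: (pt x) => -[l sigma] u /= -> e /pdeg_mon le.
by case: hn; rewrite -[fdeg b]e bdeg_le.
Qed.

Lemma coaugD k (z z' : X k -> K) b : coaug (fun x => z x + z' x) b = coaug z b + coaug z' b.
Proof. by rewrite /coaug -big_split; apply: eq_bigr => x _; rewrite mulrDl. Qed.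

Lemma coaug_lift k (h : fbasis (F k) -> K) b : fsupp h -> coaug (crit_lift h : X k -> K) b = h b.
Proof.
move=> sh; rewrite /coaug; under eq_bigr do rewrite big_distrl /=.
rewrite exchange_big (bigD1 b) //= [X in _ + X]big1 => [|b' ne]; last first.
  rewrite big1 // => x _; rewrite /delta; case: eqP => [->|_] /=; last by rewrite mulr0 mul0r.
  by case: eqP => [/bcell_inj e|_]; [rewrite e eqxx in ne|rewrite mulr0].
have [->|hb] := eqVneq (h b) 0; first by rewrite addr0 big1 // => x _; rewrite !mul0r.
have [x ex] := g_ex (sh _ hb).
rewrite addr0 (bigD1 x) //= [X in _ + X]big1 => [|x' ne].
  by rewrite /delta ex eqxx /= eqxx !mulr1 addr0.
rewrite /delta -ex; case: eqP => [/pt_inj e|_]; last by rewrite mulr0 mul0r.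
by rewrite e eqxx in ne.
Qed.

(** The augmentation is the functional [H], which does not depend on u; its two column terms cancel,
    and only the row map of F remains. *)
Lemma coaug_bnd (z : X 1 -> K) (b : fbasis (F 0%N)) :
  coaug (fun y : X 0 => bnd z (pt y)) b = \sum_b1 lam b b1 * coaug z b1.
Proof.
pose H l (sigma : {set 'I_m}) (u : 'X_{1..m}) : K := (l == bcell b)%:R * (sigma == set0)%:R.
have vH : vanish H.
  move=> l sigma u _; rewrite /H; case: (eqVneq sigma set0) => [->|_ _]; last exact: mulr0.
  by rewrite sub0set.
transitivity (\sum_x z x * diffT H (pt x).1.1 (pt x).1.2 (pt x).2).
  rewrite /coaug /bnd; under eq_bigr do rewrite big_distrl /=.
  rewrite exchange_big; apply: eq_bigr => x _ /=.
  rewrite -(@sum_ent 0) //= big_distrr; apply: eq_bigr => y _ /=.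
  rewrite -mulrA; congr (_ * (_ * _)); rewrite /H.
  have /eqP := pt_tdeg y; rewrite addn_eq0 cards_eq0 => /andP[_ ->].
  by rewrite mulr1.
under [RHS]eq_bigr do rewrite big_distrr /=.
rewrite exchange_big; apply: eq_bigr => x _ /=.
under eq_bigr do rewrite mulrCA; rewrite -big_distrr; congr (_ * _).
have := pt_tdeg x; case: (pt x) => -[[i b0] sigma] u; rewrite /tdeg /=.
have Hcol : colT H (existT _ i b0) sigma u = 0.
  by rewrite /colT big1 // => t _; rewrite subrr mulr0.
rewrite /diffT Hcol mulr0 addr0; case: i b0 {Hcol} => [|[|i]] b0 /= di.
- by rewrite /rowT /= big1 // => b1 _; rewrite mulr0.
- have s0 : sigma = set0.
    by apply/eqP; rewrite -cards_eq0; move: di; rewrite add1n => -[->].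
  rewrite /rowT /= (bigD1 b) //= big1 => [|b' ne]; last first.
    by rewrite /H; case: eqP => [/bcell_inj e|_]; [rewrite e eqxx in ne|rewrite mul0r mulr0].
  rewrite /H s0 !eqxx !mulr1 addr0 (bigD1 b0) //= big1 => [|b' ne].
    by rewrite eqxx mulr1 addr0.
  by case: eqP => [/bcell_inj e|_]; [rewrite e eqxx in ne|rewrite mulr0].
- by move: di; rewrite addSn.
Qed.

(** Write z as the boundary of z1 plus the lift of f. Applying the augmentation shows that f is the
    image of h minus the augmentation of z1, so the lift of f is a boundary too. *)
Lemma symbol_exact0 (z : X 0 -> K) (h : fbasis (F 1) -> K) : psupp c z -> fsupp h ->
    (forall b, coaug z b = \sum_b1 lam b b1 * h b1) ->
  exists2 z' : X 1 -> K, psupp c z' & forall y, z y = bnd z' (pt y).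
Proof.
move=> sz sh hz; have cz : cycle z by [].
have [z1 [f [sz1 sf hf]]] := reduce_lift sz cz.
pose h' b1 := h b1 - coaug z1 b1.
have sh' : fsupp h'.
  move=> b; rewrite /h'; have [->|/sh //] := eqVneq (h b) 0.
  by rewrite sub0r oppr_eq0; exact: coaug_fsupp.
have ef b : f b = \sum_b1 lam b b1 * h' b1.
  under eq_bigr do rewrite mulrBr; rewrite sumrB -hz -coaug_bnd -(coaug_lift b sf).
  have -> : z = (fun y => bnd z1 (pt y) + crit_lift f y) by apply/funext.
  by rewrite coaugD addrAC subrr add0r.
exists (fun x => z1 x + crit_lift h' x); first exact/psuppD/crit_lift_psupp.
move=> y; rewrite bndD bnd_lift // hf; congr (_ + _).
by apply: eq_bigr => b _; rewrite ef.
Qed.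

End FixedDegree.
End SymbolComplex.

(** * Homogeneous elements *)

Section HomogeneousVectors.
Variables (K : fieldType) (n : nat).
Local Notation S := {mpoly K[n]}.
Implicit Types (E F G : mgfree K n) (c d : 'X_{1..n}).

Definition hsupp F c (z : fbasis F -> K) := forall b, z b != 0 -> (fdeg b <= c)%MM.

(** Subtraction of exponents is truncated, hence the zero branch for generators whose degree does
    not divide [c]. *)
Definition hvec F c (z : fbasis F -> K) : F :=
  ([ffun b => if (fdeg b <= c)%MM then z b *: 'X_[c - fdeg b] else 0 : S]
    : {ffun fbasis F -> S^o}).

Lemma hvecE F c (z : fbasis F -> K) b : hsupp c z ->
  mgcoord (hvec c z) b = z b *: 'X_[c - fdeg b].
Proof.
move=> sz; rewrite /mgcoord ffunE; case: ifPn => // nle.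
by have [->|/sz] := eqVneq (z b) 0; [rewrite scale0r|rewrite (negbTE nle)].
Qed.

Lemma mgcoord_inj F (v w : F) : (forall b, mgcoord v b = mgcoord w b) -> v = w.
Proof. by move=> h; apply/ffunP. Qed.

Lemma mgcoordD F (v w : F) b : mgcoord (v + w) b = mgcoord v b + mgcoord w b.
Proof. by rewrite /mgcoord ffunE. Qed.

Lemma mgcoordZ F (p : S) (v : F) b : mgcoord (p *: v) b = p * mgcoord v b.
Proof. by rewrite /mgcoord ffunE. Qed.

Lemma mgcoord0 F b : mgcoord (0 : F) b = 0.
Proof. by rewrite /mgcoord ffunE. Qed.

Lemma mgcoord_sum F (I : Type) (r : seq I) (P : pred I) (f : I -> F) b :
  mgcoord (\sum_(i <- r | P i) f i) b = \sum_(i <- r | P i) mgcoord (f i) b.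
Proof.
apply: (big_morph (fun v : F => mgcoord v b)); last exact: mgcoord0.
by move=> v w; exact: mgcoordD.
Qed.

Lemma mgcoord_bvec F (b b' : fbasis F) : mgcoord (bvec b) b' = (b' == b)%:R.
Proof. by rewrite /mgcoord ffunE. Qed.

Lemma mgvec_sum F (v : F) : v = \sum_b mgcoord v b *: bvec b.
Proof.
apply: mgcoord_inj => b; rewrite mgcoord_sum (bigD1 b) //= big1 => [|b' ne].
  by rewrite mgcoordZ mgcoord_bvec eqxx mulr1 addr0.
by rewrite mgcoordZ mgcoord_bvec eq_sym (negbTE ne) mulr0.
Qed.

Lemma eq_hvec F c (z z' : fbasis F -> K) : z =1 z' -> hvec c z = hvec c z'.
Proof. by move=> /funext ->. Qed.

Lemma hvec_comp F c (z : fbasis F -> K) : mg_comp c (hvec c z).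
Proof.
move=> b m; rewrite /hvec ffunE; case: ifP => [le|_]; last by rewrite msupp0.
by move=> /msuppZ_le; rewrite msuppX inE => /eqP ->; rewrite submK.
Qed.

Lemma hvec_ex F c (v : F) : mg_comp c v ->
  exists2 z : fbasis F -> K, hsupp c z & v = hvec c z.
Proof.
move=> /ffun_compP h.
exists (fun b => if (fdeg b <= c)%MM then (mgcoord v b)@_(c - fdeg b) else 0).
  by move=> b; case: ifP => //; rewrite eqxx.
apply: mgcoord_inj => b; rewrite /hvec {2}/mgcoord ffunE /=.
apply/mpolyP => m; case: ifP => le; last first.
  rewrite mcoeff0; apply: h => e; move: le; rewrite -e lem_addl //.
rewrite mcoeffZ mcoeffX; case: (eqVneq (c - fdeg b)%MM m) => [->|ne].
  by rewrite le mulr1.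
by rewrite mulr0; apply: h => e; case/eqP: ne; rewrite -e addmK.
Qed.

Lemma hvec_inj F c (z z' : fbasis F -> K) : hsupp c z -> hsupp c z' ->
  hvec c z = hvec c z' -> z =1 z'.
Proof.
move=> sz sz' e b; have := congr1 (fun v => (mgcoord v b)@_(c - fdeg b)) e.
by rewrite !hvecE // !mcoeffZ mcoeffX eqxx !mulr1.
Qed.

Lemma hvec0 F c : hvec c (fun=> 0) = 0 :> F.
Proof.
apply: mgcoord_inj => b; rewrite hvecE => [|b']; last by rewrite eqxx.
by rewrite scale0r mgcoord0.
Qed.

Lemma hvecZ F c d (z : fbasis F -> K) : hsupp d z -> (d <= c)%MM ->
  'X_[c - d] *: hvec d z = hvec c z :> F.
Proof.
move=> sz le; have sz' : hsupp c z by move=> b /sz/lepm_trans; apply.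
apply: mgcoord_inj => b; rewrite mgcoordZ !hvecE //.
have [->|/sz leb] := eqVneq (z b) 0; first by rewrite !scale0r mulr0.
by rewrite -scalerAr -mpolyXD addmBA // submK.
Qed.

Lemma hvec_bvec F c (z : fbasis F -> K) : hsupp c z ->
  hvec c z = \sum_b (z b *: 'X_[c - fdeg b]) *: bvec b.
Proof. by move=> sz; rewrite [LHS]mgvec_sum; apply: eq_bigr => b _; rewrite hvecE. Qed.

Lemma hvec_sum F c (I : finType) (a : I -> K) (z : I -> fbasis F -> K) :
  (forall i, a i != 0 -> hsupp c (z i)) ->
  \sum_i (a i)%:MP *: hvec c (z i) = hvec c (fun b => \sum_i a i * z i b) :> F.
Proof.
move=> sz; have sz' : hsupp c (fun b => \sum_i a i * z i b).
  move=> b nz; apply: contrapT => hn; case/eqP: nz; rewrite big1 // => i _.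
  have [->|ai] := eqVneq (a i) 0; first by rewrite mul0r.
  by have [->|/(sz i ai)] := eqVneq (z i b) 0; first by rewrite mulr0.
apply: mgcoord_inj => b; rewrite mgcoord_sum hvecE // scaler_suml; apply: eq_bigr => i _.
rewrite mgcoordZ mul_mpolyC; have [->|ai] := eqVneq (a i) 0; first by rewrite mul0r !scale0r.
by rewrite hvecE ?scalerA //; exact: sz.
Qed.

Lemma linear_hvec E F (f : {linear E -> F}) (L : fbasis E -> fbasis F -> K) c
    (z : fbasis E -> K) :
    (forall b, hsupp (fdeg b) (L b)) -> (forall b, f (bvec b) = hvec (fdeg b) (L b)) ->
    hsupp c z ->
  f (hvec c z) = hvec c (fun j => \sum_b z b * L b j).
Proof.
move=> sL fL sz; rewrite hvec_bvec // linear_sum /= -hvec_sum; last first.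
  by move=> b /sz le j /sL/lepm_trans; apply.
apply: eq_bigr => b _; rewrite linearZ /= fL.
have [->|/sz le] := eqVneq (z b) 0; first by rewrite mpolyC0 !scale0r.
by rewrite -(hvecZ (sL b) le) scalerA mul_mpolyC.
Qed.

Lemma linear_mghom E F (f : {linear E -> F}) (L : fbasis E -> fbasis F -> K) :
    (forall b, hsupp (fdeg b) (L b)) -> (forall b, f (bvec b) = hvec (fdeg b) (L b)) ->
  mghom f.
Proof.
by move=> sL fL c _ /hvec_ex[z sz ->]; rewrite (linear_hvec sL fL sz); exact: hvec_comp.
Qed.

Lemma bvec_comp F (b : fbasis F) : mg_comp (fdeg b) (bvec b).
Proof.
move=> b' m; rewrite /bvec ffunE; case: eqP => [->|_]; last by rewrite msupp0.
by rewrite msupp1 inE => /eqP ->; rewrite add0m.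
Qed.

Lemma mon_mat_le E F (f : {linear E -> F}) j i : mon_mat f j i != 0 -> (fdeg j <= fdeg i)%MM.
Proof. by rewrite /mon_mat; case: ifP; rewrite ?eqxx. Qed.

Lemma mghom_bvec E F (f : {linear E -> F}) b : mghom f ->
  f (bvec b) = hvec (fdeg b) (fun j => mon_mat f j b).
Proof.
move=> hf; have [z sz e] := hvec_ex (hf _ _ (@bvec_comp _ b)).
rewrite e; apply: eq_hvec => j; rewrite /mon_mat e hvecE // mcoeffZ mcoeffX eqxx mulr1.
by case: ifPn => // nle; have [//|/sz] := eqVneq (z j) 0; rewrite (negbTE nle).
Qed.

Lemma mghom_hvec E F (f : {linear E -> F}) c (z : fbasis E -> K) : mghom f -> hsupp c z ->
  f (hvec c z) = hvec c (fun j => \sum_b z b * mon_mat f j b).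
Proof.
move=> hf; apply: linear_hvec => b; last exact: mghom_bvec.
by move=> j; exact: mon_mat_le.
Qed.

Lemma mon_mat_hsupp E F (f : {linear E -> F}) c (z : fbasis E -> K) : hsupp c z ->
  hsupp c (fun j => \sum_b z b * mon_mat f j b).
Proof.
move=> sz j nz; apply: contrapT => hn; case/eqP: nz; rewrite big1 // => b _.
have [->|/sz leb] := eqVneq (z b) 0; first by rewrite mul0r.
have [->|/mon_mat_le le] := eqVneq (mon_mat f j b) 0; first by rewrite mulr0.
by case: hn; exact: lepm_trans leb.
Qed.

Lemma lin_ext_bvec F G (A : fbasis F -> fbasis G -> S) b b1 :
  mgcoord (lin_ext A (bvec b)) b1 = A b b1.
Proof.
rewrite /lin_ext /mgcoord ffunE (bigD1 b) //= big1 => [|b' ne].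
  by rewrite mgcoord_bvec eqxx mul1r addr0.
by rewrite mgcoord_bvec (negbTE ne) mul0r.
Qed.

(** The composite is evaluated on [b] in degree [fdeg b], where a homogeneous element determines its
    coefficients. *)
Lemma mon_mat_comp i (F : mgcomplex K n) (h : forall i, mghom (cdiff F i))
    (dd : forall i v, cdiff F i (cdiff F i.+1 v) = 0) (b'' : fbasis (F i)) (b : fbasis (F i.+2)) :
  \sum_b' mon_mat (cdiff F i) b'' b' * mon_mat (cdiff F i.+1) b' b = 0.
Proof.
have sb : hsupp (fdeg b) (fun j => mon_mat (cdiff F i.+1) j b) by move=> j; exact: mon_mat_le.
have := dd i (bvec b); rewrite (mghom_bvec b (h _)) (mghom_hvec (h _) sb).
rewrite -(hvec0 (F i) (fdeg b)) => /hvec_inj.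
move/(_ (mon_mat_hsupp sb)) => e; rewrite -[RHS](e _ b'') => [|j]; last by rewrite eqxx.
by apply: eq_bigr => b' _; rewrite mulrC.
Qed.

End HomogeneousVectors.

Section GradedMaps.
Variables (K : fieldType) (n : nat).
Implicit Types (M N : mgmod K n) (c : 'X_{1..n}).

Lemma mg_ker_split M N (f : {linear M -> N}) v : mghom f -> f v = 0 ->
  exists (s : seq 'X_{1..n}) (y : 'X_{1..n} -> M),
    [/\ forall a, mg_comp a (y a), forall a, f (y a) = 0 & v = \sum_(a <- s) y a].
Proof.
move=> hf fv; have [s [y [gy y0 us e]]] := multigr_sum v.
exists s, y; split=> // a; have [sa|/y0 ->] := boolP (a \in s); last exact: linear0.
apply: (multigr_direct (mg_axiom N) us (y := fun a => f (y a))) => //.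
  by move=> b; exact: hf.
by rewrite -linear_sum -e.
Qed.

Lemma mg_lift M N (f : {linear M -> N}) c v m : mghom f -> f v = m -> mg_comp c m ->
  exists2 v', mg_comp c v' & f v' = m.
Proof.
move=> hf fv gm; have [s [y [gy y0 us e]]] := multigr_sum v.
exists (y c) => //; pose t := undup (c :: s).
have ut : uniq t by exact: undup_uniq.
have st : {subset s <= t} by move=> a sa; rewrite mem_undup inE sa orbT.
have ct : c \in t by rewrite mem_undup inE eqxx.
(* Subtracting [m] in degree [c] makes the images sum to zero, so directness of the grading gives f
   (y c) = m. *)
have := multigr_direct (mg_axiom N) ut (y := fun a => f (y a) - if a == c then m else 0).
move=> /(_ _ _ c ct); rewrite eqxx => h; apply/eqP; rewrite -subr_eq0; apply/eqP/h.
  move=> a; apply: (multigrB (mg_axiom N)); first exact: hf.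
  by case: eqP => [->//|_]; exact: (multigr0 (mg_axiom N)).
rewrite sumrB -linear_sum -(multigr_sumW us ut st y0) -e fv.
by rewrite -big_mkcond -big_filter filter_pred1_uniq // big_seq1 subrr.
Qed.

End GradedMaps.

(** * Homogeneous elements of the expansion F^* *)

Section HomogeneousExpansion.
Variables (K : fieldType) (n : nat) (ii : 'I_n -> nat).
Local Notation eta := (\sum_(j < n) ii j)%N.
Local Notation Ss := {mpoly K[eta]}.
Local Notation bl := (@tagnat.sig1 n ii).
Local Notation bdeg := (bdeg bl).
Implicit Types (E F : mgfree K n) (c d : 'X_{1..eta}).

Lemma hexp_mem E c (z : fbasis E -> K) :
  [ffun i => if (fdeg i <= bdeg c)%MM then z i *: 'X_[c] else 0 : Ss^o]
    \in @expF_pred K n ii E.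
Proof.
apply/expF_predP => i; rewrite ffunE; have [h0 _ hM] := @xstar_ideal K n ii (fdeg i).
by case: ifP => // le; rewrite -mul_mpolyC; apply/hM/xstar_X.
Qed.

(** F^* is a sum of ideals graded without shift, so in degree [c] all coordinates are multiples of
    one monomial. On these coefficients psi^* acts by the same matrix as psi does in degree
    [bdeg c]. *)
Definition hexp E c (z : fbasis E -> K) : expF_mod ii E := expF_sub (hexp_mem c z).

Lemma hexpE E c (z : fbasis E -> K) i : hsupp (bdeg c) z ->
  val (hexp c z : expF ii E) i = z i *: 'X_[c].
Proof.
move=> sz; rewrite ffunE; case: ifPn => // nle.
by have [->|/sz] := eqVneq (z i) 0; [rewrite scale0r|rewrite (negbTE nle)].
Qed.

Lemma hexp_comp E c (z : fbasis E -> K) : mg_comp c (hexp c z).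
Proof.
move=> i m; rewrite ffunE; case: ifP => _; last by rewrite msupp0.
by move=> /msuppZ_le; rewrite msuppX inE => /eqP ->; rewrite addm0.
Qed.

Lemma hexp_ex E c (v : expF_mod ii E) : mg_comp c v ->
  exists2 z : fbasis E -> K, hsupp (bdeg c) z & v = hexp c z.
Proof.
move=> /ffun_compP h; pose z i : K := (val (v : expF ii E) i : Ss)@_c.
have vz i : val (v : expF ii E) i = z i *: 'X_[c] :> Ss.
  apply/mpolyP => m; rewrite mcoeffZ mcoeffX; case: (eqVneq c m) => [<-|ne].
    by rewrite mulr1.
  by rewrite mulr0; apply: h; rewrite addm0 => e; case/eqP: ne.
have sz : hsupp (bdeg c) z.
  move=> i zi; apply/(@xstar_X K).
  have [_ _ hM] := @xstar_ideal K n ii (fdeg i).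
  have -> : 'X_[c] = (z i)^-1%:MP * val (v : expF ii E) i :> Ss.
    by rewrite vz mul_mpolyC scalerA mulVf // scale1r.
  apply: hM; exact: (expF_predP _ (valP (v : expF ii E))).
exists z => //; apply: val_inj; apply/ffunP => i; rewrite (hexpE i sz); exact: vz.
Qed.

Lemma hexp_expM E F (psi : {linear E -> F}) c (z : fbasis E -> K) : hsupp (bdeg c) z ->
  expM ii psi (hexp c z) = hexp c (fun j => \sum_b z b * mon_mat psi j b).
Proof.
move=> sz; apply: val_inj; apply/ffunP => j.
rewrite (hexpE j (mon_mat_hsupp sz)) [LHS]ffunE scaler_suml; apply: eq_bigr => i _.
by rewrite (hexpE i sz) mul_mpolyC scalerA mulrC.
Qed.

Lemma hexp_inj E c (z z' : fbasis E -> K) : hsupp (bdeg c) z -> hsupp (bdeg c) z' ->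
  hexp c z = hexp c z' -> z =1 z'.
Proof.
move=> sz sz' e b; have := congr1 (fun v : expF ii E => (val v b : Ss)@_c) e.
by rewrite !hexpE // !mcoeffZ mcoeffX eqxx !mulr1.
Qed.

Lemma val_expFZ E (p : Ss) (v : expF ii E) i : val (p *: v) i = p * val v i.
Proof. by rewrite linearZ ffunE. Qed.

Lemma hexpZ E c d (z : fbasis E -> K) : hsupp (bdeg d) z -> (d <= c)%MM ->
  'X_[c - d] *: hexp d z = hexp c z.
Proof.
move=> sz le; have sz' : hsupp (bdeg c) z.
  by move=> b /sz leb; apply: lepm_trans leb (bdeg_le _ le).
apply: val_inj; apply/ffunP => i; rewrite (hexpE i sz').
rewrite [LHS](val_expFZ _ (hexp d z : expF ii E)) (hexpE i sz).
by rewrite -scalerAr -mpolyXD submK.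
Qed.

Lemma hexp_sum E c (I : finType) (a : I -> K) (z : I -> fbasis E -> K) :
  (forall i, a i != 0 -> hsupp (bdeg c) (z i)) ->
  \sum_i (a i)%:MP *: hexp c (z i) = hexp c (fun b => \sum_i a i * z i b).
Proof.
move=> sz; have sz' : hsupp (bdeg c) (fun b => \sum_i a i * z i b).
  move=> b nz; apply: contrapT => hn; case/eqP: nz; rewrite big1 // => i _.
  have [->|ai] := eqVneq (a i) 0; first by rewrite mul0r.
  by have [->|/(sz i ai)] := eqVneq (z i b) 0; first by rewrite mulr0.
apply: val_inj; apply/ffunP => b; rewrite (hexpE b sz') scaler_suml.
rewrite (raddf_sum (val : expF ii E -> _)) sum_ffunE; apply: eq_bigr => i _.
rewrite [LHS](val_expFZ _ (hexp c (z i) : expF ii E)) mul_mpolyC.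
have [->|ai] := eqVneq (a i) 0; first by rewrite mul0r !scale0r.
by rewrite hexpE ?scalerA //; exact: sz.
Qed.

End HomogeneousExpansion.

(** * Symbols of the tensor products *)

Section TensorSymbols.
Variables (K : fieldType) (n : nat) (ii : 'I_n -> nat).
Local Notation eta := (\sum_(j < n) ii j)%N.
Local Notation Ss := {mpoly K[eta]}.
Local Notation bl := (@tagnat.sig1 n ii).
Local Notation bdeg := (bdeg bl).
Local Notation aset := (aset bl).
Local Notation isgen := (isgen bl).
Local Notation gcomb := (@gcomb K n ii).
Local Notation gfun := (@gfun K n ii).
Local Notation symbols := (@symbols K n ii).
Implicit Types (a b : 'X_{1..n}) (j : 'I_n) (d : nat) (u v : 'X_{1..eta})
  (sigma : {set 'I_eta}) (t k : 'I_eta).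

Definition tensor_basis a := {dffun forall j : 'I_n, seq_sub (symbols j (a j))}.

Definition block j : {set 'I_eta} := [set t | bl t == j].

Definition mres j u : 'X_{1..eta} := [multinom (if bl k == j then u k else 0)%N | k < eta].

Lemma mresE j u k : mres j u k = if bl k == j then u k else 0%N.
Proof. by rewrite mnmE. Qed.

Lemma mres_id j d u : bdeg u = (U_(j) *+ d)%MM -> mres j u = u.
Proof.
move=> du; apply/mnmP => k; rewrite mresE; case: ifPn => // ne.
by rewrite (@gens_block K n ii j d) // gensE du.
Qed.

Lemma bdeg_mres a j u : bdeg u = a -> bdeg (mres j u) = (U_(j) *+ a j)%MM.
Proof.
move=> <-; apply/mnmP => i; rewrite mulmnE mnm1E !bdegE.
have [<-|ne] := eqVneq j i.
  by rewrite mul1n; apply: eq_bigr => k kj; rewrite mresE kj.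
by rewrite mul0n big1 // => k /eqP ki; rewrite mresE ki eq_sym (negbTE ne).
Qed.

Lemma mem_symbols j d sigma u :
  ((sigma, u) \in symbols j d) = (bdeg u == (U_(j) *+ d)%MM) && (sigma \subset aset u).
Proof.
apply/allpairsPdep/andP => [[v [tau [vg]]]|[ug su]].
  rewrite mem_enum powersetE => ts [-> ->].
  by rewrite -(gensE K) vg -(@set_genE K n ii j d).
exists u, sigma; split=> //; first by rewrite gensE.
by rewrite mem_enum powersetE set_genE // gensE.
Qed.

Section Basis.
Variable a : 'X_{1..n}.
Implicit Types x y : tensor_basis a.

(** The factors sigma_j and u_j of a tensor of symbols are supported in block j, so their union and
    product determine the tensor and replace dependent families by a single pair. *)
Definition tset x : {set 'I_eta} := [set t | t \in (ssval (x (bl t))).1].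
Definition tmon x : 'X_{1..eta} := [multinom (ssval (x (bl k))).2 k | k < eta].

Lemma tsetE x t : (t \in tset x) = (t \in (ssval (x (bl t))).1).
Proof. by rewrite inE. Qed.

Lemma tmonE x k : tmon x k = (ssval (x (bl k))).2 k.
Proof. by rewrite mnmE. Qed.

Lemma tensor_comp x j : bdeg (ssval (x j)).2 = (U_(j) *+ a j)%MM /\
  (ssval (x j)).1 \subset aset (ssval (x j)).2.
Proof.
have := ssvalP (x j); case: (ssval (x j)) => sigma u.
by rewrite mem_symbols => /andP[/eqP].
Qed.

Lemma tensor_set_block x j t : t \in (ssval (x j)).1 -> bl t = j.
Proof.
have [du /subsetP su] := tensor_comp x j; move=> /su /asetP[s [_ <- us]].
apply/eqP; apply: contraTT us => ne.
by rewrite (@gens_block K n ii j (a j)) // gensE du.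
Qed.

Lemma tensor_compE x j : ssval (x j) = (tset x :&: block j, mres j (tmon x)).
Proof.
have [du su] := tensor_comp x j; rewrite [LHS]surjective_pairing; congr (_, _).
  apply/setP => t; rewrite !inE; have [<-|ne] := eqVneq (bl t) j; first by rewrite andbT.
  by rewrite andbF; apply: contra_neqF ne; exact: tensor_set_block.
rewrite -[LHS](mres_id du); apply/mnmP => k; rewrite !mresE tmonE.
by case: eqP => [->|].
Qed.

Lemma tensor_eqP x sigma u :
  reflect (forall j, ssval (x j) = (sigma :&: block j, mres j u))
          ((tset x, tmon x) == (sigma, u)).
Proof.
apply: (iffP eqP) => [[<- <-] j|h]; first exact: tensor_compE.
congr (_, _).
  by apply/setP => t; rewrite tsetE h !inE eqxx andbT.
by apply/mnmP => k; rewrite tmonE h /= mresE eqxx.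
Qed.

Lemma tensor_inj x y : tset x = tset y -> tmon x = tmon y -> x = y.
Proof.
move=> es em; apply/ffunP => j; apply: val_inj => /=.
by rewrite !tensor_compE es em.
Qed.

Lemma bdeg_tmon x : bdeg (tmon x) = a.
Proof.
apply/mnmP => j; have [du _] := tensor_comp x j.
have -> : a j = bdeg (ssval (x j)).2 j by rewrite du mulmnE mnm1E eqxx mul1n.
by rewrite !bdegE; apply: eq_bigr => k /eqP kj; rewrite tmonE kj.
Qed.

Lemma tset_aset x : tset x \subset aset (tmon x).
Proof.
apply/subsetP => t; rewrite tsetE; have [_ /subsetP su] := tensor_comp x (bl t).
move=> /su /asetP[s [ts bs us]]; apply/asetP; exists s; split=> //.
by rewrite tmonE bs.
Qed.

Lemma tensor_surj sigma u : bdeg u = a -> sigma \subset aset u ->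
  exists x, tset x = sigma /\ tmon x = u.
Proof.
move=> du su.
have h j : (sigma :&: block j, mres j u) \in symbols j (a j).
  rewrite mem_symbols (bdeg_mres _ du) eqxx; apply/subsetP => t.
  rewrite !inE => /andP[/(subsetP su)/asetP[s [ts bs us]] /eqP bt].
  by apply/existsP; exists s; rewrite ts bs eqxx mresE bs bt eqxx.
pose x : tensor_basis a := [ffun j => SeqSub (h j)].
have /tensor_eqP/eqP[e1 e2] : forall j, ssval (x j) = (sigma :&: block j, mres j u).
  by move=> j; rewrite ffunE.
by exists x.
Qed.

End Basis.
Lemma mres_gcomb a v j : (a <= bdeg v)%MM -> mres j (gcomb a v) = gfun j (a j) v.
Proof.
move=> le; apply/mnmP => k; rewrite mresE; case: eqP => [<-|/eqP ne]; first exact: gcombE.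
by rewrite (@gfun_block K n ii) // le_mulmn1.
Qed.

Lemma gfun_mres j d v : (U_(j) *+ d <= bdeg v)%MM -> gfun j d (mres j v) = gfun j d v.
Proof.
move=> le; apply: (isgen_uniq (bl := bl) (a := (U_(j) *+ d)%MM) (v := v)); last first.
  exact: gfun_isgen.
have le' : (U_(j) *+ d <= bdeg (mres j v))%MM.
  apply/mnm_lepP => i; have := mnm_lepP le i; rewrite !mulmnE !mnm1E.
  have [<-|_] := eqVneq j i; rewrite ?mul0n ?mul1n // => /leq_trans; apply.
  by rewrite !bdegE leq_sum // => k kj; rewrite mresE kj.
have [gle dg hg] := gfun_isgen K le'; split=> //.
  apply: lepm_trans gle _; apply/mnm_lepP => k; rewrite mresE.
  by case: ifP.
move=> t tg; rewrite hg // mresE; have /asetP[s [_ bs gs]] := tg.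
case: eqP => // /eqP ne; move: gs.
by rewrite (@gens_block K n ii j d) ?bs // gensE dg.
Qed.

Lemma set_monE sigma u k : [multinom ((i \in sigma) + u i)%N | i < eta] k =
  ((k \in sigma) + u k)%N.
Proof. by rewrite mnmE. Qed.

Lemma tensor_hdeg a (x : tensor_basis a) : bc_hdeg (x : bc_basis (Gtensor K ii a)) = #|tset x|.
Proof.
rewrite /= -sum1_card (partition_big bl predT) //=; apply: eq_bigr => j _.
rewrite tensor_compE -sum1_card; apply: eq_bigl => t.
by rewrite !inE.
Qed.

Definition tensor_degree a (x : tensor_basis a) : 'X_{1..eta} :=
  [multinom ((i \in tset x) + tmon x i)%N | i < eta].

Lemma tensor_mdeg a (x : tensor_basis a) :
  bc_mdeg (x : bc_basis (Gtensor K ii a)) = tensor_degree x.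
Proof.
apply/mnmP => i; rewrite /= mnm_sumE mnmE (bigD1 (bl i)) //= [X in (_ + X)%N]big1 => [|j ne].
  by rewrite mnmE tsetE tmonE addn0.
by rewrite mnmE tensor_compE /= !inE mresE eq_sym (negbTE ne) andbF.
Qed.

Lemma gp_diffE j d (x y : bc_basis (GP K ii j d)) : bc_diff x y =
  \sum_(t in (ssval x).1) (-1) ^+ below (ssval x).1 t *
    ('X_[U_(t) + (ssval x).2 - gfun j d (U_(t) + (ssval x).2)] *
       (ssval y == ((ssval x).1 :\ t, gfun j d (U_(t) + (ssval x).2)%MM))%:R -
     'X_t * (ssval y == ((ssval x).1 :\ t, (ssval x).2))%:R) :> Ss.
Proof.
rewrite /= /gp_diff; case: (ssval x) => sigma u /=.
rewrite addrC -sumrB; apply: eq_bigr => t _.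
by rewrite -!mulrA -mulrBr.
Qed.

(** The blocks are consecutive in the order of the variables. Hence the Koszul sign of the tensor
    product and the sign inside the factor of t combine to the sign for the merged sigma. *)
Lemma below_block sigma t : (\sum_(i < n | (i < bl t)%N) #|sigma :&: block i| +
  below (sigma :&: block (bl t)) t)%N = below sigma t.
Proof.
rewrite /below -!sum1_card [RHS](partition_big bl (fun i => (i <= bl t)%N)) /=; last first.
  move=> s; rewrite inE => /andP[_ /ltnW st].
  by have := @tagnat.le_sig1 n ii s t st.
rewrite [RHS](bigD1 (bl t)) //= addnC; congr (_ + _)%N.
  apply: eq_bigl => s; rewrite !inE.
  by case: (s \in sigma) => //=; rewrite andbC.
apply: eq_big => [i|i it]; first by rewrite ltn_neqAle andbC.
rewrite -sum1_card; apply: eq_bigl => s; rewrite !inE.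
have [bs|_] := eqVneq (bl s) i; last by rewrite !andbF.
have -> : (s < t)%N.
  rewrite ltnNge; apply: contraTN it => ts; rewrite -leqNgt -bs.
  exact: (@tagnat.le_sig1 n ii t s ts).
by rewrite !andbT.
Qed.

(** After merging the blocks, the tensor differential has the shape of the differential of a single
    G(P^a), because an exchange at t changes only the block of t. *)
Lemma tensor_diff a (x y : tensor_basis a) :
  bc_diff (x : bc_basis (Gtensor K ii a)) y =
  (\sum_(t in tset x) (-1) ^+ below (tset x) t *
     (((tset y, tmon y) == (tset x :\ t, gcomb a (U_(t) + tmon x)%MM))%:R -
      ((tset y, tmon y) == (tset x :\ t, tmon x))%:R)) *:
  'X_[tensor_degree x - tensor_degree y].
Proof.
rewrite /tensor_degree scaler_suml (partition_big bl predT) //=.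
apply: eq_bigr => j _; rewrite -[gp_diff _ _]/(bc_diff (x j : bc_basis (GP K ii j (a j))) (y j)).
rewrite gp_diffE big_distrl big_distrr /=.
have ej := tensor_compE x j.
have le0 : (a <= bdeg (tmon x))%MM by rewrite bdeg_tmon lepm_refl.
(* Agreement with [x] outside block j, together with a prescribed component at j, amounts to
   prescribing the merged pair. *)
have others t sigma' u' : bl t = j -> sigma' = tset x :\ t ->
    (forall i, i != j -> mres i u' = mres i (tmon x)) ->
    (ssval (y j) == (sigma' :&: block j, mres j u')) && [forall i, (i != j) ==> (x i == y i)] =
    ((tset y, tmon y) == (sigma', u')).
  move=> tj es eu; apply/andP/tensor_eqP => [[/eqP yj /forallP h] i|h]; last first.
    split; first exact/eqP/h.
    apply/forallP => i; apply/implyP => ne; apply/eqP/val_inj => /=.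
    rewrite h tensor_compE eu // es; congr (_, _); apply/setP => s; rewrite !inE.
    have [e|//] := eqVneq (bl s) i; last by rewrite !andbF.
    have -> : s != t by apply: contra_neq ne => e'; rewrite -e e'.
    by [].
  have [->//|ne] := eqVneq i j.
  have /eqP <- := implyP (h i) ne; rewrite tensor_compE eu // es; congr (_, _).
  apply/setP => s; rewrite !inE.
  have [e|//] := eqVneq (bl s) i; last by rewrite !andbF.
  have -> : s != t by apply: contra_neq ne => e'; rewrite -e e'.
  by [].
apply: eq_big => [t|t]; first by rewrite ej !inE.
rewrite ej /= !inE => /andP[tx /eqP tj].
have tx' : t \in tset x by rewrite tsetE.
have eD : (tset x :&: block j) :\ t = (tset x :\ t) :&: block j.
  by apply/setP => s; rewrite !inE andbA.
have eU i : i != j -> mres i (gcomb a (U_(t) + tmon x)%MM) = mres i (tmon x).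
  move=> ne; have leU : (a <= bdeg (U_(t) + tmon x))%MM.
    by rewrite bdegD; apply: lepm_trans le0 (lem_addl _ _).
  rewrite mres_gcomb // -gfun_mres ?le_mulmn1 //.
  have -> : mres i (U_(t) + tmon x)%MM = mres i (tmon x).
    apply/mnmP => k; rewrite !mresE; case: eqP => // ki; rewrite mnmDE mnm1E.
    by have [e|//] := eqVneq t k; case/eqP: ne; rewrite -ki -e tj.
  have dx := bdeg_mres i (bdeg_tmon x).
  apply: (isgen_uniq (bl := bl) (a := (U_(i) *+ a i)%MM) (v := mres i (tmon x))).
    by apply: gfun_isgen; rewrite dx lepm_refl.
  by rewrite -{1}dx; exact: isgen_id.
have eg : gfun j (a j) (U_(t) + mres j (tmon x))%MM = mres j (gcomb a (U_(t) + tmon x)%MM).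
  have leU : (a <= bdeg (U_(t) + tmon x))%MM.
    by rewrite bdegD; apply: lepm_trans le0 (lem_addl _ _).
  rewrite mres_gcomb // -[RHS]gfun_mres ?le_mulmn1 //; congr Defs.gfun.
  apply/mnmP => k; rewrite mnmDE !mresE mnmDE mnm1E.
  have [//|kj] := eqVneq (bl k) j.
  by have -> : (t == k) = false by apply: contra_neqF kj => /eqP <-.
have sgn : (-1) ^+ (\sum_(i < n | (i < j)%N) #|(ssval (x i)).1|) *
    (-1) ^+ below (tset x :&: block j) t = (-1) ^+ below (tset x) t :> Ss.
  rewrite -exprD -(below_block (tset x) t) tj; congr (_ ^+ (_ + _)).
  by apply: eq_bigr => i _; rewrite tensor_compE.
rewrite mulrA mulrA sgn -scalerA -[(-1) ^+ _ *: _]mul_mpolyC rmorphXn rmorphN1.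
rewrite -mulrA; congr (_ * _); rewrite mulrBl scalerBl; congr (_ - _).
  rewrite -mulrA -natrM mulnb eD eg (others t) //.
  case: eqP => [[e1 e2]|_]; last by rewrite mulr0 scale0r.
  rewrite mulr1 scale1r; congr mpolyX; apply/mnmP => k.
  rewrite mnmBE [RHS]mnmBE !set_monE mnmDE e1 e2 !inE.
  have [kj|kj] := eqVneq (bl k) j; last first.
    have nt : k != t by apply: contra_neq kj => ->.
    rewrite nt /= mresE (negbTE kj) mnm1E eq_sym (negbTE nt).
    have := eU (bl k) kj => /(congr1 (fun v : 'X_{1..eta} => v k)); rewrite !mresE eqxx => ->.
    by rewrite subnn.
  rewrite !mresE kj eqxx mnm1E eq_sym; have [->|_] /= := eqVneq k t; last by rewrite add0n subnDl.
  by rewrite -tj tx.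
rewrite -mulrA -natrM mulnb eD (others t) //.
case: eqP => [exy|_]; last by rewrite mulr0 scale0r.
have e1 : tset y = tset x :\ t := congr1 fst exy.
have e2 : tmon y = tmon x := congr1 snd exy.
rewrite mulr1 scale1r; congr mpolyX; apply/mnmP => k.
rewrite mnmBE mnm1E !set_monE e1 e2 in_setD1; have [->|ne] := eqVneq k t.
  by rewrite tx' add0n addnK.
by rewrite /= subnn.
Qed.

Lemma tensor_map a b (x : tensor_basis a) (y : tensor_basis b) : (b <= a)%MM ->
  phi_tensor (x : bc_basis (Gtensor K ii a)) (y : bc_basis (Gtensor K ii b)) =
  ((tset y, tmon y) == (tset x, gcomb b (tmon x)))%:R *:
  'X_[tensor_degree x - tensor_degree y].
Proof.
move=> le; rewrite /tensor_degree /phi_tensor /bc_tensor_map /phi.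
have le' : (b <= bdeg (tmon x))%MM by rewrite bdeg_tmon.
have eg j : gfun j (b j) (mres j (tmon x)) = mres j (gcomb b (tmon x)).
  by rewrite mres_gcomb // gfun_mres // le_mulmn1.
transitivity (\prod_j ('X_[mres j (tmon x) - mres j (gcomb b (tmon x))] *
    (ssval (y j) == (tset x :&: block j, mres j (gcomb b (tmon x))))%:R : Ss)).
  by apply: eq_bigr => j _; rewrite (tensor_compE x) /cfun /fsym eg.
have [/tensor_eqP h|/tensor_eqP h] := boolP ((tset y, tmon y) == (tset x, gcomb b (tmon x))).
  under eq_bigr do rewrite h eqxx mulr1; rewrite scale1r mprodXE; congr mpolyX.
  have /tensor_eqP/eqP[e1 e2] := h.
  apply/mnmP => k; rewrite mnm_sumE mnmBE !set_monE e1 e2 subnDl.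
  rewrite (bigD1 (bl k)) //= [X in (_ + X)%N]big1 ?addn0 => [|j ne]; first by rewrite mnmBE !mresE eqxx.
  by rewrite mnmBE !mresE eq_sym (negbTE ne).
rewrite scale0r; have [j hj] : exists j, ssval (y j) != (tset x :&: block j, mres j (gcomb b (tmon x))).
  by apply: contrapT => hn; apply: h => j; apply/eqP; apply: contrapT => /negP ne; apply: hn; exists j.
by rewrite [LHS](bigD1 j) //= (negbTE hj) mulr0 mul0r.
Qed.

End TensorSymbols.

(** * The total complex of the double complex *)

Section TotalSymbols.
Variables (K : fieldType) (n : nat) (ii : 'I_n -> nat) (F : mgcomplex K n).
Local Notation eta := (\sum_(j < n) ii j)%N.
Local Notation Ss := {mpoly K[eta]}.
Local Notation bl := (@tagnat.sig1 n ii).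
Local Notation bdeg := (bdeg bl).
Local Notation aset := (aset bl).
Local Notation gcomb := (@gcomb K n ii).
Local Notation C := (expansion_double ii F).
Local Notation cell := {i : nat & fbasis (F i)}.
Local Notation point := (cell * {set 'I_eta} * 'X_{1..eta})%type.
Local Notation lam := (fun i b' b => mon_mat (cdiff F i) b' b).
Local Notation ent := (@ent K eta n F lam gcomb).
Local Notation bcell := (@bcell K n F _).

Definition Gpoint i (z : bc_basis (Gsum ii F i)) : point :=
  (bcell (tag z), tset (tagged z : tensor_basis K ii _), tmon (tagged z : tensor_basis K ii _)).

Definition idx_point (w : tot_idx C) : point := Gpoint (val (tagged (tagged w))).

Definition tot_point k (x : fbasis (tot_term C k)) : point := Gpoint (val (tagged x)).

Lemma Gpoint_inj i : injective (@Gpoint i).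
Proof.
move=> [l x] [l' x'] e; have e1 : bcell l = bcell l' := congr1 (fun q => q.1.1) e.
have e2 : tset (x : tensor_basis K ii _) = tset (x' : tensor_basis K ii _) :=
  congr1 (fun q => q.1.2) e.
have e3 : tmon (x : tensor_basis K ii _) = tmon (x' : tensor_basis K ii _) :=
  congr1 (fun q => q.2) e.
move/bcell_inj: e1 => e1; case: _ / e1 x' e2 e3 {e} => x' e2 e3.
by congr Tagged; exact: tensor_inj.
Qed.

Lemma Gpoint_valid i (z : bc_basis (Gsum ii F i)) : valid bl (Gpoint z).
Proof. by split; [exact: bdeg_tmon|exact: tset_aset]. Qed.

Lemma Gpoint_hdeg i (z : bc_basis (Gsum ii F i)) : bc_hdeg z = #|(Gpoint z).1.2|.
Proof. exact: tensor_hdeg. Qed.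

Lemma Gpoint_mdeg i (z : bc_basis (Gsum ii F i)) : bc_mdeg z = pdeg (Gpoint z).
Proof. exact: tensor_mdeg. Qed.

Lemma tot_point_valid k (x : fbasis (tot_term C k)) : valid bl (tot_point x).
Proof. exact: Gpoint_valid. Qed.

Lemma tot_point_tdeg k (x : fbasis (tot_term C k)) : tdeg (tot_point x) = k.
Proof.
rewrite /tdeg -Gpoint_hdeg; have := valP (tagged x) => /eqP ->.
exact: (@subnKC (tag x) k (ltn_ord (tag x))).
Qed.

Lemma tot_point_fdeg k (x : fbasis (tot_term C k)) : fdeg x = pdeg (tot_point x).
Proof. exact: Gpoint_mdeg. Qed.

Lemma tot_point_inj k : injective (@tot_point k).
Proof.
move=> [i x] [i' x'] e.
have e1 : i = i' by apply: ord_inj; exact: (congr1 (fun q : point => tag q.1.1) e).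
case: _ / e1 x' e => x' e; congr Tagged; apply: val_inj.
exact: (@Gpoint_inj i _ _ e).
Qed.

Lemma tot_point_surj (q : point) : valid bl q ->
  exists x : fbasis (tot_term C (tdeg q)), tot_point x = q.
Proof.
case: q => -[[i b] sigma] u [/= wq sq]; have [x [e1 e2]] := tensor_surj K wq sq.
pose z : bc_basis (Gsum ii F i) := Tagged (fun l => bc_basis (Gtensor K ii (fdeg l))) x.
set k := tdeg _; have ik : (i < k.+1)%N by rewrite ltnS leq_addr.
have hz : bc_hdeg z == (k - i)%N by rewrite Gpoint_hdeg /k /tdeg addKn; apply/eqP; rewrite /= e1.
exists (existT (fun i : 'I_k.+1 => fbasis (dterm C i (k - i))) (Ordinal ik) (exist _ z hz)).
by rewrite /tot_point /Gpoint /= e1 e2.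
Qed.

Lemma idx_point_ex i j (w : tot_idx C) (b : fbasis (F i)) sigma u :
  idx_point w = (bcell b, sigma, u) -> #|sigma| = j ->
  exists c : fbasis (dterm C i j), w = existT _ i (existT _ j c).
Proof.
case: w => i0 [j0 c] e ej.
have ei : i0 = i := congr1 (fun q : point => tag q.1.1) e.
have e0 : j0 = j by rewrite -ej -(eqP (valP c)) Gpoint_hdeg -[Gpoint _]/(idx_point (existT _ i0 (existT _ j0 c))) e.
by case: _ / ei c {e} => c; case: _ / e0 c => c; exists c.
Qed.

Lemma tsym_sum k (y : fbasis (tot_term C k)) i j (c : fbasis (dterm C i j))
    (f : fbasis (dterm C i j) -> Ss) : to_idx y = existT _ i (existT _ j c) :> tot_idx C ->
  \sum_c' f c' * tsym y c' = f c.
Proof.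
move=> ec; rewrite (bigD1 c) //= [X in _ + X]big1 => [|c' ne]; last first.
  rewrite /tsym ec; case: eqP => [e|_]; last by rewrite mulr0.
  by move/eqP: e; rewrite eq_Tagged /= eq_Tagged /= eq_sym (negbTE ne).
by rewrite /tsym ec eqxx mulr1 addr0.
Qed.

Lemma tot_rowE k (y : fbasis (tot_term C k)) i j (b : fbasis (dterm C i j)) :
  tot_row y b = rowT lam gcomb (delta (tot_point y))
      (Gpoint (val b)).1.1 (Gpoint (val b)).1.2 (Gpoint (val b)).2
    *: 'X_[pdeg (Gpoint (val b)) - pdeg (tot_point y)].
Proof.
case: i b => [|i] b; first by rewrite /rowT /= scale0r.
rewrite /tot_row /rowT -[(Gpoint (val b)).1.1]/(bcell (tag (val b))) rowsumE.
transitivity (\sum_(c : fbasis (dterm C i j)) Gsum_map (val b) (val c) * tsym y c).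
  by apply: eq_bigr => c _; congr (_ * _); exact: lin_ext_bvec.
(* If [y] does not lie in bidegree (i, j), both sides vanish. *)
have [[c ec]|hn] := asboolP (exists c, to_idx y = existT _ i (existT _ j c) :> tot_idx C).
  have ey : tot_point y = Gpoint (val c).
    by rewrite -[RHS]/(idx_point (existT _ i (existT _ j c))) -ec.
  rewrite (tsym_sum (fun c => Gsum_map (val b) (val c)) ec) /Gsum_map ey.
  rewrite (bigD1 (tag (val c))) //= [X in _ + X]big1 => [|l ne]; last first.
    rewrite /delta; case: eqP => [e|_]; last by rewrite mulr0.
    have /bcell_inj e1 := congr1 (fun q : point => q.1.1) e.
    by rewrite -e1 eqxx in ne.
  case: ifPn => le; last first.
    by rewrite /mon_mat (negbTE le) mul0r addr0 scale0r.
  rewrite addr0 mul_mpolyC -scalerA; congr (_ *: _); rewrite (tensor_map _ _ le).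
  by rewrite /delta /Gpoint !xpair_eqE eqxx.
rewrite [LHS]big1 => [|c _]; last first.
  by rewrite /tsym; case: eqP => [e|_]; rewrite ?mulr0 //; case: hn; exists c.
rewrite [X in X *: _]big1 ?scale0r // => l _; rewrite /delta; case: eqP => [e|_]; last by rewrite mulr0.
case: hn; apply: (@idx_point_ex i j (to_idx y) l _ _ e).
by rewrite -[RHS](eqP (valP b)) Gpoint_hdeg.
Qed.

Lemma tot_colE k (y : fbasis (tot_term C k)) i j (b : fbasis (dterm C i j)) :
  tot_col y b = colT gcomb (delta (tot_point y))
      (Gpoint (val b)).1.1 (Gpoint (val b)).1.2 (Gpoint (val b)).2
    *: 'X_[pdeg (Gpoint (val b)) - pdeg (tot_point y)].
Proof.
case: j b => [|j] b.
  rewrite /tot_col; have /eqP := Gpoint_hdeg (val b); rewrite (eqP (valP b)) eq_sym cards_eq0 => /eqP e0.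
  by rewrite /colT e0 big_set0 scale0r.
transitivity (\sum_(c : fbasis (dterm C i j)) bc_diff (val b) (val c) * tsym y c).
  by apply: eq_bigr => c _; congr (_ * _); exact: lin_ext_bvec.
have [[c ec]|hn] := asboolP (exists c, to_idx y = existT _ i (existT _ j c) :> tot_idx C).
  have ey : tot_point y = Gpoint (val c).
    by rewrite -[RHS]/(idx_point (existT _ i (existT _ j c))) -ec.
  rewrite (tsym_sum (fun c => bc_diff (val b) (val c)) ec) ey.
  case: (val b) (val c) => [l x] [l' x'] /=; have [el|ne] := eqVneq l l'; last first.
    have d0 s v : delta (Gpoint (existT _ l' x')) (bcell l) s v = 0 :> K.
      rewrite /delta; case: eqP => // e.
      have e1 : l' = l := bcell_inj (congr1 (fun q : point => q.1.1) e).
      by rewrite e1 eqxx in ne.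
    by rewrite /colT [X in X *: _]big1 ?scale0r // => t _; rewrite !d0 subrr mulr0.
  case: _ / el x' => x'; rewrite tagged_asE.
  rewrite [LHS](tensor_diff (x : tensor_basis K ii _) x'); congr (_ *: _).
  by apply: eq_bigr => t _; rewrite /delta /Gpoint !xpair_eqE eqxx.
rewrite [LHS]big1 => [|c _]; last first.
  by rewrite /tsym; case: eqP => [e|_]; rewrite ?mulr0 //; case: hn; exists c.
rewrite /colT [X in X *: _]big1 ?scale0r // => t ts.
have hc : #|tset (tagged (val b) : tensor_basis K ii _) :\ t| = j.
  have := Gpoint_hdeg (val b); rewrite (eqP (valP b)) /= (cardsD1 t) ts add1n.
  by case.
rewrite /delta; case: eqP => [e|_]; first by case: hn; exact: (@idx_point_ex i j (to_idx y) _ _ _ e hc).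
case: eqP => [e|_]; first by case: hn; exact: (@idx_point_ex i j (to_idx y) _ _ _ e hc).
by rewrite subrr mulr0.
Qed.

(** The bridge to the symbol complex: each entry of T(C) is a scalar entry of that complex times the
    monomial forced by the degrees. *)
Lemma tot_entry k (x : fbasis (tot_term C k.+1)) (y : fbasis (tot_term C k)) :
  tot_row y (tagged x) + (-1) ^+ tag x * tot_col y (tagged x) =
  ent (tot_point x) (tot_point y) *: 'X_[fdeg x - fdeg y].
Proof.
rewrite tot_rowE tot_colE !tot_point_fdeg -scalerAr /ent /diffT.
rewrite [RHS]scalerDl; congr (_ + _); rewrite [X in _ = X *: _]mulrC -scalerA.
congr (_ *: _); rewrite -[in LHS]signr_odd -[in RHS]signr_odd.
by case: odd; rewrite ?expr0 ?expr1 ?mulN1r ?scaleN1r ?mul1r ?scale1r.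
Qed.

End TotalSymbols.

(** * The resolution *)

Section FreeLift.
Variables (K : fieldType) (n : nat) (E : mgfree K n) (W : lmodType {mpoly K[n]}).
Variable w : fbasis E -> W.

Definition free_lift_fun (v : E) : W := \sum_b mgcoord v b *: w b.

Lemma free_lift_is_linear : linear free_lift_fun.
Proof.
move=> p u v; rewrite /free_lift_fun scaler_sumr -big_split; apply: eq_bigr => b _ /=.
by rewrite mgcoordD mgcoordZ scalerDl scalerA.
Qed.

HB.instance Definition _ :=
  GRing.isLinear.Build {mpoly K[n]} E W _ free_lift_fun free_lift_is_linear.

Definition free_lift : {linear E -> W} := free_lift_fun.

End FreeLift.

Lemma mg_comp_eq0 (K : fieldType) (n : nat) (M N : mgmod K n) (W : lmodType {mpoly K[n]})
    (f : {linear M -> N}) (h : {linear N -> W}) :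
  (forall a x, mg_comp a x -> h (f x) = 0) -> forall x, h (f x) = 0.
Proof.
move=> h0 x; have [s [y [gy _ _ ->]]] := multigr_sum x.
by rewrite !linear_sum big1 // => a _; exact: h0 (gy a).
Qed.

Lemma image_sum (R : nzRingType) (U V : lmodType R) (f : {linear U -> V}) (I : Type)
    (s : seq I) (y : I -> V) :
  (forall i, exists w, f w = y i) -> exists w, f w = \sum_(i <- s) y i.
Proof.
move=> h; apply: (big_ind (fun v => exists w, f w = v)) => //.
  by exists 0; rewrite linear0.
by move=> _ _ [w <-] [w' <-]; exists (w + w'); rewrite linearD.
Qed.

Lemma mg_image (K : fieldType) (n : nat) (M N : mgmod K n) (W : lmodType {mpoly K[n]})
    (f : {linear M -> W}) (h : {linear N -> W}) :
    (forall a x, mg_comp a x -> exists w, f w = h x) ->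
  forall x, exists w, f w = h x.
Proof.
move=> hx x; have [s [y [gy _ _ ->]]] := multigr_sum x.
by rewrite linear_sum; apply: image_sum => a; exact: hx (gy a).
Qed.

Lemma hvecB (K : fieldType) (n : nat) (E : mgfree K n) c (z z' : fbasis E -> K) :
  hvec c (fun b => z b - z' b) = hvec c z - hvec c z'.
Proof.
apply/ffunP => b; rewrite !ffunE; case: ifP => _; last by rewrite subr0.
by rewrite scalerBl.
Qed.

Lemma hsuppB (K : fieldType) (n : nat) (E : mgfree K n) c (z z' : fbasis E -> K) :
  hsupp c z -> hsupp c z' -> hsupp c (fun b => z b - z' b).
Proof.
by move=> h h' b; have [->|/h //] := eqVneq (z b) 0; rewrite sub0r oppr_eq0 => /h'.
Qed.

Lemma hexpB (K : fieldType) (n : nat) (ii : 'I_n -> nat) (E : mgfree K n) c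
    (z z' : fbasis E -> K) :
  hexp (ii := ii) c (fun b => z b - z' b) = hexp c z - hexp c z'.
Proof.
apply: val_inj; rewrite raddfB /=; apply/ffunP => b; rewrite !ffunE.
by case: ifP => _; [rewrite scalerBl|rewrite subr0].
Qed.

Lemma lin_ext_const0 (K : fieldType) (n : nat) (E G : mgfree K n)
    (A : fbasis E -> fbasis G -> {mpoly K[n]}) :
  (forall b b', (A b b')@_0%MM = 0) -> forall v b', (mgcoord (lin_ext A v) b')@_0%MM = 0.
Proof.
move=> A0 v b'; rewrite /mgcoord ffunE raddf_sum big1 //= => b _.
by rewrite [LHS]rmorphM /= A0 mulr0.
Qed.

Lemma free_lift_hexp (K : fieldType) (n : nat) (ii : 'I_n -> nat)
    (E : mgfree K (\sum_(j < n) ii j)%N) (G : mgfree K n)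
    (W : lmodType {mpoly K[\sum_(j < n) ii j]}) (proj : {linear expF_mod ii G -> W})
    (cl : fbasis E -> fbasis G -> K) c (z : fbasis E -> K) :
    (forall x, hsupp (bdeg (@tagnat.sig1 n ii) (fdeg x)) (cl x)) -> hsupp c z ->
  free_lift (fun x => proj (hexp (fdeg x) (cl x))) (hvec c z) =
  proj (hexp c (fun j => \sum_x z x * cl x j)).
Proof.
move=> scl sz; rewrite -hexp_sum => [|x zx j /scl]; last first.
  by move=> le; apply: lepm_trans le (bdeg_le _ (sz _ zx)).
rewrite linear_sum; apply: eq_bigr => x _; rewrite hvecE // linearZ /=.
have [->|/sz le] := eqVneq (z x) 0; first by rewrite mpolyC0 !scale0r.
by rewrite -(hexpZ (@scl x) le) linearZ /= scalerA mul_mpolyC.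
Qed.

Section Resolution.
Variables (K : fieldType) (n : nat) (ii : 'I_n -> nat) (M : mgmod K n) (F : mgcomplex K n).
Local Notation eta := (\sum_(j < n) ii j)%N.
Local Notation bl := (@tagnat.sig1 n ii).
Local Notation bdeg := (bdeg bl).
Local Notation gcomb := (@gcomb K n ii).
Local Notation C := (expansion_double ii F).
Local Notation X k := (fbasis (tot_term C k)).
Local Notation pt := (@tot_point K n ii F _).
Local Notation lam := (fun i b' b => mon_mat (cdiff F i) b' b).
Local Notation ent := (@ent K eta n F lam gcomb).
Local Notation bnd := (@bnd K eta n F lam gcomb (fun k => X k) (@tot_point K n ii F) _).
Local Notation bcell := (@bcell K n F _).
Local Notation tcoaug := (@coaug K eta n F (fun k => X k) (@tot_point K n ii F) _).

Hypothesis hF : mg_min_free_resolution F M.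

Let Fhom : forall i, mghom (cdiff F i). Proof. by case: hF => -[]. Qed.

Let Fdd i v : cdiff F i (cdiff F i.+1 v) = 0.
Proof. by case: hF => -[_ Fex _] _; apply/Fex; exists v. Qed.

Let lam_le i b' b : lam i b' b != 0 -> (fdeg b' <= fdeg b)%MM.
Proof. exact: mon_mat_le. Qed.

Let lam_comp i (b'' : fbasis (F i)) (b : fbasis (F i.+2)) :
  \sum_b' lam i b'' b' * lam i.+1 b' b = 0.
Proof. exact: mon_mat_comp. Qed.

Let gP a v : (a <= bdeg v)%MM -> isgen bl a v (gcomb a v).
Proof. exact: gcomb_isgen. Qed.

Lemma tot_ent_fdeg k (x : X k.+1) (y : X k) : ent (pt x) (pt y) != 0 ->
  (fdeg y <= fdeg x)%MM.
Proof.
move=> nz; have [wx _] := tot_point_valid x.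
rewrite !tot_point_fdeg; have := diffT_delta_pdeg lam_le gP wx nz.
by case: (pt x) => -[].
Qed.

Lemma tot_bvec k (x : X k.+1) :
  tot_diff C k (bvec x) = hvec (fdeg x) (fun y => ent (pt x) (pt y)).
Proof.
apply: mgcoord_inj => y; rewrite lin_ext_bvec tot_entry hvecE // => y'.
exact: tot_ent_fdeg.
Qed.

Lemma tot_mghom k : mghom (tot_diff C k).
Proof.
apply: linear_mghom; last exact: tot_bvec.
by move=> x y; exact: tot_ent_fdeg.
Qed.

Lemma tot_hvec k c (z : X k.+1 -> K) : hsupp c z ->
  tot_diff C k (hvec c z) = hvec c (fun y => bnd z (pt y)).
Proof.
move=> sz; apply: linear_hvec => // x; last exact: tot_bvec.
by move=> y; exact: tot_ent_fdeg.
Qed.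

Lemma hsupp_psupp k c (z : X k -> K) : hsupp c z <-> psupp (@tot_point K n ii F) c z.
Proof. by split=> h x; have := h x; rewrite tot_point_fdeg. Qed.

Lemma bnd_hsupp k c (z : X k.+1 -> K) : hsupp c z -> hsupp c (fun y : X k => bnd z (pt y)).
Proof.
move=> /hsupp_psupp sz y; rewrite tot_point_fdeg.
exact: (bnd_neq0 lam_le gP (@tot_point_valid K n ii F) sz).
Qed.

Lemma strand_lift k d (f : fbasis (F k) -> K) v : hsupp d f -> cdiff F k v = hvec d f ->
  exists2 h : fbasis (F k.+1) -> K, hsupp d h & forall b, f b = \sum_b1 lam k b b1 * h b1.
Proof.
move=> sf e; have [_ /hvec_ex[h sh ->] eh] := mg_lift (@Fhom k) e (@hvec_comp _ _ _ d f).
exists h => // b; move: eh; rewrite (mghom_hvec (@Fhom k) sh) => /hvec_inj.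
move/(_ (mon_mat_hsupp sh) sf b) <-.
by apply: eq_bigr => b1 _; rewrite mulrC.
Qed.

Lemma strand_image k d (f : fbasis (F k) -> K) (h : fbasis (F k.+1) -> K) : hsupp d h ->
  (forall b, f b = \sum_b1 lam k b b1 * h b1) -> cdiff F k (hvec d h) = hvec d f.
Proof.
move=> sh e; rewrite (mghom_hvec (@Fhom k) sh); apply: eq_hvec => b.
by rewrite e; apply: eq_bigr => b1 _; rewrite mulrC.
Qed.

(** Homogeneous parts suffice. In degree [c] the claim is exactness of the symbol complex, fed with
    the exactness of F in degree [bdeg c]. *)
Lemma tot_exact k v : tot_diff C k v = 0 <-> exists w, tot_diff C k.+1 w = v.
Proof.
split=> [|[w <-]]; last first.
  move: w; apply: mg_comp_eq0 => c _ /hvec_ex[z sz ->].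
  apply: (etrans (congr1 (tot_diff C k) (tot_hvec sz))).
  apply: (etrans (tot_hvec (bnd_hsupp sz))).
  rewrite -(hvec0 _ c); apply: eq_hvec => y.
  apply: (bnd_bnd lam_le lam_comp gP (@tot_point_inj K n ii F)).
  - exact: tot_point_valid.
  - exact: tot_point_tdeg.
  - exact: tot_point_surj.
  - exact: tot_point_valid.
move=> /(mg_ker_split (@tot_mghom k))[s [y [gy y0 ->]]].
apply: image_sum => c; have [z sz ez] := hvec_ex (gy c).
have [|||z' sz' hz'] := @symbol_exact _ _ _ _ _ _ _ lam_le lam_comp gP _ (@tot_point K n ii F)
  (@tot_point_inj K n ii F) (@tot_point_valid K n ii F) (@tot_point_tdeg K n ii F)
  (@tot_point_surj K n ii F) c k z.
- move=> f sf hf; have [-[_ Fex _] _] := hF.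
  have /Fex[w ew] : cdiff F k (hvec (bdeg c) f) = 0.
    rewrite (mghom_hvec (@Fhom k) sf) -(hvec0 _ (bdeg c)); apply: eq_hvec => b.
    by rewrite -[RHS](hf b); apply: eq_bigr => b1 _; rewrite mulrC.
  exact: strand_lift sf ew.
- exact/hsupp_psupp.
- move=> y'; have := y0 c; rewrite ez (tot_hvec sz) -(hvec0 _ c) => /hvec_inj; apply.
    exact: bnd_hsupp.
  by move=> x; rewrite eqxx.
exists (hvec c z'); rewrite ez (tot_hvec (proj2 (hsupp_psupp c z') sz')).
by apply: eq_hvec => x; rewrite hz'.
Qed.

Lemma mdeg_pdeg (q : {i : nat & fbasis (F i)} * {set 'I_eta} * 'X_{1..eta}) :
  mdeg (pdeg q) = (#|q.1.2| + mdeg q.2)%N.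
Proof.
rewrite !mdegE; under eq_bigr do rewrite mnmE; rewrite big_split /=; congr (_ + _)%N.
by rewrite -sum1_card [RHS]big_mkcond; apply: eq_bigr => i _; case: (i \in q.1.2).
Qed.

(** A constant term needs equal multidegrees. Exchange and Koszul terms lose an element of sigma
    while the degree of u does not grow. A row term then joins generators of F of equal degree, and
    its entry is zero by minimality of F. *)
Lemma tot_minimal : minimal_complex (tot_complex C).
Proof.
move=> k; apply: lin_ext_const0 => x y; rewrite tot_entry mcoeffZ mcoeffX.
have [->|nz] := eqVneq (ent (pt x) (pt y)) 0; first by rewrite mul0r.
case: (eqVneq (fdeg x - fdeg y)%MM 0%MM) => [e0|_]; last by rewrite mulr0.
exfalso; have := submK (tot_ent_fdeg nz); rewrite e0 add0m => /(congr1 (@mdeg _)).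
rewrite !tot_point_fdeg !mdeg_pdeg.
have [wx _] := tot_point_valid x; move: nz wx; rewrite /ent.
move: (pt x) (pt y) => [[l sigma] u] q /= nz wx.
have ltD t : t \in sigma -> (#|sigma :\ t| < #|sigma|)%N 
  by move=> ts; have := cardsD1 t sigma; rewrite ts => ->.
move: (diffT_delta_neq0 lam_le nz) => {nz} [[l' [rn tl le ->]]|[t /ltD ts ->]|[t /ltD ts ->]] /=.
- move=> /addnI; rewrite -!(mdeg_bdeg bl).
  have [_ -> _] := g_isgen gP wx le; rewrite wx => /esym/(lem_mdeg_eq le) ed.
  case: l l' rn tl le wx ed => i b [i' b'] rn /= tl; move/esym: tl => tl; case: i / tl b rn => b rn _ _ ed.
  move: rn => /=; rewrite (bigD1 b') //= big1 => [|b1 ne].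
    rewrite eqxx mulr1 addr0 /mon_mat; case: ifP => _; last by rewrite eqxx.
    move: ed; rewrite /cdeg /= => ->; rewrite (_ : fdeg b - fdeg b = 0)%MM; last first.
      by apply/mnmP => j; rewrite mnmBE subnn mnm0E.
    by have [_ ->] := hF; rewrite eqxx.
  case: eqP => [e|_]; last by rewrite mulr0.
  by rewrite (@bcell_inj K n F i' _ _ e) eqxx in ne.
- move=> e; have := exch_wf gP t wx; rewrite /wf -wx => /(congr1 (@mdeg _)).
  by rewrite !mdeg_bdeg => e'; move: ts; rewrite e' in e; move/addIn: e => ->; rewrite ltnn.
- by move=> /addIn e; rewrite e ltnn in ts.
Qed.


(** * The augmentation of T(C) onto the cokernel of psi^* *)

Section Augmentation.
Variables (E1 E0 : mgfree K n) (psi : {linear E1 -> E0}) (e_E : {linear E0 -> M})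
  (e_F : {linear F 0%N -> M}).
Hypotheses (hpsi : mghom psi) (hE : mghom e_E) (cE : is_coker psi e_E).
Hypotheses (hFM : mghom e_F) (cF : is_coker (cdiff F 0) e_F).
(* The columns of a lift F_0 -> E_0 of the identity of M. *)
Variable L : fbasis (F 0%N) -> fbasis E0 -> K.
Hypotheses (sL : forall b, hsupp (fdeg b) (L b))
  (eL : forall b, e_E (hvec (fdeg b) (L b)) = e_F (bvec b)).

Lemma lift_hsupp d (f : fbasis (F 0%N) -> K) : hsupp d f ->
  hsupp d (fun j => \sum_b f b * L b j).
Proof.
move=> sf j nz; apply: contrapT => hn; case/eqP: nz; rewrite big1 // => b _.
have [->|/sf le] := eqVneq (f b) 0; first by rewrite mul0r.
have [->|/sL leb] := eqVneq (L b j) 0; first by rewrite mulr0.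
by case: hn; exact: lepm_trans le.
Qed.

Lemma lift_hvec d (f : fbasis (F 0%N) -> K) : hsupp d f ->
  e_E (hvec d (fun j => \sum_b f b * L b j)) = e_F (hvec d f).
Proof.
move=> sf; rewrite [in RHS]hvec_bvec // -hvec_sum => [|b fb j /sL]; last first.
  by move=> le; apply: lepm_trans le (sf _ fb).
rewrite !linear_sum /=; apply: eq_bigr => b _; rewrite !linearZ /= -eL.
have [->|/sf le] := eqVneq (f b) 0; first by rewrite mpolyC0 !scale0r.
by rewrite -(hvecZ (@sL b) le) linearZ /= scalerA mul_mpolyC.
Qed.

Local Notation Mstar := (expansion ii psi).
Local Notation proj := (coker_pi (expM ii psi)).

(** M^* in degree [c] is M in degree [bdeg c]: lying in the image of psi^* or of psi is the same
    linear system over K. *)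
Lemma proj_hexp c (z : fbasis E0 -> K) : hsupp (bdeg c) z ->
  proj (hexp c z) = 0 <-> e_E (hvec (bdeg c) z) = 0.
Proof.
move=> sz; split=> [/(coker_is_coker _).2[u eu]|/cE.2[u eu]].
  have [_ /hexp_ex[z' sz' ->] eu'] := mg_lift (@expM_mghom _ _ ii _ _ psi) eu (@hexp_comp _ _ ii _ c z).
  apply/cE.2; exists (hvec (bdeg c) z'); rewrite mghom_hvec //.
  apply: eq_hvec; move: eu'; rewrite hexp_expM // => /hexp_inj; apply=> //.
  exact: mon_mat_hsupp.
have [_ /hvec_ex[z' sz' ->] eu'] := mg_lift hpsi eu (@hvec_comp _ _ _ (bdeg c) z).
apply/(coker_is_coker _).2; exists (hexp c z'); rewrite hexp_expM //; congr hexp.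
apply/funext; move: eu'; rewrite mghom_hvec // => /hvec_inj; apply=> //.
exact: mon_mat_hsupp.
Qed.

(** A symbol of degree 0 lies over exactly one generator of F_0; the indicator selects its column of
    [L] without a transport along an equality of cells. *)
Definition cell_lift (x : X 0) (j : fbasis E0) : K :=
  \sum_b ((pt x).1.1 == bcell b)%:R * L b j.

Lemma cell_lift_hsupp x : hsupp (bdeg (fdeg x)) (cell_lift x).
Proof.
move=> j nz; apply: contrapT => hn; case/eqP: nz; rewrite /cell_lift big1 // => b _.
case: eqP => [e|_]; last by rewrite mul0r.
have [->|/sL le] := eqVneq (L b j) 0; first by rewrite mulr0.
case: hn; apply: lepm_trans le _; have [+ _] := tot_point_valid x.
rewrite e => e'; rewrite -[fdeg b]e'; apply: bdeg_le; rewrite tot_point_fdeg.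
by apply/mnm_lepP => i; rewrite set_monE leq_addl.
Qed.

Definition tot_aug : {linear tot_term C 0 -> Mstar} :=
  free_lift (fun x : X 0 => proj (hexp (fdeg x) (cell_lift x)) : Mstar).

Lemma sum_cell_lift (z : X 0 -> K) j :
  \sum_x z x * cell_lift x j = \sum_b tcoaug z b * L b j.
Proof.
rewrite /cell_lift /coaug; under eq_bigr do rewrite big_distrr /=.
rewrite exchange_big; apply: eq_bigr => b _ /=; rewrite big_distrl.
by apply: eq_bigr => x _; rewrite mulrA.
Qed.

Lemma tot_aug_hvec c (z : X 0 -> K) : hsupp c z ->
  tot_aug (hvec c z) = proj (hexp c (fun j => \sum_b tcoaug z b * L b j)).
Proof.
move=> sz; apply: (etrans (free_lift_hexp proj cell_lift_hsupp sz)).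
by congr (proj (hexp c _)); apply/funext => j; exact: sum_cell_lift.
Qed.

Lemma tot_aug_mghom : mghom tot_aug.
Proof.
move=> c _ /hvec_ex[z sz ->]; rewrite tot_aug_hvec //.
by exists (hexp c (fun j => \sum_b tcoaug z b * L b j)) => //; exact: hexp_comp.
Qed.

Lemma coaug_hsupp c (z : X 0 -> K) : hsupp c z -> hsupp (bdeg c) (tcoaug z).
Proof. by move=> /hsupp_psupp; apply: coaug_fsupp; exact: tot_point_valid. Qed.

Lemma tot_aug_eq0 c (z : X 0 -> K) : hsupp c z ->
  tot_aug (hvec c z) = 0 <-> exists2 h : fbasis (F 1) -> K, hsupp (bdeg c) h &
    forall b, tcoaug z b = \sum_b1 lam 0%N b b1 * h b1.
Proof.
move=> sz; have sc := coaug_hsupp sz; rewrite tot_aug_hvec // proj_hexp ?lift_hvec //; last first.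
  exact: lift_hsupp.
split=> [/cF.2[w ew]|[h sh eh]]; first exact: strand_lift sc ew.
by apply/cF.2; exists (hvec (bdeg c) h); exact: strand_image.
Qed.

Lemma tot_aug_coker : is_coker (tot_diff C 0) tot_aug.
Proof.
split=> [y|v]; last split=> [|[w <-]].
- have [v <-] := (coker_is_coker (expM ii psi)).1 y; move: v {y}.
  apply: mg_image => c _ /hexp_ex[z sz ->].
  have [f' ef'] := cF.1 (e_E (hvec (bdeg c) z)).
  have [_ /hvec_ex[f sf ->] ef] := mg_lift hFM ef' (hE (@hvec_comp _ _ _ (bdeg c) z)).
  have sl := crit_lift_psupp gP (pt := @tot_point K n ii F) sf.
  (* On coefficients [crit_lift] is a section of the augmentation, so a preimage in F_0 of the class
     of [z] yields one in T(C). *)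
  exists (hvec c (crit_lift gcomb (@tot_point K n ii F) c f)).
  rewrite tot_aug_hvec; last exact/hsupp_psupp.
  apply/eqP; rewrite -subr_eq0 -linearB -hexpB; apply/eqP.
  set f1 := tcoaug _; have -> : f1 = f.
    apply/funext => b; apply: coaug_lift => //.
    * exact: gP.
    * exact: tot_point_inj.
    * exact: tot_point_surj.
    * exact: sf.
  apply: (proj2 (proj_hexp (hsuppB (lift_hsupp sf) sz))).
  by rewrite hvecB linearB /= lift_hvec // ef subrr.
- move=> /(mg_ker_split tot_aug_mghom)[s [y [gy y0 ->]]].
  apply: image_sum => c; have [z sz ez] := hvec_ex (gy c).
  have := y0 c; rewrite ez (tot_aug_eq0 sz) => -[h sh eh].
  have [z' sz' hz'] := symbol_exact0 lam_le lam_comp gP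
    (@tot_point_inj K n ii F) (@tot_point_valid K n ii F) (@tot_point_tdeg K n ii F)
    (@tot_point_surj K n ii F) (proj1 (hsupp_psupp c z) sz) sh eh.
  exists (hvec c z'); rewrite (tot_hvec (proj2 (hsupp_psupp c z') sz')).
  by apply: eq_hvec => x; rewrite hz'.
move: w; apply: mg_comp_eq0 => c _ /hvec_ex[z sz ->].
apply: (etrans (congr1 tot_aug (tot_hvec sz))).
apply: (proj2 (tot_aug_eq0 (bnd_hsupp sz))).
exists (coaug (@tot_point K n ii F) z : fbasis (F 1) -> K) => [|b].
  by apply: coaug_fsupp; [exact: tot_point_valid|exact/hsupp_psupp].
apply: coaug_bnd => //.
- exact: gP.
- exact: tot_point_inj.
- exact: tot_point_valid.
- exact: tot_point_tdeg.
- exact: tot_point_surj.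
Qed.

End Augmentation.
End Resolution.

Theorem theorem3p8 (K : fieldType) (n : nat) (ii : 'I_n -> nat)
    (hii : forall j, (0 < ii j)%N)
    (M : mgmod K n) (hM : fin_gen M)
    (p : nat) (F : mgcomplex K n)
    (hF : mg_min_free_resolution F M) (hp : length_le F p)
    (E1 E0 : mgfree K n) (psi : {linear E1 -> E0})
    (hpsi : mg_presentation psi M) :
  mg_min_free_resolution (tot_complex (expansion_double ii F)) (expansion ii psi).
Proof.
have [psi_hom [e_E [hE cE]]] := hpsi.
have [[_ _ [e_F [hFM cF]]] _] := hF.
(* Surjectivity of [e_E] gives a preimage, and passing to its component of degree [fdeg b] makes it
   homogeneous. *)
have lift b : {z : fbasis E0 -> K | hsupp (fdeg b) z /\ e_E (hvec (fdeg b) z) = e_F (bvec b)}.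
  apply: cid; have [v ev] := cE.1 (e_F (bvec b)).
  have [_ /hvec_ex[z sz ->] ez] := mg_lift hE ev (hFM _ _ (@bvec_comp _ _ _ b)).
  by exists z.
pose L b := sval (lift b).
have sL b : hsupp (fdeg b) (L b) by have [] := svalP (lift b).
have eL b : e_E (hvec (fdeg b) (L b)) = e_F (bvec b) by have [] := svalP (lift b).
split; last exact: tot_minimal hF.
split; first exact: tot_mghom.
- exact: (@tot_exact K n ii M F hF).
exists (@tot_aug K n ii F E1 E0 psi L); split; first exact: tot_aug_mghom.
apply: tot_aug_coker; eassumption.
Qed.
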